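(* Let $\alpha\in(0,1)$. Let $\psi$ be a function on $[0,T]\times\frac1N\mathbb T_N^n$ such that $\xi_e=\xi_e^N:=\nabla_e^N\psi$ ($|e|=1$, $e>0$) satisfies the system $$\partial_t\xi_e=-\nabla^N_e\Big\{\bar a\sum_{|e'|=1,e'>0}\nabla^{N,*}_{e'}\xi_{e'}\Big\}+\nabla^N_eg,$$ where the functions $\bar a=\bar a(t,\frac xN)$ and $g=g(t,\frac xN)$ (with $g$ continuous in $t$) satisfy (B.1) $c_-\le\bar a\le c_+$ with $0<c_-<c_+<\infty$; (B.2) $[\bar a]^{*,N}_\alpha\le\bar A<\infty$; (B.3) $|\nabla^Ng|^{(1),N}_0\le G^1_0<\infty$. Then, with $C=C(n,c_\pm,T,\alpha)$ independent of $N$, $$|\tilde\xi^N_\cdot|^{(1)}_{1+\alpha}\le C\Big[(\bar A+1)^{1+\frac1\alpha}|\tilde\xi^N_\cdot|^{(1)}_0+G^1_0\Big]$$ and $$U_2\le C\Big[(\bar A+1)^{\frac1\alpha}|\tilde\xi^N_\cdot|^{(1)}_0+(\bar A+1)^{-1}G_0^1\Big].$$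
   Context: Lattice notation. $N\in\mathbb N$, $T>0$ fixed, $\mathbb T^n=\mathbb R^n/\mathbb Z^n$, $\mathbb T_N^n=(\mathbb Z/N\mathbb Z)^n$; functions on $\frac1N\mathbb T^n_N\subset\mathbb T^n$ are written $u(\frac xN)$. For $e\in\mathbb Z^n$, $|e|=1$: $\nabla_e^Nu(\frac xN)=N(u(\frac{x+e}N)-u(\frac xN))$, $\nabla_e^{N,*}=\nabla^N_{-e}$. ''$e>0$'' means that the nonzero component of $e$ is $1$. Norms. $\Omega=[0,T]\times\mathbb T^n$, $\Omega_N=[0,T]\times\frac1N\mathbb T_N^n$. For $X=(t,z)$, $Y=(s,y)$: $|X-Y|=\max\{|t-s|^{1/2},|z-y|\}$ with $|z-y|$ the Euclidean distance on the torus, and $d(X)=\sqrt t$. For $F$ on $\Omega$, $\nabla^N_eF(t,z)=N(F(t,z+\frac eN)-F(t,z))$, and $|\nabla^NF(X)-\nabla^NF(Y)|=\max_{|e|=1,e>0}|\nabla^N_eF(X)-\nabla_e^NF(Y)|$. The polylinear interpolation in space of a function $u$ on $\Omega_N$ is $\tilde u(t,z)=\sum_{v\in\{0,1\}^n}\prod_{i=1}^n\vartheta(v_i,z_i)\,u(t,\frac{[Nz]+v}N)$, where $\vartheta(1,b)=\{Nb\}$, $\vartheta(0,b)=1-\{Nb\}$ and $[\cdot],\{\cdot\}$ are (componentwise) integer and fractional parts. $[\bar a]^{*,N}_\alpha=\sup_{X\neq Y\in\Omega_N}(d(X)\wedge d(Y))^\alpha\frac{|\bar a(X)-\bar a(Y)|}{|X-Y|^\alpha}$;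 $|\nabla^Ng|_0^{(1),N}=\max_{|e|=1}\sup_{X\in\Omega_N}d(X)|\nabla^N_eg(X)|$. $[F]^{(1)}_{1+\alpha}=\sup_{X\ne Y\in\Omega}(d(X)\wedge d(Y))^{2+\alpha}\frac{|\nabla^NF(X)-\nabla^NF(Y)|}{|X-Y|^\alpha}$; $\langle F\rangle^{(1),N}_{1+\alpha}=\sup(d(X)\wedge d(Y))^{2+\alpha}\frac{|F(X)-F(Y)|}{|t-s|^{(1+\alpha)/2}}$ over $X=(t,\frac xN)\ne Y=(s,\frac xN)$ in $\Omega_N$ with the same spatial coordinate. With maxima over unit vectors $e,e_1,e_2>0$: $U_2=\max_{e_1,e_2}\sup_{X\in\Omega}d(X)^2|\nabla^N_{e_1}\tilde\xi^N_{e_2}(X)|$, $U_{2+\alpha}=\max_e[\tilde\xi^N_e]^{(1)}_{1+\alpha}$, $|\tilde\xi^N_\cdot|_0^{(1)}=\max_e\sup_{X\in\Omega}d(X)|\tilde\xi_e^N(X)|$, and $|\tilde\xi^N_\cdot|^{(1)}_{1+\alpha}=U_2+U_{2+\alpha}+\max_e\langle\xi^N_e\rangle^{(1),N}_{1+\alpha}$. *)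

(* Defs.v *)
From HB Require Import structures.
From mathcomp Require Import all_boot all_order all_algebra.
From mathcomp Require Import all_classical all_reals all_analysis.

Set Implicit Arguments.
Unset Strict Implicit.
Unset Printing Implicit Defensive.
Import Order.TTheory GRing.Theory Num.Theory.
Import numFieldNormedType.Exports.

Local Open Scope classical_set_scope.
Local Open Scope ring_scope.

(* The discrete torus (Z/NZ)^n, meant for 0 < N, when N.-1.+1 = N ('Z_N is not
   usable, since it is Z/2Z for N = 1). Points of T^n = R^n/Z^n are represented
   by their representatives in [0,1[^n (see [Omega]); functions on T^n are
   Z^n-periodic functions of z : 'rV[R]_n. *)
Notation lattice n N := ('rV['I_N.-1.+1]_n).

(* Functions of (t,z) are only ever looked at for t in [0,T]; their values at
   other times are irrelevant. *)

Definition modN (n N : nat) (k : 'rV[int]_n) : lattice n N :=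
  \row_i inZp `|(k ord0 i %% N)%Z|%N.

Definition pos_unit (n : nat) (i : 'I_n) : 'rV[int]_n := delta_mx 0 i.

Definition offdiag (U : Type) (A : set U) : set (U * U) :=
  [set P | [/\ A P.1, A P.2 & P.1 <> P.2]].

Section Notions.
Context {R : realType} {n : nat}.

Definition eucl (v : 'rV[R]_n) : R := Num.sqrt (\sum_i v 0 i ^+ 2).

Definition torus_dist (z y : 'rV[R]_n) : R :=
  inf [set eucl (z - y + map_mx intr k) | k in [set: 'rV[int]_n]].

Definition parab_dist (X Y : R * 'rV[R]_n) : R :=
  Num.max (Num.sqrt `|X.1 - Y.1|) (torus_dist X.2 Y.2).

(* d(X) = sqrt t and d(X) /\ d(Y), for space variables of any kind *)
Definition dpar {S : Type} (X : R * S) : R := Num.sqrt X.1.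
Definition dmin {S : Type} (P : (R * S) * (R * S)) : R :=
  Num.min (dpar P.1) (dpar P.2).

Definition Omega (T : R) : set (R * 'rV[R]_n) :=
  [set X : R * 'rV[R]_n | 0 <= X.1 <= T /\ forall i, 0 <= X.2 0 i < 1].

Section Mesh.
Variable N : nat.

Definition OmegaN (T : R) : set (R * lattice n N) :=
  [set X | 0 <= X.1 <= T].

Definition emb (x : lattice n N) : 'rV[R]_n := \row_i ((x 0 i : nat)%:R / N%:R).

Definition embX (X : R * lattice n N) : R * 'rV[R]_n := (X.1, emb X.2).

Definition nablaN (e : 'rV[int]_n) (u : lattice n N -> R) (x : lattice n N) : R :=
  N%:R * (u (x + modN N e) - u x).

Definition nablaN_adj (e : 'rV[int]_n) := nablaN (- e).

Definition nabla (e : 'rV[int]_n) (F : R -> 'rV[R]_n -> R) (X : R * 'rV[R]_n) : R :=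
  N%:R * (F X.1 (X.2 + N%:R^-1 *: map_mx intr e) - F X.1 X.2).

Definition nabla_dist (F : R -> 'rV[R]_n -> R) (X Y : R * 'rV[R]_n) : R :=
  \big[Num.max/0]_(i < n)
    `|nabla (pos_unit i) F X - nabla (pos_unit i) F Y|.

Definition vartheta (v : bool) (b : R) : R :=
  let frac := N%:R * b - (Num.floor (N%:R * b))%:~R in
  if v then frac else 1 - frac.

Definition interp (u : R -> lattice n N -> R) (t : R) (z : 'rV[R]_n) : R :=
  \sum_(v : {ffun 'I_n -> bool})
    (\prod_(i < n) vartheta (v i) (z 0 i)) *
    u t (modN N (\row_i (Num.floor (N%:R * z 0 i) + (v i : nat)%:Z))).

(* [a]^{*,N}_alpha *)
Definition holder_starN (T alpha : R) (a : R -> lattice n N -> R) : \bar R :=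
  ereal_sup [set (dmin P `^ alpha * (`|a P.1.1 P.1.2 - a P.2.1 P.2.2|
                    / parab_dist (embX P.1) (embX P.2) `^ alpha))%:E
            | P in offdiag (OmegaN T)].

(* |nabla^N g|^{(1),N}_0; the maximum is over both e_i and -e_i *)
Definition grad_sup1N (T : R) (g : R -> lattice n N -> R) : \bar R :=
  let S e := ereal_sup [set (dpar X * `|nablaN e (g X.1) X.2|)%:E
                       | X in OmegaN T] in
  \big[maxe/-oo%E]_(i < n) maxe (S (pos_unit i)) (S (- pos_unit i)).

(* [F]^{(1)}_{1+alpha} *)
Definition holder1 (T alpha : R) (F : R -> 'rV[R]_n -> R) : \bar R :=
  ereal_sup [set (dmin P `^ (2 + alpha) *
                    (nabla_dist F P.1 P.2 / parab_dist P.1 P.2 `^ alpha))%:E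
            | P in offdiag (Omega T)].

(* <F>^{(1),N}_{1+alpha} *)
Definition time_holder1N (T alpha : R) (F : R -> lattice n N -> R) : \bar R :=
  ereal_sup [set (dmin P `^ (2 + alpha) *
                    (`|F P.1.1 P.1.2 - F P.2.1 P.2.2|
                     / `|P.1.1 - P.2.1| `^ ((1 + alpha) / 2)))%:E
            | P in offdiag (OmegaN T) `&` [set P | P.1.2 = P.2.2]].

(* The norms below are those of a family [xi i] indexed by the unit vectors
   e_i > 0. *)

Definition U2 (T : R) (xi : 'I_n -> R -> lattice n N -> R) : \bar R :=
  \big[maxe/-oo%E]_(i < n) \big[maxe/-oo%E]_(j < n)
    ereal_sup [set (dpar X ^+ 2 * `|nabla (pos_unit i) (interp (xi j)) X|)%:E
              | X in Omega T].

Definition U2alpha (T alpha : R) (xi : 'I_n -> R -> lattice n N -> R) : \bar R :=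
  \big[maxe/-oo%E]_(i < n) holder1 T alpha (interp (xi i)).

(* |xi~|^{(1)}_0 *)
Definition norm1_0 (T : R) (xi : 'I_n -> R -> lattice n N -> R) : \bar R :=
  \big[maxe/-oo%E]_(i < n)
    ereal_sup [set (dpar X * `|interp (xi i) X.1 X.2|)%:E | X in Omega T].

(* |xi~|^{(1)}_{1+alpha} *)
Definition norm1_1alpha (T alpha : R) (xi : 'I_n -> R -> lattice n N -> R)
    : \bar R :=
  (U2 T xi + U2alpha T alpha xi
   + \big[maxe/-oo%E]_(i < n) time_holder1N T alpha (xi i))%E.

Definition grad_family (psi : R -> lattice n N -> R)
    (i : 'I_n) (t : R) (x : lattice n N) : R :=
  nablaN (pos_unit i) (psi t) x.

(* f'(t) = l relative to [0,T]: one-sided at the end points *)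
Definition is_time_deriv (T : R) (f : R -> R) (t l : R) : Prop :=
  (fun s => (f s - f t) / (s - t)) @ within `[0, T] t^' --> l.

(* The system is only required for 0 < t <= T: all the norms above carry a
   weight which vanishes at t = 0. *)
Definition solves_system (T : R) (abar g : R -> lattice n N -> R)
    (xi : 'I_n -> R -> lattice n N -> R) : Prop :=
  forall (i : 'I_n) (t : R) (x : lattice n N), 0 < t <= T ->
    is_time_deriv T (fun s => xi i s x) t
      (- nablaN (pos_unit i)
           (fun y => abar t y * \sum_(j < n) nablaN_adj (pos_unit j) (xi j t) y) x
       + nablaN (pos_unit i) (g t) x).

End Mesh.
End Notions.

(* Main.v *)
(* Since every weight depends on time only, no space cutoff is needed.  Fix
   X = (t0, x0), freeze a = abar X, and let P_s be the heat semigroup of the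
   lattice Laplacian.  Gamma-calculus gives the pointwise inequality
     (D^k P_s u)^2 <= (k / s)^k P_s (u^2),
   with constants that do not see the mesh.  For
     F(r) = D^es P_(a r) xi_j(t0 - r)
   one has F' = - D^es P_(a r) D_j f with f = (abar - a) lap psi + g; as f
   vanishes at X like |.|^alpha, up to g, and P_s dist^2 <= dist^2 + 2 n s, this
   yields |F'(r)| <= C r^((alpha - |es| - 1) / 2) by the inequality above.
   Integrating F' up to r = la^2 t0 with la^alpha ~ 1 / (A + 1) bounds the second
   differences and lets the U_2 term be absorbed; comparing F at r = rho^2 at two
   points at distance rho gives the Hoelder bounds.  Finally, polylinear
   interpolation is an average over independent roundings of the coordinates,
   so that coupling the roundings of two points transfers the Hoelder bounds
   from the lattice to the torus. *)

From HB Require Import structures.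
Require Import Defs.
From mathcomp Require Import all_boot all_order all_algebra.
From mathcomp Require Import all_classical all_reals all_analysis.
From mathcomp Require Import ring lra zify.

Set Implicit Arguments.
Unset Strict Implicit.
Unset Printing Implicit Defensive.
Import Order.TTheory GRing.Theory Num.Theory.
Import numFieldNormedType.Exports.

Local Open Scope classical_set_scope.
Local Open Scope ring_scope.

(** * Lattice differences and the heat kernel *)

(** Only the differences [xi] of [psi] obey an equation, and its right-hand side is a full
    difference of the rough function [abar lap psi + g]. Moving that difference to the kernel costs
    [r^(-1/2)], and the Hoelder continuity of [abar] returns [r^(alpha/2)]. The integral of [F']
    thus converges at [r = 0] for second differences of [psi] and diverges for third ones. Third
    differences are therefore bounded only after smoothing for a time [r], which suffices: over a
    distance [rho = sqrt r] they contribute [rho * rho^(alpha - 1)]. The powers of [A + 1] come from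
    the absorption scale: the term [M / la] gives [(A + 1)^(1/alpha) M], the term [la^alpha G] gives
    [G / (A + 1)], and the Hoelder bounds see the resulting bound [B] multiplied by [A + 1]. The
    analysis takes place on any finite abelian group with marked steps [eps]. The torus enters
    through a single function [q], its squared distance to 0, of which only semiconcavity and
    comparison with multiples of the steps are used. *)

Section RealAux.
Context {R : realType}.

Lemma cvg_sumr (I : Type) (r : seq I) (u : I -> R^nat) (l : I -> R) :
  (forall i, u i k @[k --> \oo] --> l i) ->
  \sum_(i <- r) u i k @[k --> \oo] --> \sum_(i <- r) l i.
Proof.
move=> h; elim: r => [|i r IH].
  rewrite big_nil; under eq_fun do rewrite big_nil.
  exact: cvg_cst.
rewrite big_cons; under eq_fun do rewrite big_cons.
exact: cvgD.
Qed.

Lemma is_derive_sumr (I : Type) (r : seq I) (h : I -> R -> R) (x : R) (dh : I -> R) :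
  (forall i, is_derive x 1 (h i) (dh i)) ->
  is_derive x 1 (fun s => \sum_(i <- r) h i s) (\sum_(i <- r) dh i).
Proof.
move=> hd; elim: r => [|i r IH].
  rewrite big_nil; under eq_fun do rewrite big_nil.
  exact: is_derive_cst.
rewrite big_cons; under eq_fun do rewrite big_cons.
exact: is_deriveD.
Qed.

Lemma is_deriveMr (f g : R -> R) (x df dg : R) :
  is_derive x 1 f df -> is_derive x 1 g dg ->
  is_derive x 1 (fun s => f s * g s) (df * g x + f x * dg).
Proof.
move=> hf hg; apply: is_derive_eq (is_deriveM hf hg) _.
by rewrite /GRing.scale/= addrC mulrC; congr (_ + _); rewrite mulrC.
Qed.

End RealAux.

Section Diff.
Context {R : realType} {L : finZmodType} {n : nat}.
Variables (eps : 'I_n -> L) (nu : R).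
Implicit Types (u v : L -> R) (x y e : L) (s t : R).

Definition fdiff e u x : R := nu * (u (x + e) - u x).

Definition lap u x : R :=
  \sum_i nu ^+ 2 * (u (x + eps i) + u (x - eps i) - 2 * u x).

Lemma lapE u x : lap u x = - \sum_i fdiff (- eps i) (fdiff (eps i) u) x.
Proof.
rewrite /lap/fdiff -sumrN; apply: eq_bigr => i _.
by rewrite addrNK; ring.
Qed.

Lemma sum_shift (e : L) u : \sum_x u (x + e) = \sum_x u x.
Proof.
rewrite [RHS](reindex_inj (addIr e)) //.
Qed.

Lemma sum_lap u : \sum_x lap u x = 0.
Proof.
rewrite exchange_big big1//= => i _.
rewrite -mulr_sumr !big_split/= !sum_shift sumrN -mulr_sumr; ring.
Qed.

Lemma lap_shift u x y : lap (fun z => u (x + z)) y = lap u (x + y).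
Proof. by rewrite /lap; apply: eq_bigr => i _; rewrite !addrA. Qed.

Lemma lap_sym u v : \sum_x lap u x * v x = \sum_x u x * lap v x.
Proof.
rewrite /lap.
under eq_bigr do rewrite mulr_suml; rewrite exchange_big/=.
under [RHS]eq_bigr do rewrite mulr_sumr; rewrite [RHS]exchange_big/=.
apply: eq_bigr => i _.
have E1 : \sum_x u (x + eps i) * v x = \sum_x u x * v (x - eps i).
  by rewrite -[RHS](sum_shift (eps i)); apply: eq_bigr => x _; rewrite addrK.
have E2 : \sum_x u (x - eps i) * v x = \sum_x u x * v (x + eps i).
  by rewrite -[RHS](sum_shift (- eps i)); apply: eq_bigr => x _; rewrite addrNK.
transitivity (nu ^+ 2 * (\sum_x u (x + eps i) * v x +
  \sum_x u (x - eps i) * v x - 2 * \sum_x u x * v x)).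
  by rewrite mulr_sumr -sumrN -!big_split/= mulr_sumr; apply: eq_bigr => x _; ring.
rewrite E1 E2 mulr_sumr -sumrN -!big_split/= mulr_sumr; apply: eq_bigr => x _; ring.
Qed.

End Diff.

(** * The heat kernel as a power series in time *)

Section Kernel.
Context {R : realType} {L : finZmodType} {n : nat}.
Variables (eps : 'I_n -> L) (nu : R).
Hypotheses (n0 : (0 < n)%N) (nu0 : 0 < nu).
Implicit Types (u v : L -> R) (x y e : L) (s t : R).
Local Notation lap := (lap eps nu).

Definition walk_step u x : R := (2 * n%:R)^-1 * \sum_i (u (x + eps i) + u (x - eps i)).
Definition walk_rate : R := 2 * n%:R * nu ^+ 2.

Let n0R : (n%:R : R) != 0. Proof. by rewrite pnatr_eq0 -lt0n. Qed.

(** Splitting off the diagonal part of the generator leaves a power series with nonnegative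
    coefficients, multiplied by [expR (- (walk_rate * s))]; positivity of the kernel is then
    visible. *)
Let lap_step u x : lap u x = walk_rate * walk_step u x - walk_rate * u x.
Proof.
rewrite /lap/walk_step/walk_rate.
transitivity (nu ^+ 2 * \sum_i (u (x + eps i) + u (x - eps i)) - walk_rate * u x).
  rewrite /walk_rate [X in X - _]mulr_sumr.
  have -> : 2 * n%:R * nu ^+ 2 * u x = \sum_(i < n) (nu ^+2 * (2 * u x)).
    by rewrite sumr_const card_ord -[RHS]mulr_natr; ring.
  by rewrite -sumrN -big_split/=; apply: eq_bigr => i _; ring.
congr (_ - _); field.
by rewrite n0R.
Qed.

Definition walk_law (m : nat) : L -> R := iter m walk_step (fun y => (y == 0)%:R).

Let jump_bnd m y : 0 <= walk_law m y <= 1.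
Proof.
rewrite /walk_law; elim: m y => [|m IH] y /=; first by case: eqP; rewrite ?lexx ?ler01.
rewrite /walk_step; have n1 : 0 < (2 * n%:R : R) by rewrite mulr_gt0// ltr0n.
rewrite mulr_ge0/=; last 2 first.
- by rewrite invr_ge0 ltW.
- by apply: sumr_ge0 => i _; rewrite addr_ge0//; have /andP[] := IH (y + eps i); have /andP[] := IH (y - eps i).
rewrite mulrC ler_pdivrMr// mul1r.
apply: (@le_trans _ _ (\sum_(i < n) 2)).
  apply: ler_sum => i _.
  have /andP[_ h1] := IH (y + eps i); have /andP[_ h2] := IH (y - eps i); lra.
by rewrite sumr_const card_ord mulr_natr.
Qed.

(** Stated for an arbitrary sequence [b], because differentiating the series in time merely shifts
    [b] and multiplies it by [walk_rate]. *)
Definition pois_coef (b : nat -> R) m : R := walk_rate ^+ m / m`!%:R * b m.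

Let Lam_ge0 : 0 <= walk_rate. Proof. by rewrite /walk_rate mulr_ge0// sqr_ge0. Qed.

Let cvg_coef (b : nat -> R) s : (forall m, 0 <= b m <= 1) -> cvgn (pseries (pois_coef b) s).
Proof.
move=> hb; apply: normed_cvg.
apply: (@series_le_cvg _ _ (exp_coeff (walk_rate * `|s|))).
- by move=> m /=; exact: normr_ge0.
- by move=> m; rewrite /exp_coeff/= divr_ge0// exprn_ge0// mulr_ge0.
- move=> m; rewrite /pois_coef /exp_coeff/= normrM normrX.
  have /andP[b0 b1] := hb m.
  have l0 : 0 <= walk_rate ^+ m / m`!%:R by rewrite divr_ge0// exprn_ge0.
  have -> : (walk_rate * `|s|) ^+ m / m`!%:R = walk_rate ^+ m / m`!%:R * `|s| ^+ m.
    by rewrite (exprMn m walk_rate) mulrAC.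
  rewrite ler_wpM2r ?exprn_ge0// ger0_norm ?mulr_ge0 ?exprn_ge0//.
  by rewrite ler_piMr.
- exact: is_cvg_series_exp_coeff.
Qed.

Let diffs_coef b : pseries_diffs (pois_coef b) = pois_coef (fun m => walk_rate * b m.+1).
Proof.
apply/funext => m; rewrite /pseries_diffs /pois_coef factS natrM exprS.
have h : (m`!%:R : R) != 0 by rewrite pnatr_eq0 -lt0n fact_gt0.
have h' : (m.+1%:R : R) != 0 by rewrite pnatr_eq0.
by move: (m.+1%:R : R) h' (m`!%:R : R) h => c c0 d d0; field; rewrite c0 d0.
Qed.

Let coefZ (c : R) b s : pseries (pois_coef (fun m => c * b m)) s = (fun k => c * pseries (pois_coef b) s k).
Proof.
apply/funext => k; rewrite /pseries /series/= mulr_sumr; apply: eq_bigr => m _.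
by rewrite /pois_coef; ring.
Qed.

Definition walk_gen y s : R := limn (pseries (pois_coef (walk_law ^~ y)) s).

Let cvgS y s : pseries (pois_coef (walk_law ^~ y)) s k @[k --> \oo] --> walk_gen y s.
Proof. by apply: cvg_coef => m; exact: jump_bnd. Qed.

Let derS y s : is_derive s 1 (walk_gen y) (walk_rate * walk_step (walk_gen ^~ s) y).
Proof.
(* Any radius beyond [|s|] would do: [walk_law] is bounded, so the series converges everywhere. *)
have := @pseries_snd_diffs R (pois_coef (walk_law ^~ y)) (`|s| + 1) s.
have lims : pseries (pois_coef (fun m => walk_rate * walk_law m.+1 y)) s k @[k --> \oo]
    --> walk_rate * walk_step (walk_gen ^~ s) y.
  rewrite coefZ; apply: cvgMr; rewrite /walk_step.
  have -> : pseries (pois_coef (fun m => walk_law m.+1 y)) s = fun k =>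
     (2 * n%:R)^-1 * \sum_i (pseries (pois_coef (walk_law ^~ (y + eps i))) s k
                     + pseries (pois_coef (walk_law ^~ (y - eps i))) s k).
    apply/funext => k; rewrite /pseries/series/=.
    under [in RHS]eq_bigr do rewrite -big_split/=.
    rewrite exchange_big/= mulr_sumr; apply: eq_bigr => m _.
    rewrite /pois_coef /walk_law/= {1}/walk_step !mulr_sumr mulr_suml; apply: eq_bigr => i _; ring.
  apply: cvgMr; apply: cvg_sumr => i; apply: cvgD; exact: cvgS.
have -> : (limn (pseries (pseries_diffs (pois_coef (walk_law ^~ y))) s)) = walk_rate * walk_step (walk_gen ^~ s) y.
  by rewrite diffs_coef; exact: cvg_lim lims.
apply.
- exact: cvg_coef.
- by rewrite diffs_coef coefZ; apply: is_cvgMr; apply: cvg_coef.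
- rewrite diffs_coef diffs_coef.
  rewrite (coefZ walk_rate (fun m => walk_rate * walk_law m.+2 y)); apply: is_cvgMr.
  by rewrite (coefZ walk_rate (fun m => walk_law m.+2 y)); apply: is_cvgMr; apply: cvg_coef.
- by rewrite [X in _ < X]ger0_norm ?addr_ge0// ltrDl.
Qed.

Definition heat_ker s y : R := expR (- (walk_rate * s)) * walk_gen y s.

Let hk_ge0 s y : 0 <= s -> 0 <= heat_ker s y.
Proof.
move=> s0; rewrite /heat_ker mulr_ge0 ?expR_ge0//.
apply: limr_ge; first exact: (cvgP _ (@cvgS y s)).
near=> k; rewrite /pseries/series/=; apply: sumr_ge0 => m _.
rewrite mulr_ge0 ?exprn_ge0// /pois_coef mulr_ge0 ?divr_ge0 ?exprn_ge0//.
by have /andP[] := jump_bnd m y.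
Unshelve. all: by end_near. Qed.

Let hk_0 y : heat_ker 0 y = (y == 0)%:R.
Proof.
rewrite /heat_ker mulr0 oppr0 expR0 mul1r /walk_gen.
apply/cvg_lim => //; rewrite -[X in _ --> X](_ : pois_coef (walk_law ^~ y) 0 = _); last first.
  by rewrite /pois_coef/walk_law/= expr0 fact0 divr1 mul1r.
(* At time 0 only the term of index 0 survives, as [0 ^+ 0 = 1]; without the empty partial sum the
   sequence is constant. *)
rewrite -cvg_shiftS/=.
have -> : (fun k => pseries (pois_coef (walk_law ^~ y)) 0 k.+1) = fun=> pois_coef (walk_law ^~ y) 0.
  apply/funext => k; rewrite /pseries/series/= big_nat_recl//= big1 ?addr0 ?expr0 ?mulr1//.
  by move=> m _; rewrite expr0n mulr0.
exact: cvg_cst.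
Qed.

Let hk_derive s y : is_derive s 1 (heat_ker ^~ y) (lap (heat_ker s) y).
Proof.
have h1 : is_derive s 1 (fun s => expR (- (walk_rate * s))) (- walk_rate * expR (- (walk_rate * s))).
  have h2 : is_derive s 1 (fun s : R => - (walk_rate * s)) (- walk_rate).
    apply: is_derive_eq (is_deriveN (is_deriveZ walk_rate (is_derive_id s 1))) _.
    by rewrite /GRing.scale/= mulr1.
  rewrite mulrC; exact: (is_derive1_comp (is_derive_expR _) h2).
apply: is_derive_eq (is_deriveMr h1 (derS y s)) _.
rewrite lap_step /heat_ker.
have -> : walk_step (fun y => expR (- (walk_rate * s)) * walk_gen y s) y =
  expR (- (walk_rate * s)) * walk_step (walk_gen ^~ s) y.
  rewrite /walk_step !mulr_sumr; apply: eq_bigr => i _; ring.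
ring.
Qed.

(** The total mass has zero derivative, since [lap] sums to zero, and it equals 1 at time 0. *)
Let hk_sum s : \sum_y heat_ker s y = 1.
Proof.
transitivity (\sum_y heat_ker 0 y).
  apply: (@is_derive_0_is_cst R (fun s => \sum_y heat_ker s y)) => t.
  have := is_derive_sumr (index_enum L) (fun y => hk_derive t y).
  by rewrite sum_lap.
rewrite (bigD1 0)//= hk_0 eqxx big1 ?addr0//= => y /negbTE y0.
by rewrite hk_0 y0.
Qed.

(* Poissonization, at rate [walk_rate], of the simple random walk. *)
Lemma heat_kernel_exists : { p : R -> L -> R |
  [/\ forall s y, 0 <= s -> 0 <= p s y,
      forall s, \sum_y p s y = 1,
      forall y, p 0 y = (y == 0)%:R &
      forall s y, is_derive s 1 (p ^~ y) (lap (p s) y)] }.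
Proof. by exists heat_ker. Qed.

End Kernel.

(** * Heat semigroup *)

Section MVT.
Context {R : realType}.

(** Here [a = b] is allowed, and two-sided derivability at the end points replaces a separate
    continuity hypothesis. *)
Lemma MVT_closed (F dF : R -> R) (a b : R) : a <= b ->
  (forall r, a <= r <= b -> is_derive r 1 F (dF r)) ->
  exists2 c, a <= c <= b & F b - F a = dF c * (b - a).
Proof.
rewrite le_eqVlt => /orP[/eqP<-|ab] fdf.
  by exists a; rewrite ?lexx// !subrr mulr0.
have [x|x|c] := @MVT R F dF a b ab.
- by rewrite in_itv/= => /andP[ax xb]; apply: fdf; rewrite !ltW.
- apply: derivable_within_continuous => y; rewrite in_itv/= => yab.
  exact: (@ex_derive _ _ _ _ _ _ _ (fdf y yab)).
- by rewrite in_itv/= => /andP[ac cb] ->; exists c; rewrite ?(ltW ac) ?(ltW cb).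
Qed.

Lemma ler_norm_sqr (a b : R) : 0 <= b -> a ^+ 2 <= b ^+ 2 -> `|a| <= b.
Proof. by move=> b0; rewrite -(real_normK (num_real a)) ler_sqr ?nnegrE. Qed.

End MVT.

Section Diffs.
Context {R : realType} {L : finZmodType} {n : nat}.
Variables (eps : 'I_n -> L) (nu : R).

Definition unit_step (e : L) := exists i, e = eps i \/ e = - eps i.

Definition diffs (es : seq L) (u : L -> R) : L -> R := foldr (fdiff nu) u es.

Lemma unit_stepP i : unit_step (eps i). Proof. by exists i; left. Qed.
Lemma unit_stepN i : unit_step (- eps i). Proof. by exists i; right. Qed.

(** The excess [lap (w^2) - 2 w lap w] (the carre du champ) is the sum of the squared differences in
    all [2 n] directions; only the one along [e] is kept. *)
Lemma lap_sqr (w : L -> R) (e : L) x : unit_step e ->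
  2 * w x * lap eps nu w x + (fdiff nu e w x) ^+ 2 <= lap eps nu (fun z => w z ^+ 2) x.
Proof.
move=> [i ei]; rewrite -lerBrDl /lap mulr_sumr -sumrB.
rewrite (eq_bigr (fun i => (fdiff nu (eps i) w x) ^+ 2 + (fdiff nu (- eps i) w x) ^+ 2)); last first.
  by move=> j _; rewrite /fdiff; ring.
rewrite (bigD1 i)//=; apply: ler_wpDr.
  by apply: sumr_ge0 => j _; rewrite addr_ge0// sqr_ge0.
by case: ei => ->; rewrite ?lerDl ?lerDr sqr_ge0.
Qed.

End Diffs.

Section Heat.
Context {R : realType} {L : finZmodType} {n : nat}.
Variables (eps : 'I_n -> L) (nu : R) (p : R -> L -> R).
Hypotheses (p_ge0 : forall (s : R) y, 0 <= s -> 0 <= p s y)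
  (p_sum : forall s, \sum_y p s y = 1)
  (p_0 : forall y, p 0 y = (y == 0)%:R)
  (p_derive : forall (s : R) y, is_derive s 1 (p ^~ y) (lap eps nu (p s) y)).
Implicit Types (u v w : L -> R) (x y e : L) (s t : R).
Local Notation Lap := (lap eps nu).
Local Notation D := (fdiff nu).
Local Notation Ds := (diffs nu).

Definition heat s u x : R := \sum_y p s y * u (x + y).

Lemma heat0 u : heat 0 u = u.
Proof.
apply/funext => x; rewrite /heat (bigD1 0)//= p_0 eqxx addr0 mul1r big1 ?addr0// => y /negbTE y0.
by rewrite p_0 y0 mul0r.
Qed.

Lemma heatD s u v x : heat s (fun z => u z + v z) x = heat s u x + heat s v x.
Proof. by rewrite /heat -big_split/=; apply: eq_bigr => y _; rewrite mulrDr. Qed.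

Lemma heatZ s c u x : heat s (fun z => c * u z) x = c * heat s u x.
Proof. by rewrite /heat mulr_sumr; apply: eq_bigr => y _; ring. Qed.

Lemma heatN s u x : heat s (fun z => - u z) x = - heat s u x.
Proof. by rewrite /heat -sumrN; apply: eq_bigr => y _; ring. Qed.

Lemma heatB s u v x : heat s (fun z => u z - v z) x = heat s u x - heat s v x.
Proof. by rewrite heatD heatN. Qed.

Lemma heat_cst s c x : heat s (fun=> c) x = c.
Proof. by rewrite /heat -mulr_suml p_sum mul1r. Qed.

Lemma ler_heat s u v x : 0 <= s -> (forall y, u y <= v y) -> heat s u x <= heat s v x.
Proof. by move=> s0 uv; apply: ler_sum => y _; rewrite ler_wpM2l// p_ge0. Qed.

(** Nonnegativity of the variance of [u] under the probability [p s]. *)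
Lemma heat_sqr s u x : 0 <= s -> heat s u x ^+ 2 <= heat s (fun z => u z ^+ 2) x.
Proof.
move=> s0; set c := heat s u x.
have : 0 <= heat s (fun z => (u z ^+ 2 - (2 * c) * u z) + c ^+ 2) x.
  rewrite -(heat_cst s 0 x); apply: ler_heat => // y.
  by rewrite (_ : _ + _ = (u y - c) ^+ 2) ?sqr_ge0//; ring.
rewrite heatD heat_cst heatB heatZ -/c => h.
by rewrite -subr_ge0; move: h; congr (_ <= _); ring.
Qed.

Lemma fdiff_heat s e u : D e (heat s u) = heat s (D e u).
Proof.
apply/funext => x.
transitivity (nu * (heat s (fun z => u (z + e)) x - heat s u x)); last by rewrite -heatB -heatZ.
by rewrite /fdiff /heat; congr (_ * (_ - _)); apply: eq_bigr => y _; congr (_ * u _); rewrite addrAC.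
Qed.

Lemma diffs_heat s es u : Ds es (heat s u) = heat s (Ds es u).
Proof. by elim: es => //= e es IH; rewrite /diffs/= -/(Ds es _) IH fdiff_heat. Qed.

Lemma lap_heat s u : Lap (heat s u) = heat s (Lap u).
Proof.
apply/funext => x; rewrite lapE; transitivity (- \sum_i heat s (D (- eps i) (D (eps i) u)) x).
  by congr (- _); apply: eq_bigr => i _; rewrite !fdiff_heat.
rewrite /heat exchange_big/= -sumrN; apply: eq_bigr => y _.
by rewrite -mulr_sumr lapE mulrN.
Qed.

(** The time derivative puts [lap] on the kernel, and its symmetry moves it onto [v]. The clock
    [sig] and the function [v] vary together, as needed both for interpolation along the semigroup
    and for Duhamel's formula. *)
Lemma is_derive_heat (sig : R -> R) (v : R -> L -> R) (dsig : R) (dv : L -> R) (r : R) x :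
  is_derive r 1 sig dsig -> (forall z, is_derive r 1 (v ^~ z) (dv z)) ->
  is_derive r 1 (fun r => heat (sig r) (v r) x)
    (dsig * heat (sig r) (Lap (v r)) x + heat (sig r) dv x).
Proof.
move=> hs hv; rewrite /heat.
have h y : is_derive r 1 (fun r => p (sig r) y * v r (x + y))
   (Lap (p (sig r)) y * dsig * v r (x + y) + p (sig r) y * dv (x + y)).
  apply: is_deriveMr => //; exact: (is_derive1_comp (p_derive _ _) hs).
apply: is_derive_eq (is_derive_sumr (index_enum L) h) _.
rewrite big_split/=; congr (_ + _).
transitivity (dsig * \sum_y Lap (p (sig r)) y * v r (x + y)).
  by rewrite mulr_sumr; apply: eq_bigr => y _; ring.
rewrite lap_sym; congr (_ * _); apply: eq_bigr => y _.
by rewrite lap_shift.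
Qed.

Lemma is_derive_heat_time u s x : is_derive s 1 (fun s => heat s u x) (heat s (Lap u) x).
Proof.
apply: is_derive_eq (@is_derive_heat id (fun=> u) 1 (fun=> 0) s x _ _) _.
  by move=> z; exact: is_derive_cst.
by rewrite mul1r heat_cst addr0.
Qed.

(** The path [r |-> heat (s + t - r) (heat r u)] joins the two sides and has zero derivative,
    because [heat] commutes with [lap]. *)
Lemma heat_semigroup s t u : heat (s + t) u = heat s (heat t u).
Proof.
apply/funext => x.
have := @is_derive_0_is_cst R (fun r => heat (s + t - r) (heat r u) x) 0 t.
rewrite subr0 heat0 addrK; apply => r.
have h1 : is_derive r 1 (fun r : R => s + t - r) (-1).
  apply: is_derive_eq (is_deriveB (is_derive_cst (s + t) r 1) (is_derive_id r 1)) _.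
  by rewrite sub0r.
apply: is_derive_eq (is_derive_heat x h1 (fun z => is_derive_heat_time u r z)) _.
by rewrite lap_heat mulN1r addNr.
Qed.

(* Gamma-calculus: along [r |-> heat (s - r) (heat r u ^ 2)] the derivative
   dominates the squared gradient of [heat s u]. *)
Lemma heat_gradient s e u x : 0 < s -> unit_step eps e ->
  D e (heat s u) x ^+ 2 <= s^-1 * heat s (fun z => u z ^+ 2) x.
Proof.
move=> s0 he.
pose f r := heat (s - r) (fun z => heat r u z ^+ 2) x.
pose df (r : R) : R := - 1 * heat (s - r) (Lap (fun z => heat r u z ^+ 2)) x +
  heat (s - r) (fun z => 2 * heat r u z * Lap (heat r u) z) x.
have fdf (r : R) : is_derive r 1 f (df r).
  apply: is_derive_heat.
    apply: is_derive_eq (is_deriveB (is_derive_cst s r 1) (is_derive_id r 1)) _.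
    by rewrite sub0r.
  move=> z.
  apply: is_derive_eq (is_deriveMr (is_derive_heat_time u r z) (is_derive_heat_time u r z)) _.
  by rewrite lap_heat; ring.
have [c /andP[c0 cs]] := MVT_closed (ltW s0) (fun r _ => fdf r).
rewrite /f /= !subr0 subrr !heat0 => fE.
rewrite ler_pdivlMl//.
(* By the semigroup law the gradient of [heat s u] can be read off at any intermediate time [c], so
   the mean value point need not be known. *)
have : D e (heat s u) x ^+ 2 <= - df c.
  rewrite /df mulN1r opprD opprK.
  have -> : D e (heat s u) x = heat (s - c) (D e (heat c u)) x.
    by rewrite -fdiff_heat -heat_semigroup subrK.
  have sc : 0 <= s - c by rewrite subr_ge0.
  rewrite -heatB; apply: (le_trans (heat_sqr _ _ sc)); apply: ler_heat => // y.
  by rewrite lerBrDl; exact: lap_sqr.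
have := sqr_ge0 (heat s u x).
move: fE; rewrite /= -/(heat s u x); set A := heat s u x ^+ 2; set B := heat s _ x.
move=> fE A0 h.
have : s * D e (heat s u) x ^+ 2 <= s * - df c by rewrite ler_wpM2l// (ltW s0).
move: fE; nra.
Qed.

(** The time is cut into as many equal pieces as there are differences, and each piece pays for one
    of them; hence the factor [(k / s)^k] below. *)
Lemma heat_diffs_sqr es (tau : R) u x : 0 < tau -> (forall e, e \in es -> unit_step eps e) ->
  Ds es (heat ((size es)%:R * tau) u) x ^+ 2 <=
  (tau ^+ size es)^-1 * heat ((size es)%:R * tau) (fun z => u z ^+ 2) x.
Proof.
move=> t0; elim: es x => [|e es IH] x hes /=.
  by rewrite mul0r !heat0 expr0 invr1 mul1r.
have -> : (size es).+1%:R * tau = tau + (size es)%:R * tau by rewrite -nat1r mulrDl mul1r.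
rewrite heat_semigroup diffs_heat.
apply: (le_trans (heat_gradient _ _ t0 (hes _ (mem_head _ _)))).
rewrite exprS invfM -mulrA ler_wpM2l ?invr_ge0 ?(ltW t0)//.
rewrite heat_semigroup -heatZ; apply: ler_heat; first exact: ltW.
by move=> y; apply: IH => e' he'; apply: hes; rewrite inE he' orbT.
Qed.

Lemma heat_diffs_le es s u x : 0 < s -> (forall e, e \in es -> unit_step eps e) ->
  Ds es (heat s u) x ^+ 2 <= ((size es)%:R / s) ^+ size es * heat s (fun z => u z ^+ 2) x.
Proof.
move=> s0 hes; have [es0|k0] := posnP (size es).
  by rewrite (size0nil es0) expr0 mul1r; apply: heat_sqr; exact: ltW.
have k0R : 0 < ((size es)%:R : R) by rewrite ltr0n.
have := @heat_diffs_sqr es (s / (size es)%:R) u x (divr_gt0 s0 k0R) hes.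
by rewrite mulrC divfK ?gt_eqF// -exprVn invf_div.
Qed.

Lemma heat_diffs_bound es s u x (c : R) : 0 < s ->
  (forall e, e \in es -> unit_step eps e) -> (forall y, u y ^+ 2 <= c) ->
  Ds es (heat s u) x ^+ 2 <= ((size es)%:R / s) ^+ size es * c.
Proof.
move=> s0 hes uc; apply: (le_trans (heat_diffs_le _ _ s0 hes)).
rewrite ler_wpM2l ?exprn_ge0 ?divr_ge0 ?(ltW s0)//.
rewrite -[leRHS](heat_cst s c x); apply: ler_heat => //; exact: ltW.
Qed.

(** For a squared distance [q] this is the diffusive growth of the second moment, obtained without
    any explicit formula for the kernel. *)
Lemma heat_moment q (c : R) s x : 0 <= s -> (forall y, Lap q y <= c) -> heat s q x <= q x + c * s.
Proof.
move=> s0 qc.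
have [t /andP[t0 ts]] := MVT_closed s0 (fun r _ => is_derive_heat_time q r x).
rewrite heat0 subr0 => h; rewrite -lerBlDl h ler_wpM2r//.
by rewrite -[leRHS](heat_cst t c x); apply: ler_heat.
Qed.

(** Serves to compare two frozen diffusivities, which amount to two running times of the same
    semigroup. The time derivative is a sum of [n] second differences, each at most [2 / a * c]. *)
Lemma heat_time_change (a c : R) s t u x : 0 < a -> a <= s -> a <= t -> 0 <= c ->
  (forall y, `|u y| <= c) ->
  `|heat t u x - heat s u x| <= 2 * n%:R / a * c * `|t - s|.
Proof.
move=> a0; wlog st : s t / s <= t.
  move=> h as_ at_ c0 uc; have [|/ltW] := leP s t => st; first exact: h.
  by rewrite distrC [`|t - s|]distrC; apply: h.
move=> as_ at_ c0 uc.
have [r /andP[sr rt] ->] := MVT_closed st (fun r _ => is_derive_heat_time u r x).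
rewrite normrM ler_wpM2r// -lap_heat lapE normrN.
have r0 : 0 < r by apply: lt_le_trans a0 _; apply: le_trans sr.
apply: (le_trans (ler_norm_sum _ _ _)).
rewrite (_ : 2 * n%:R / a * c = \sum_(i < n) (2 / a * c)); last first.
  by rewrite sumr_const card_ord -[RHS]mulr_natr; ring.
apply: ler_sum => i _; apply: ler_norm_sqr; first by rewrite mulr_ge0// divr_ge0// ltW.
have := @heat_diffs_bound [:: - eps i; eps i] r u x (c ^+ 2) r0.
rewrite /diffs/= => /(_ _ _)/le_trans; apply.
- move=> e; rewrite !inE => /orP[] /eqP ->; [exact: unit_stepN|exact: unit_stepP].
- by move=> y; rewrite -(real_normK (num_real (u y))) ler_sqr ?nnegrE.
rewrite [leRHS]exprMn ler_wpM2r ?sqr_ge0// ler_sqr ?nnegrE ?divr_ge0 ?(ltW r0) ?(ltW a0)//.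
by rewrite ler_pM2l// lef_pV2 ?posrE// (le_trans as_).
Qed.

End Heat.

(** * Comparison with powers of time *)

Section PowerAux.
Context {R : realType}.
Implicit Types (x y b p : R).

Lemma powR_sqr x p : 0 <= x -> (x `^ p) ^+ 2 = x `^ (p * 2).
Proof. by move=> x0; rewrite powRrM powR_mulrn ?powR_ge0. Qed.

(* Replaces Jensen's inequality for the concave power [p]. *)
Lemma powR_le_affine x b p : 0 < b -> 0 <= x -> 0 <= p <= 1 ->
  x `^ p <= b `^ p * (1 + x / b).
Proof.
move=> b0 x0 /andP[p0 p1].
have [xb|bx] := leP x b.
  rewrite -[leLHS]mulr1 ler_pM ?powR_ge0//.
    by rewrite ge0_ler_powR// nnegrE// ltW.
  by rewrite lerDl divr_ge0// ltW.
have xb1 : 1 <= x / b by rewrite ler_pdivlMr// mul1r ltW.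
rewrite -[in leLHS](divfK (lt0r_neq0 b0) x) [x / b * b]mulrC powRM ?divr_ge0//; last first.
- exact: ltW.
- exact: ltW.
rewrite ler_wpM2l ?powR_ge0//.
by apply: (le_trans (ler1_powR xb1 p1)); rewrite lerDr.
Qed.

(** With the primitive [G r = K / p * r^p], the increment of [F - G] is nonpositive and that of
    [F + G] nonnegative. A negative [p] is allowed: it occurs for third differences. *)
Lemma powR_MVT (F dF : R -> R) (a b p K : R) : 0 < a -> a <= b -> p != 0 ->
  (forall r, a <= r <= b -> is_derive r 1 F (dF r)) ->
  (forall r, a <= r <= b -> `|dF r| <= K * r `^ (p - 1)) ->
  `|F b - F a| <= K * ((b `^ p - a `^ p) / p).
Proof.
move=> a0 ab p0 hF hK.
pose G r := K / p * r `^ p.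
have hG r : a <= r <= b -> is_derive r 1 G (K * r `^ (p - 1)).
  move=> /andP[ar _]; have r0 : 0 < r by exact: lt_le_trans ar.
  apply: is_derive_eq (is_deriveZ (K / p) (is_derive1_powR p r0)) _.
  by rewrite /GRing.scale/= mulrA divfK.
have GE : G b - G a = K * ((b `^ p - a `^ p) / p) by rewrite /G; ring.
rewrite ler_norml -GE.
have ba : 0 <= b - a by rewrite subr_ge0.
have [r rab h1] : exists2 c, a <= c <= b & F b - G b - (F a - G a) = (dF c - K * c `^ (p - 1)) * (b - a).
  by apply: (@MVT_closed R (fun r => F r - G r)) => // r rab; apply: is_deriveB (hF r rab) (hG r rab).
have [c cab h2] : exists2 c, a <= c <= b & F b + G b - (F a + G a) = (dF c + K * c `^ (p - 1)) * (b - a).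
  by apply: (@MVT_closed R (fun r => F r + G r) (fun c => dF c + K * c `^ (p - 1))) => // c cab; apply: is_deriveD (hF c cab) (hG c cab).
have := hK r rab; have := hK c cab; rewrite !ler_norml => /andP[k1 _] /andP[_ k2].
have : (dF r - K * r `^ (p - 1)) * (b - a) <= 0 by rewrite mulr_le0_ge0// subr_le0.
have : 0 <= (dF c + K * c `^ (p - 1)) * (b - a) by rewrite mulr_ge0// -lerBlDr sub0r.
by rewrite -h1 -h2 => k3 k4; apply/andP; split; lra.
Qed.

(** The integrable singularity at 0: right continuity there replaces a derivative. *)
Lemma powR_MVT0 (F dF : R -> R) (b p K : R) : 0 < b -> 0 < p -> 0 <= K ->
  F r @[r --> 0^'+] --> F 0 ->
  (forall r, 0 < r <= b -> is_derive r 1 F (dF r)) ->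
  (forall r, 0 < r <= b -> `|dF r| <= K * r `^ (p - 1)) ->
  `|F b - F 0| <= K * (b `^ p / p).
Proof.
move=> b0 p0 K0 F0 hF hK.
have cv : `|F b - F r| @[r --> 0^'+] --> `|F b - F 0|.
  by apply: cvg_norm; apply: cvgB => //; exact: cvg_cst.
rewrite -(cvg_lim _ cv)//; apply: limr_le; first exact: cvgP cv.
near=> r; have r0 : 0 < r by near: r; exact: nbhs_right_gt.
have rb : r <= b by near: r; exact: nbhs_right_le.
apply: (@le_trans _ _ (K * ((b `^ p - r `^ p) / p))).
  by apply: (@powR_MVT F dF) => //; rewrite ?gt_eqF// => x /andP[rx xb];
    [apply: hF|apply: hK]; rewrite xb (lt_le_trans r0 rx).
rewrite ler_wpM2l// ler_pM2r ?invr_gt0// gerBl powR_ge0//.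
Unshelve. all: by end_near. Qed.

End PowerAux.

Section DiffsAux.
Context {R : realType} {L : finZmodType} {n : nat}.
Variables (eps : 'I_n -> L) (nu : R).

Lemma is_derive_diffs (es : seq L) (v : R -> L -> R) (dv : L -> R) (r : R) z :
  (forall z, is_derive r 1 (v ^~ z) (dv z)) ->
  is_derive r 1 (fun r => diffs nu es (v r) z) (diffs nu es dv z).
Proof.
move=> hv; elim: es z => [|e es IH] z; first exact: hv.
apply: is_derive_eq (is_deriveZ nu (is_deriveB (IH (z + e)) (IH z))) _.
by [].
Qed.

Lemma cvg_diffs (es : seq L) (F : set_system R) {FF : Filter F} (v : R -> L -> R) (l : L -> R) z :
  (forall z, v r z @[r --> F] --> l z) ->
  diffs nu es (v r) z @[r --> F] --> diffs nu es l z.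
Proof.
move=> hv; elim: es z => [|e es IH] z; first exact: hv.
by apply: cvgMr; apply: cvgB; exact: IH.
Qed.

Lemma diffsN es (u : L -> R) z : diffs nu es (fun y => - u y) z = - diffs nu es u z.
Proof.
elim: es z => [|e es IH] z //=; rewrite /diffs/= /fdiff -!/(diffs _ _ _) !IH; ring.
Qed.

Lemma diffsD es (u v : L -> R) z :
  diffs nu es (fun y => u y + v y) z = diffs nu es u z + diffs nu es v z.
Proof.
elim: es z => [|e es IH] z //=; rewrite /diffs/= /fdiff -!/(diffs _ _ _) !IH; ring.
Qed.

Lemma diffs_rcons es e (u : L -> R) : diffs nu (rcons es e) u = diffs nu es (fdiff nu e u).
Proof. by rewrite /diffs foldr_rcons. Qed.

Lemma lap_fdiff e (u : L -> R) x : lap eps nu (fdiff nu e u) x = fdiff nu e (lap eps nu u) x.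
Proof.
rewrite /lap /fdiff -sumrB mulr_sumr; apply: eq_bigr => i _.
by rewrite ![x + e + _]addrAC; ring.
Qed.

Lemma fdiffN_shift e (u : L -> R) x : fdiff nu (- e) u x = - fdiff nu e u (x - e).
Proof. by rewrite /fdiff addrNK; ring. Qed.

End DiffsAux.

(** * Frozen coefficients *)

Section Duhamel.
Context {R : realType} {L : finZmodType} {n : nat}.
Variables (eps : 'I_n -> L) (nu : R) (p : R -> L -> R).
Hypotheses (p_ge0 : forall (s : R) y, 0 <= s -> 0 <= p s y)
  (p_sum : forall s, \sum_y p s y = 1)
  (p_0 : forall y, p 0 y = (y == 0)%:R)
  (p_derive : forall (s : R) y, is_derive s 1 (p ^~ y) (lap eps nu (p s) y)).
Variables (cm cp T alpha : R).
Hypotheses (cm0 : 0 < cm) (T0 : 0 < T) (alpha01 : 0 < alpha < 1).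
(** Stands for the squared distance to 0. Semiconcavity is what [heat_moment] asks of it, and no
    other feature of the geometry is needed to bound the second differences of [psi], apart from
    [q 0 = 0]. *)
Variable q : L -> R.
Hypotheses (q_ge0 : forall x, 0 <= q x) (q_lap : forall x, lap eps nu q x <= 2 * n%:R).
(** [M] and [B] bound [xi] and its differences. [B] is left free: absorption takes the best
    constant, and the Hoelder bounds are then applied with the value obtained from it. *)
Variables (psi abar g : R -> L -> R) (M A B G : R).
Local Notation D := (fdiff nu).
Local Notation Ds := (diffs nu).
Local Notation Lap := (lap eps nu).
Local Notation heat := (heat p).
Definition xi (j : 'I_n) (t : R) : L -> R := D (eps j) (psi t).

Hypotheses (A0 : 0 <= A) (B0 : 0 <= B) (G0 : 0 <= G) (M0 : 0 <= M).
Hypothesis abar_bnd : forall (t : R) x, 0 < t <= T -> cm <= abar t x <= cp.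
Hypothesis xi_derive : forall j (t : R) x, 0 < t < T ->
  is_derive t 1 (fun s => xi j s x) (D (eps j) (fun y => abar t y * Lap (psi t) y + g t y) x).
Hypothesis xi_cont : forall j (t : R) x, 0 < t <= T -> xi j s x @[s --> t^'-] --> xi j t x.
(** Squared, as the semigroup estimates are quadratic. The earlier time [s] carries the weight, and
    [Num.max (t - s) (q z)] is the square of the parabolic distance. *)
Hypothesis abar_holder : forall (s t : R) x z, 0 < s -> s < t -> t <= T ->
  (abar s (x + z) - abar t x) ^+ 2 <= A ^+ 2 * s `^ (- alpha) * (Num.max (t - s) (q z)) `^ alpha.
Hypothesis g_bnd : forall j (t : R) x, 0 < t <= T -> D (eps j) (g t) x ^+ 2 <= G ^+ 2 / t.
Hypothesis xi_bnd : forall j (t : R) x, 0 < t <= T -> xi j t x ^+ 2 <= M ^+ 2 / t.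
Hypothesis dxi_bnd : forall i j (t : R) x, 0 < t <= T -> t * `|D (eps i) (xi j t) x| <= B.

Let a0 : 0 < alpha. Proof. by case/andP: alpha01. Qed.
Let a1 : alpha < 1. Proof. by case/andP: alpha01. Qed.

Lemma abar_gt0 t x : 0 < t <= T -> 0 < abar t x.
Proof. by move=> /abar_bnd-/(_ x)/andP[h _]; exact: lt_le_trans h. Qed.

Lemma lap_psi_bnd t x : 0 < t <= T -> `|Lap (psi t) x| <= n%:R * B / t.
Proof.
move=> tT; have t0 : 0 < t by case/andP: tT.
rewrite lapE normrN; apply: (le_trans (ler_norm_sum _ _ _)).
have -> : n%:R * B / t = \sum_(i < n) (B / t).
  by rewrite sumr_const card_ord -[RHS]mulr_natr; ring.
apply: ler_sum => i _; rewrite fdiffN_shift normrN ler_pdivlMr// mulrC.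
exact: dxi_bnd.
Qed.

(** Growth like [1 + q / r] costs only a constant: in time [cp * r] the walk travels a distance of
    order [sqrt r], and it starts within [sqrt r] of [x0]. *)
Lemma heat_weighted (s r : R) (u : L -> R) (K : R) x0 z : 0 <= s <= cp * r -> 0 < r -> 0 <= K -> q z <= r ->
  (forall y, u y ^+ 2 <= K * (1 + q (- x0 + y) / r)) ->
  heat s (fun y => u y ^+ 2) (x0 + z) <= K * (2 + 2 * n%:R * cp).
Proof.
move=> /andP[s0 sr] r0 K0 qz uK.
have -> : K * (2 + 2 * n%:R * cp) = K * (1 + r^-1 * (r + 2 * n%:R * (cp * r))).
  by field; rewrite gt_eqF.
apply: (le_trans (ler_heat p_ge0 _ s0 (fun y => uK y))).
rewrite heatZ heatD heat_cst// ler_wpM2l// lerD2l.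
under [X in heat _ X]eq_fun do rewrite mulrC.
rewrite heatZ ler_wpM2l ?invr_ge0 ?(ltW r0)//.
have := @heat_moment _ _ _ eps nu p p_ge0 p_sum p_0 p_derive (fun y => q (- x0 + y)) (2 * n%:R) s (x0 + z) s0.
move=> /(_ _)/le_trans; apply.
  by move=> y; rewrite lap_shift.
by rewrite addKr lerD// ler_wpM2l.
Qed.

(* [xi' = a0 lap xi + D source] for the diffusivity [a0 = abar t0 x0] frozen at
   [(t0, x0)], the time being [t0 - r]. *)
Definition source (x0 : L) (t0 r : R) (y : L) : R :=
  (abar (t0 - r) y - abar t0 x0) * Lap (psi (t0 - r)) y + g (t0 - r) y.

(** The power of [t0] collects [t0^(-1)] from [lap psi] and [t0^(-alpha/2)] from [abar]. In the
    power of [r], the Hoelder gain is [alpha / 2] and each of the [k + 1] differences on the kernel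
    costs [1 / 2]. *)
Definition weight (k : nat) (t0 r : R) : R :=
  t0 `^ (- (1 + alpha / 2)) * r `^ ((alpha - k.+1%:R) / 2).

Lemma weight_ge0 k t0 r : 0 <= weight k t0 r.
Proof. by rewrite mulr_ge0 ?powR_ge0. Qed.

Lemma weight_sqr k (t0 r : R) : 0 < t0 -> 0 < r ->
  weight k t0 r ^+ 2 = t0 ^- 2 * t0 `^ (- alpha) * r `^ alpha * r ^- k.+1.
Proof.
move=> t00 r0; rewrite exprMn !powR_sqr ?(ltW t00) ?(ltW r0)//.
have -> : - (1 + alpha / 2) * 2 = (- 2%:R) + - alpha by field.
have -> : (alpha - k.+1%:R) / 2 * 2 = alpha + - k.+1%:R by field.
rewrite !powRD; last 2 first.
- by rewrite (gt_eqF t00) implybT.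
- by rewrite (gt_eqF r0) implybT.
by rewrite !powR_invn ?(ltW t00) ?(ltW r0)// !mulrA.
Qed.

(** As [r / t0 <= (r / t0)^alpha], terms with one difference fewer on the kernel and no Hoelder gain
    are dominated by the same weight. *)
Lemma weight_sqr_ge k (t0 r : R) : 0 < r -> r <= t0 -> t0 ^- 3 * r ^- k <= weight k t0 r ^+ 2.
Proof.
move=> r0 rt; have t00 : 0 < t0 by exact: lt_le_trans rt.
rewrite weight_sqr//.
have -> : t0 ^- 2 * t0 `^ (- alpha) * r `^ alpha * r ^- k.+1 = t0 ^- 2 * (r / t0) `^ alpha * (r ^- k / r).
  rewrite powRM ?invr_ge0 ?(ltW r0) ?(ltW t00)// -[t0^-1]powR_inv1 ?(ltW t00)// -powRrM mulN1r.
  by rewrite (exprSr r k) (invfM (r ^+ k)); ring.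
have -> : t0 ^- 3 * r ^- k = t0 ^- 2 * (r / t0) * (r ^- k / r).
  by field; rewrite !expf_neq0 ?(gt_eqF r0) ?(gt_eqF t00).
rewrite ler_wpM2r ?divr_ge0 ?invr_ge0 ?exprn_ge0 ?(ltW r0)//.
rewrite ler_wpM2l ?invr_ge0 ?sqr_ge0//.
by apply: ger1_powR; rewrite ?(ltW a1)// divr_gt0//= ler_pdivrMr// mul1r.
Qed.

(** The factors of [C_src1] come from [heat_diffs_le] at a time at least [cm * r], from
    [heat_weighted] and from [source_abar]. In [C_src2] the 2 is due to [t0 - r >= t0 / 2] and
    [T ^+ 2] to the excess of negative powers of [t0] in the weight. The 2 in [C_src] is paid to
    [ler_norm_sqrM], applied twice. *)
Definition C_src1 (k : nat) : R := (k.+1%:R / cm) ^+ k.+1 * (2 + 2 * n%:R * cp) * n%:R ^+ 2 * 8.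
Definition C_src2 (k : nat) : R := (k%:R / cm) ^+ k * 2 * T ^+ 2.
Definition C_src (k : nat) : R := 2 + C_src1 k + C_src2 k.

(* [ler_norm_sqr] with [sqrt c] replaced by the larger [1 + c]. *)
Lemma ler_norm_sqrM (x c w : R) : 0 <= c -> 0 <= w -> x ^+ 2 <= c * w ^+ 2 -> `|x| <= (1 + c) * w.
Proof.
move=> c0 w0 h; apply: ler_norm_sqr; first by rewrite mulr_ge0// addr_ge0.
apply: (le_trans h); rewrite exprMn ler_wpM2r ?sqr_ge0//; nra.
Qed.

Lemma powR_half (t0 r : R) : 0 < r -> r <= t0 / 2 -> (t0 - r) `^ (- alpha) <= 2 * t0 `^ (- alpha).
Proof.
move=> r0 rt; have t00 : 0 < t0 by lra.
have s0 : 0 < t0 - r by lra.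
rewrite !powRN; apply: (@le_trans _ _ ((t0 / 2) `^ alpha)^-1).
  rewrite lef_pV2 ?posrE ?powR_gt0//; last by lra.
  by rewrite ge0_ler_powR ?nnegrE ?(ltW a0)//; lra.
have t2 : 0 < t0 / 2 by lra.
rewrite -[leRHS]invrK invfM invrK lef_pV2 ?posrE ?powR_gt0//; last first.
  by rewrite mulr_gt0 ?invr_gt0 ?powR_gt0.
rewrite powRM ?(ltW t00)// mulrC ler_wpM2l ?powR_ge0//.
by apply: ger1_powR; rewrite ?(ltW a1)//; apply/andP; split; lra.
Qed.

(** The power of [q] is traded for an affine function of [q], whose heat average is under control.
    The 8 is a 2 from [powR_half] times a 4 from evaluating [(n B / t)^2] at [t0 / 2]. *)
Lemma source_abar (t0 r : R) x0 y : 0 < r -> r <= t0 / 2 -> t0 <= T ->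
  ((abar (t0 - r) y - abar t0 x0) * Lap (psi (t0 - r)) y) ^+ 2 <=
  (n%:R ^+ 2 * 8 * (A * B) ^+ 2 * (t0 ^- 2 * t0 `^ (- alpha) * r `^ alpha)) * (1 + q (- x0 + y) / r).
Proof.
move=> r0 rt t0T.
have t00 : 0 < t0 by lra.
have s0 : 0 < t0 - r by lra.
have sT : 0 < t0 - r <= T by rewrite s0/=; lra.
have h1 := @abar_holder (t0 - r) t0 x0 (- x0 + y) s0 _ t0T.
rewrite addrA subrr add0r subKr in h1.
have {}h1 := h1 ltac:(by lra).
have h2 : Lap (psi (t0 - r)) y ^+ 2 <= (n%:R * B / (t0 / 2)) ^+ 2.
  rewrite -(real_normK (num_real _)) ler_sqr ?nnegrE//; last first.
    by rewrite divr_ge0 ?mulr_ge0//; lra.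
  apply: (le_trans (lap_psi_bnd y sT)); rewrite ler_wpM2l ?mulr_ge0//.
  by rewrite lef_pV2 ?posrE; lra.
have h3 := powR_half r0 rt.
have h4 : Num.max r (q (- x0 + y)) `^ alpha <= r `^ alpha * (1 + q (- x0 + y) / r).
  have [qr|rq] := leP (q (- x0 + y)) r.
    rewrite -[leLHS]mulr1 ler_wpM2l ?powR_ge0// lerDl divr_ge0//; exact: ltW.
  by apply: powR_le_affine; rewrite ?(ltW a0) ?(ltW a1).
rewrite exprMn; apply: (le_trans (ler_pM (sqr_ge0 _) (sqr_ge0 _) h1 h2)).
apply: (@le_trans _ _ (A ^+ 2 * (2 * t0 `^ (- alpha)) * (r `^ alpha * (1 + q (- x0 + y) / r))
   * (n%:R * B / (t0 / 2)) ^+ 2)).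
  rewrite ler_wpM2r ?sqr_ge0// ler_pM ?mulr_ge0 ?sqr_ge0 ?powR_ge0//.
  by rewrite ler_wpM2l ?sqr_ge0.
rewrite le_eqVlt; apply/orP; left; apply/eqP; field.
by rewrite (gt_eqF r0) (gt_eqF t00).
Qed.

(** The difference [D (eps j)] is moved to the kernel in the [abar] part, which has no bounded
    differences, and stays on [g], where [g_bnd] controls it. *)
Lemma source_bnd (es : seq L) j (t0 r : R) x0 z :
  (forall e, e \in es -> unit_step eps e) ->
  0 < r -> r <= t0 / 2 -> t0 <= T -> q z <= r ->
  `|Ds es (heat (abar t0 x0 * r) (D (eps j) (source x0 t0 r))) (x0 + z)| <=
  C_src (size es) * (A * B + G) * weight (size es) t0 r.
Proof.
move=> hes r0 rt t0T qz.
have t00 : 0 < t0 by lra.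
have sT : 0 < t0 - r <= T by apply/andP; split; lra.
have t0T' : 0 < t0 <= T by rewrite t00.
have ac := abar_bnd x0 t0T'; have /andP[acm acp] := ac.
have cp0 : 0 < cp by exact: lt_le_trans cm0 (le_trans acm acp).
set s := abar t0 x0 * r.
have s0 : 0 < s by rewrite mulr_gt0// abar_gt0.
pose f1 y := (abar (t0 - r) y - abar t0 x0) * Lap (psi (t0 - r)) y.
have -> : Ds es (heat s (D (eps j) (source x0 t0 r))) (x0 + z) =
  Ds (rcons es (eps j)) (heat s f1) (x0 + z) + Ds es (heat s (D (eps j) (g (t0 - r)))) (x0 + z).
  rewrite diffs_rcons fdiff_heat !diffs_heat -heatD.
  rewrite /heat; apply: eq_bigr => y _; congr (_ * _).
  rewrite -diffsD; congr (diffs _ _ _ _); apply/funext => w.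
  by rewrite /source /fdiff /f1; ring.
have hk (k : nat) : (k%:R / s) ^+ k <= (k%:R / cm) ^+ k * r ^- k.
  rewrite -exprVn -exprMn lerXn2r ?nnegrE ?mulr_ge0 ?invr_ge0 ?(ltW s0) ?(ltW cm0) ?(ltW r0)//.
  rewrite -mulrA -invfM ler_wpM2l// lef_pV2 ?posrE ?mulr_gt0//.
    by rewrite /s ler_pM2r.
  exact: abar_gt0.
set k := size es.
have w0 := weight_ge0 k t0 r.
have E1 : `|Ds (rcons es (eps j)) (heat s f1) (x0 + z)| <= (1 + C_src1 k) * ((A * B) * weight k t0 r).
  have c0 : 0 <= C_src1 k.
    by rewrite /C_src1 !mulr_ge0 ?exprn_ge0 ?divr_ge0 ?addr_ge0 ?mulr_ge0 ?(ltW cm0) ?(ltW cp0).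
  apply: (ler_norm_sqrM c0 (mulr_ge0 (mulr_ge0 A0 B0) w0)).
  rewrite [(_ * _) ^+ 2]exprMn weight_sqr//.
  have hes' e : e \in rcons es (eps j) -> unit_step eps e.
    by rewrite mem_rcons inE => /orP[/eqP->|/hes//]; exact: unit_stepP.
  apply: (le_trans (heat_diffs_le p_ge0 p_sum p_0 p_derive f1 (x0 + z) s0 hes')).
  rewrite size_rcons -/k.
  pose K := n%:R ^+ 2 * 8 * (A * B) ^+ 2 * (t0 ^- 2 * t0 `^ (- alpha) * r `^ alpha).
  have K0 : 0 <= K by rewrite /K !mulr_ge0 ?sqr_ge0 ?invr_ge0 ?powR_ge0 ?sqr_ge0.
  have sr : 0 <= s <= cp * r by rewrite (ltW s0)/= ler_wpM2r ?(ltW r0).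
  have := @heat_weighted s r f1 K x0 z sr r0 K0 qz (fun y => source_abar x0 y r0 rt t0T).
  move=> hw; apply: (@le_trans _ _ ((k.+1%:R / cm) ^+ k.+1 * r ^- k.+1 * (K * (2 + 2 * n%:R * cp)))).
    apply: ler_pM => //; first by rewrite exprn_ge0// divr_ge0// ltW.
    rewrite -(heat_cst p_sum s 0 (x0 + z)); apply: (ler_heat p_ge0); first exact: ltW.
    by move=> y; exact: sqr_ge0.
  by rewrite le_eqVlt; apply/orP; left; apply/eqP; rewrite /C_src1 /K; ring.
have E2 : `|Ds es (heat s (D (eps j) (g (t0 - r)))) (x0 + z)| <= (1 + C_src2 k) * (G * weight k t0 r).
  have c0 : 0 <= C_src2 k.
    by rewrite /C_src2 !mulr_ge0 ?exprn_ge0 ?divr_ge0 ?(ltW cm0) ?(ltW T0).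
  apply: (ler_norm_sqrM c0 (mulr_ge0 G0 w0)).
  have gb y : D (eps j) (g (t0 - r)) y ^+ 2 <= G ^+ 2 / (t0 / 2).
    apply: (le_trans (g_bnd _ _ sT)); rewrite ler_wpM2l ?sqr_ge0// lef_pV2 ?posrE; lra.
  apply: (le_trans (heat_diffs_bound p_ge0 p_sum p_0 p_derive (x0 + z) s0 hes gb)); rewrite -/k.
  rewrite [(G * _) ^+ 2]exprMn weight_sqr//.
  (* The bound for [g] is less singular at [t0 = 0] than the weight; [t0 <= T] makes up for the
     missing powers. *)
  have h1 : t0^-1 * r ^- k <= T ^+ 2 * (t0 ^- 2 * t0 `^ (- alpha) * r `^ alpha * r ^- k.+1).
    rewrite -weight_sqr//; have rt0 : r <= t0 by lra.
    apply: (@le_trans _ _ (T ^+ 2 * (t0 ^- 3 * r ^- k))); last first.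
      by rewrite ler_wpM2l ?sqr_ge0//; exact: weight_sqr_ge.
    rewrite mulrA ler_wpM2r ?invr_ge0 ?exprn_ge0 ?(ltW r0)//.
    have -> : T ^+ 2 * t0 ^- 3 = t0^-1 * (T / t0) ^+ 2 by field; rewrite (gt_eqF t00).
    rewrite -[leLHS]mulr1 ler_wpM2l ?invr_ge0 ?(ltW t00)//.
    by rewrite exprn_ege1// ler_pdivlMr// mul1r.
  apply: (@le_trans _ _ ((k%:R / cm) ^+ k * r ^- k * (G ^+ 2 / (t0 / 2)))).
    by rewrite ler_wpM2r// divr_ge0 ?sqr_ge0//; lra.
  have -> : (k%:R / cm) ^+ k * r ^- k * (G ^+ 2 / (t0 / 2)) = ((k%:R / cm) ^+ k * 2 * G ^+ 2) * (t0^-1 * r ^- k).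
    by move: (_ ^+ k) (r ^- k) => u v; field; rewrite (gt_eqF t00).
  have -> : C_src2 k * (G ^+ 2 * (t0 ^- 2 * t0 `^ (- alpha) * r `^ alpha * r ^- k.+1)) =
     ((k%:R / cm) ^+ k * 2 * G ^+ 2) * (T ^+ 2 * (t0 ^- 2 * t0 `^ (- alpha) * r `^ alpha * r ^- k.+1)).
    by rewrite /C_src2; ring.
  by rewrite ler_wpM2l// !mulr_ge0 ?sqr_ge0 ?exprn_ge0 ?divr_ge0 ?(ltW cm0).
apply: (le_trans (ler_normD _ _)); apply: (le_trans (lerD E1 E2)).
rewrite /C_src.
have c1 : 0 <= C_src1 k.
  by rewrite /C_src1 !mulr_ge0 ?exprn_ge0 ?divr_ge0 ?addr_ge0 ?mulr_ge0 ?(ltW cm0) ?(ltW cp0).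
have c2 : 0 <= C_src2 k.
  by rewrite /C_src2 !mulr_ge0 ?exprn_ge0 ?divr_ge0 ?(ltW cm0) ?(ltW T0).
have e1 := mulr_ge0 (mulr_ge0 A0 B0) w0.
have e2 := mulr_ge0 G0 w0.
have -> : (2 + C_src1 k + C_src2 k) * (A * B + G) * weight k t0 r =
  (2 + C_src1 k + C_src2 k) * (A * B * weight k t0 r + G * weight k t0 r) by ring.
move: c1 c2 e1 e2; move: (C_src1 k) (C_src2 k) (_ * weight k t0 r) (G * _) => x y u v; nra.
Qed.


(* Equals [Ds es (xi j t0) (x0 + z)] at [r = 0]; Duhamel's formula is the
   integral of its derivative. *)
Definition propag (es : seq L) j (t0 : R) x0 z (r : R) : R :=
  Ds es (heat (abar t0 x0 * r) (xi j (t0 - r))) (x0 + z).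

Lemma is_derive_propag es j (t0 r : R) x0 z : 0 < r < t0 -> t0 <= T ->
  is_derive r 1 (propag es j t0 x0 z)
    (- Ds es (heat (abar t0 x0 * r) (D (eps j) (source x0 t0 r))) (x0 + z)).
Proof.
move=> /andP[r0 rt] t0T.
pose h y := abar (t0 - r) y * Lap (psi (t0 - r)) y + g (t0 - r) y.
have hxi y : is_derive r 1 (fun r => xi j (t0 - r) y) (- D (eps j) h y).
  have tT : 0 < t0 - r < T by apply/andP; split; lra.
  have h1 : is_derive r 1 (fun r : R => t0 - r) (-1).
    apply: is_derive_eq (is_deriveB (is_derive_cst t0 r 1) (is_derive_id r 1)) _.
    by rewrite sub0r.
  apply: is_derive_eq (@is_derive1_comp _ (fun s => xi j s y) _ r _ _ (xi_derive j y tT) h1) _.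
  by rewrite mulrN1.
have ha : is_derive r 1 (fun r : R => abar t0 x0 * r) (abar t0 x0).
  apply: is_derive_eq (is_deriveZ _ (is_derive_id r 1)) _.
  by rewrite /GRing.scale/= mulr1.
rewrite /propag -diffsN; apply: is_derive_diffs => y.
apply: is_derive_eq (is_derive_heat p_derive y ha hxi) _.
rewrite -heatZ -heatD -heatN; congr (heat _ _ _); apply/funext => w.
rewrite lap_fdiff /source /fdiff /h; ring.
Qed.

(* Integration turns the weight in [r] into [r `^ dexp k]. *)
Definition dexp k : R := (alpha - k%:R + 1) / 2.

Lemma weightE k t0 r : weight k t0 r = t0 `^ (- (1 + alpha / 2)) * r `^ (dexp k - 1).
Proof.
rewrite /weight /dexp; congr (_ * _ `^ _).
by rewrite -natr1; field.
Qed.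

Lemma C_src_ge0 k : 0 < cp -> 0 <= C_src k.
Proof.
move=> cp0; rewrite /C_src /C_src1 /C_src2.
rewrite !addr_ge0 ?mulr_ge0 ?exprn_ge0 ?divr_ge0 ?addr_ge0 ?mulr_ge0 ?(ltW cm0) ?(ltW cp0) ?(ltW T0)//.
Qed.

Lemma cp_gt0 (t0 : R) (x0 : L) : 0 < t0 <= T -> 0 < cp.
Proof.
by move=> h; have /andP[h1 h2] := abar_bnd x0 h; exact: lt_le_trans cm0 (le_trans h1 h2).
Qed.

Lemma propag_int es j (t0 r1 r2 : R) x0 z :
  (forall e, e \in es -> unit_step eps e) -> dexp (size es) != 0 ->
  0 < r1 -> r1 <= r2 -> r2 <= t0 / 2 -> t0 <= T -> q z <= r1 ->
  `|propag es j t0 x0 z r2 - propag es j t0 x0 z r1| <=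
  C_src (size es) * (A * B + G) * t0 `^ (- (1 + alpha / 2)) *
    ((r2 `^ dexp (size es) - r1 `^ dexp (size es)) / dexp (size es)).
Proof.
move=> hes b0 r10 r12 r2t t0T qz.
apply: (powR_MVT r10 r12 b0 (dF := fun r => - Ds es (heat (abar t0 x0 * r) (D (eps j) (source x0 t0 r))) (x0 + z))).
  by move=> r /andP[r1r rr2]; apply: is_derive_propag => //; apply/andP; split; lra.
move=> r /andP[r1r rr2]; rewrite normrN -mulrA -weightE.
by apply: source_bnd => //; lra.
Qed.

(** Integration down to 0 forces [z = 0], because [q z <= r] must persist as [r] tends to 0. *)
Lemma propag_int0 es j (t0 r : R) x0 :
  (forall e, e \in es -> unit_step eps e) -> 0 < dexp (size es) ->
  0 < r -> r <= t0 / 2 -> t0 <= T -> q 0 = 0 ->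
  `|propag es j t0 x0 0 r - Ds es (xi j t0) x0| <=
  C_src (size es) * (A * B + G) * t0 `^ (- (1 + alpha / 2)) *
    (r `^ dexp (size es) / dexp (size es)).
Proof.
move=> hes b0 r0 rt t0T q0.
have t0T' : 0 < t0 <= T by apply/andP; split; lra.
have -> : Ds es (xi j t0) x0 = propag es j t0 x0 0 0.
  by rewrite /propag mulr0 heat0// subr0 addr0.
apply: (powR_MVT0 (dF := fun r => - Ds es (heat (abar t0 x0 * r) (D (eps j) (source x0 t0 r))) (x0 + 0))) => //.
- exact: mulr_ge0 (mulr_ge0 (C_src_ge0 _ (cp_gt0 x0 t0T')) (addr_ge0 (mulr_ge0 A0 B0) G0)) (powR_ge0 _ _).
- rewrite /propag; apply: cvg_diffs => y; rewrite /heat.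
  have -> : \sum_y0 p (abar t0 x0 * 0) y0 * xi j (t0 - 0) (y + y0) =
            \sum_y0 p 0 y0 * xi j t0 (y + y0) by rewrite mulr0 subr0.
  apply: (cvg_big (P := xpredT) (op := +%R) (x0 := 0)); first exact: add_continuous.
  move=> w _; apply: cvgM.
    have h : p s w @[s --> 0] --> p 0 w.
      by apply: differentiable_continuous; apply/derivable1_diffP; exact: (@ex_derive _ _ _ _ _ _ _ (p_derive 0 w)).
    have h' : abar t0 x0 * r @[r --> (0:R)^'+] --> abar t0 x0 * 0.
      by apply: cvgMr; apply: cvg_at_right_filter; exact: cvg_id.
    by rewrite mulr0 in h'; exact: cvg_comp h' h.
  (* Left continuity is enough, as [t0 - r] approaches [t0] from below; this includes [t0 = T]. *)
  have h := @xi_cont j t0 (y + w) t0T'.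
  apply: (@cvg_comp _ _ _ (fun r => t0 - r) (fun s => xi j s (y + w)) _ _ _ _ h).
  move=> P [e /= e0 he]; exists e => //= r' hr' r'0; apply: he => /=.
    by move: hr'; rewrite /= sub0r normrN => h'; rewrite opprB addrC subrK.
  by rewrite gtrBl.
- by move=> x /andP[x00 xr]; apply: is_derive_propag => //; apply/andP; split; lra.
- move=> x /andP[x00 xr]; rewrite normrN -mulrA -weightE.
  apply: source_bnd => //; first by lra.
  by rewrite q0 ltW.
Qed.

Definition C_dxi : R := C_src 1 * (2 / alpha).

(** At [h = la^2 t0] the Duhamel integral contributes [la^alpha]. The remaining value is one
    difference of a kernel at time of order [h], applied to [xi] of size [M / sqrt t0], which gives
    [M / (la t0)]. *)
Lemma dxi_step i j (t0 la : R) x0 : 0 < t0 <= T -> q 0 = 0 -> 0 < la -> la ^+ 2 <= 2^-1 ->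
  t0 * `|D (eps i) (xi j t0) x0| <=
  C_dxi * la `^ alpha * (A * B + G) + (1 + 2 / cm) * (M / la).
Proof.
move=> /andP[t00 t0T] q0 la0 la2.
have t0T' : 0 < t0 <= T by rewrite t00.
pose h := la ^+ 2 * t0.
have h0 : 0 < h by rewrite mulr_gt0 ?exprn_gt0.
have ht : h <= t0 / 2 by rewrite /h mulrC ler_wpM2l// ltW.
have b1 : dexp 1 = alpha / 2 by rewrite /dexp; field.
have hes e : e \in [:: eps i] -> unit_step eps e by rewrite inE => /eqP->; exact: unit_stepP.
have := @propag_int0 [:: eps i] j t0 h x0 hes _ h0 ht t0T q0.
rewrite /= b1 => /(_ (divr_gt0 a0 _))-/(_ ltac:(by [])) E1.
have E2 : `|propag [:: eps i] j t0 x0 0 h| <= (1 + 2 / cm) * (M / (la * t0)).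
  have c0 : 0 <= 2 / cm by rewrite divr_ge0// ltW.
  apply: ler_norm_sqrM => //; first by rewrite divr_ge0// mulr_ge0// ltW.
  rewrite /propag.
  have ha := abar_gt0 x0 t0T'.
  have sT : 0 < t0 - h <= T by apply/andP; split; lra.
  have xb y : xi j (t0 - h) y ^+ 2 <= M ^+ 2 / (t0 / 2).
    apply: (le_trans (xi_bnd _ _ sT)); rewrite ler_wpM2l ?sqr_ge0// lef_pV2 ?posrE; lra.
  apply: (le_trans (heat_diffs_bound p_ge0 p_sum p_0 p_derive (x0 + 0) (mulr_gt0 ha h0) hes xb)).
  rewrite /= expr1 div1r.
  have /andP[acm _] := abar_bnd x0 t0T'.
  apply: (@le_trans _ _ ((cm * h)^-1 * (M ^+ 2 / (t0 / 2)))).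
    rewrite ler_wpM2r ?divr_ge0 ?sqr_ge0//; first by lra.
    by rewrite lef_pV2 ?posrE ?mulr_gt0// ler_pM2r.
  rewrite le_eqVlt; apply/orP; left; apply/eqP; rewrite /h; field.
  by rewrite (gt_eqF la0) (gt_eqF t00) (gt_eqF cm0).
have E3 : t0 * (t0 `^ (- (1 + alpha / 2)) * h `^ (alpha / 2)) = la `^ alpha.
  rewrite /h powRM ?sqr_ge0 ?(ltW t00)// -[la ^+ 2]powR_mulrn ?(ltW la0)// -powRrM.
  have -> : 2%:R * (alpha / 2) = alpha by field.
  transitivity (la `^ alpha * (t0 `^ 1 * t0 `^ (- (1 + alpha / 2)) * t0 `^ (alpha / 2))).
    by rewrite powRr1 ?(ltW t00)//; ring.
  rewrite -!powRD ?(gt_eqF t00) ?implybT//.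
  by rewrite (_ : _ + _ = 0) ?powRr0 ?mulr1//; field.
have : `|Ds [:: eps i] (xi j t0) x0| <= C_src 1 * (A * B + G) * t0 `^ (- (1 + alpha / 2)) *
     (h `^ (alpha / 2) / (alpha / 2)) + (1 + 2 / cm) * (M / (la * t0)).
  rewrite -(subrK (propag [:: eps i] j t0 x0 0 h) (Ds [:: eps i] (xi j t0) x0)).
  by apply: (le_trans (ler_normD _ _)); rewrite lerD// distrC.
move=> /(ler_wpM2l (ltW t00)) /le_trans; apply.
rewrite -E3 /C_dxi le_eqVlt; apply/orP; left; apply/eqP; field.
by rewrite (gt_eqF a0) (gt_eqF la0) (gt_eqF t00) (gt_eqF cm0).
Qed.


(** * Hoelder continuity in space *)

Hypothesis q_0 : q 0 = 0.
Hypothesis q_step : forall e m, unit_step eps e -> q (e *+ m) <= (m%:R / nu) ^+ 2.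
Hypothesis nu0 : 0 < nu.

(** The power of [t] is the inverse of the weight [d^(2 + alpha)] of the seminorms. *)
Definition scal (t : R) : R := (A * B + B + G) * t `^ (- (1 + alpha / 2)).

Lemma size_ge0 : 0 <= A * B + G. Proof. by rewrite addr_ge0// mulr_ge0. Qed.

Lemma size_le : A * B + G <= A * B + B + G. Proof. by rewrite lerD2r lerDl. Qed.

Lemma scal_ge0 t : 0 <= scal t.
Proof. by rewrite mulr_ge0 ?powR_ge0// !addr_ge0// mulr_ge0. Qed.

Lemma scal_ge (t : R) (c : R) : 0 <= c -> c <= A * B + B + G -> c * t `^ (- (1 + alpha / 2)) <= scal t.
Proof. by move=> c0 cS; rewrite ler_wpM2r ?powR_ge0. Qed.

Lemma dxi_le i j t x : 0 < t <= T -> `|D (eps i) (xi j t) x| <= B / t.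
Proof. by move=> /andP[t0 tT]; rewrite ler_pdivlMr// mulrC; apply: dxi_bnd; rewrite t0. Qed.

Definition C_third : R := C_src 2 * (2 / (1 - alpha)) + (1 + 8 / cm).

(** Here [dexp 2 < 0], so Duhamel's integral runs from [r] up to [t0 / 2] instead of down to 0. At
    [t0 / 2] one difference on the kernel and the bound [B] on the others suffice. *)
Lemma third_diff i j (t0 r : R) x0 z e : unit_step eps e ->
  0 < r -> r <= t0 / 2 -> t0 <= T -> q z <= r ->
  `|propag [:: e; eps i] j t0 x0 z r| <= C_third * scal t0 * r `^ ((alpha - 1) / 2).
Proof.
have a0' := a0; have a1' := a1.
move=> he r0 rt t0T qz.
have t00 : 0 < t0 by lra.
have t0T' : 0 < t0 <= T by rewrite t00.
have b2 : dexp 2 = (alpha - 1) / 2 by rewrite /dexp; field.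
have hes e' : e' \in [:: e; eps i] -> unit_step eps e'.
  by rewrite !inE => /orP[] /eqP->//; exact: unit_stepP.
pose h := t0 / 2.
have sT : 0 < t0 - h <= T by rewrite /h; apply/andP; split; lra.
have h0 : 0 < h by rewrite /h; lra.
have w0 := powR_ge0 t0 (- (1 + alpha / 2)).
have r1 := powR_ge0 r ((alpha - 1) / 2).
have cp0 := cp_gt0 x0 t0T'.
have E1 : `|propag [:: e; eps i] j t0 x0 z h - propag [:: e; eps i] j t0 x0 z r| <=
   C_src 2 * (2 / (1 - alpha)) * scal t0 * r `^ ((alpha - 1) / 2).
  have := @propag_int [:: e; eps i] j t0 r h x0 z hes _ r0 rt (lexx _) t0T qz.
  rewrite /= b2 => /(_ _)/le_trans; apply; first by rewrite lt_eqF//; lra.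
  have -> : C_src 2 * (A * B + G) * t0 `^ (- (1 + alpha / 2)) *
     ((h `^ ((alpha - 1) / 2) - r `^ ((alpha - 1) / 2)) / ((alpha - 1) / 2)) =
     C_src 2 * (2 / (1 - alpha)) * ((A * B + G) * t0 `^ (- (1 + alpha / 2))) *
      (r `^ ((alpha - 1) / 2) - h `^ ((alpha - 1) / 2)).
    by field; rewrite !subr_eq0 (lt_eqF a1') (gt_eqF a1').
  apply: ler_pM.
  - rewrite !mulr_ge0 ?C_src_ge0 ?size_ge0 ?invr_ge0//; lra.
  - rewrite subr_ge0.
    have -> : (alpha - 1) / 2 = - ((1 - alpha) / 2) by field.
    rewrite !powRN lef_pV2 ?posrE ?powR_gt0// ge0_ler_powR ?nnegrE ?(ltW r0) ?(ltW h0)//; lra.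
  - rewrite ler_wpM2l ?mulr_ge0 ?C_src_ge0 ?invr_ge0//; first by lra.
    by apply: scal_ge; [exact: size_ge0|exact: size_le].
  - by rewrite gerBl powR_ge0.
have E2 : `|propag [:: e; eps i] j t0 x0 z h| <= (1 + 8 / cm) * (B * weight 0 t0 r).
  have c0 : 0 <= 8 / cm by rewrite divr_ge0// ltW.
  apply: ler_norm_sqrM => //; first by rewrite mulr_ge0// weight_ge0.
  rewrite /propag (diffs_rcons nu [:: e]) fdiff_heat.
  have ha := abar_gt0 x0 t0T'.
  have he' e' : e' \in [:: e] -> unit_step eps e' by rewrite inE => /eqP->.
  have vb y : D (eps i) (xi j (t0 - h)) y ^+ 2 <= (B / (t0 / 2)) ^+ 2.
    rewrite -(real_normK (num_real _)) ler_sqr ?nnegrE//; last by rewrite divr_ge0//; lra.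
    apply: (le_trans (dxi_le _ _ _ sT)); rewrite ler_wpM2l// lef_pV2 ?posrE /h; lra.
  apply: (le_trans (heat_diffs_bound p_ge0 p_sum p_0 p_derive (x0 + z) (mulr_gt0 ha h0) he' vb)).
  rewrite /= expr1 div1r.
  have /andP[acm _] := abar_bnd x0 t0T'.
  apply: (@le_trans _ _ ((cm * h)^-1 * (B / (t0 / 2)) ^+ 2)).
    rewrite ler_wpM2r ?sqr_ge0//.
    by rewrite lef_pV2 ?posrE ?mulr_gt0// ler_pM2r.
  have rt0 : r <= t0 by lra.
  have hw := weight_sqr_ge 0 r0 rt0.
  have -> : 8 / cm * (B * weight 0 t0 r) ^+ 2 = 8 / cm * B ^+ 2 * weight 0 t0 r ^+ 2 by ring.
  have -> : (cm * h)^-1 * (B / (t0 / 2)) ^+ 2 = 8 / cm * B ^+ 2 * (t0 ^- 3 * r ^- 0).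
    rewrite /h expr0 invr1 mulr1; field.
    by rewrite (gt_eqF t00) (gt_eqF cm0).
  by rewrite ler_wpM2l// mulr_ge0 ?sqr_ge0.
rewrite -[X in `|X|](subrK (propag [:: e; eps i] j t0 x0 z h)).
apply: (le_trans (ler_normD _ _)); rewrite distrC.
apply: (le_trans (lerD E1 E2)); 
have -> : C_third * scal t0 * r `^ ((alpha - 1) / 2) =
  C_src 2 * (2 / (1 - alpha)) * scal t0 * r `^ ((alpha - 1) / 2) +
  (1 + 8 / cm) * (scal t0 * r `^ ((alpha - 1) / 2)) by rewrite /C_third; ring.
rewrite lerD2l ler_wpM2l ?addr_ge0 ?divr_ge0 ?(ltW cm0)//.
rewrite /weight mulrA ler_wpM2r ?powR_ge0//; apply: scal_ge => //.
by rewrite -addrA addrCA lerDl size_ge0.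
Qed.

Lemma telescope_fdiff (u : L -> R) x e m K :
  (forall l, (l < m)%N -> `|D e u (x + e *+ l)| <= K) ->
  `|u (x + e *+ m) - u x| <= m%:R / nu * K.
Proof.
elim: m => [|m IH] h; first by rewrite mulr0n addr0 subrr normr0 !mul0r.
have -> : u (x + e *+ m.+1) - u x = nu^-1 * D e u (x + e *+ m) + (u (x + e *+ m) - u x).
  rewrite /fdiff mulrA mulVf ?(gt_eqF nu0)// mul1r mulrSr addrA; ring.
apply: (le_trans (ler_normD _ _)).
rewrite -nat1r mulrDl mulrDl lerD//.
  by rewrite normrM ger0_norm ?invr_ge0 ?(ltW nu0)// div1r ler_wpM2l ?invr_ge0 ?(ltW nu0)// h.
by apply: IH => l lm; apply: h; exact: ltnW.
Qed.

Lemma abar_diff (t0 r : R) x z : 0 < r -> r <= t0 / 2 -> t0 <= T -> q z <= r ->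
  `|abar (t0 - r) (x + z) - abar t0 x| <= 2 * A * t0 `^ (- (alpha / 2)) * r `^ (alpha / 2).
Proof.
move=> r0 rt t0T qz.
have t00 : 0 < t0 by lra.
apply: ler_norm_sqr; first by rewrite !mulr_ge0 ?powR_ge0.
apply: (le_trans (@abar_holder (t0 - r) t0 x z _ _ t0T)); [lra|lra|].
rewrite subKr max_l//.
rewrite [leRHS]exprMn exprMn !powR_sqr ?(ltW r0) ?(ltW t00)//.
have -> : alpha / 2 * 2 = alpha by field.
have -> : - (alpha / 2) * 2 = - alpha by field.
rewrite ler_wpM2r ?powR_ge0//.
apply: (@le_trans _ _ (A ^+ 2 * (2 * t0 `^ (- alpha)))).
  by rewrite ler_wpM2l ?sqr_ge0// powR_half.
rewrite mulrA ler_wpM2r ?powR_ge0//.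
by have := sqr_ge0 A; rewrite exprMn; lra.
Qed.

Lemma powR_far (t x : R) ex : 0 < t -> 0 <= ex <= 1 -> t / 2 <= x -> t `^ ex <= 2 * x `^ ex.
Proof.
move=> t0 /andP[b0 b1] tx.
have -> : t = 2 * (t / 2) by field.
have t2 : 0 <= t / 2 by lra.
rewrite powRM// ler_pM ?powR_ge0//.
  by apply: ler1_powR => //; rewrite ler1n.
by rewrite ge0_ler_powR// nnegrE; lra.
Qed.

Definition C_space : R := 4 + C_third + 2 * (C_src 1 * (2 / alpha)) + 16 * n%:R / cm.

Lemma dxi_holder_step i j (t0 : R) x0 e m : 0 < t0 <= T -> unit_step eps e -> (0 < m)%N ->
  `|D (eps i) (xi j t0) (x0 + e *+ m) - D (eps i) (xi j t0) x0| <=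
  C_space * scal t0 * (m%:R / nu) `^ alpha.
Proof.
have a0' := a0; have a1' := a1.
move=> t0T' he m0; have /andP[t00 t0T] := t0T'.
set y := x0 + e *+ m; set rho := m%:R / nu.
have rho0 : 0 < rho by rewrite divr_gt0 ?ltr0n.
pose r := rho ^+ 2.
have r0 : 0 < r by rewrite exprn_gt0.
have cp0 := cp_gt0 x0 t0T'.
have c3 : 0 <= C_third.
  by rewrite /C_third !addr_ge0 ?mulr_ge0 ?C_src_ge0 ?invr_ge0 ?(ltW cm0)//; lra.
have c1 : 0 <= 2 * (C_src 1 * (2 / alpha)).
  by rewrite !mulr_ge0 ?C_src_ge0 ?invr_ge0// ltW.
have c4 : 0 <= 16 * n%:R / cm by rewrite divr_ge0// ltW.
have ra : r `^ (alpha / 2) = rho `^ alpha.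
  by rewrite /r -[rho ^+ 2]powR_mulrn ?(ltW rho0)// -powRrM; congr (_ `^ _); field.
have s0 := scal_ge0 t0.
have rp := powR_ge0 rho alpha.
have sr0 : 0 <= scal t0 * rho `^ alpha by rewrite mulr_ge0.
have sB : B / t0 * t0 `^ (- (alpha / 2)) <= scal t0.
  apply: (@le_trans _ _ (B * t0 `^ (- (1 + alpha / 2)))); last first.
    by apply: scal_ge => //; rewrite -addrA addrCA lerDl size_ge0.
  rewrite opprD powRD ?(gt_eqF t00) ?implybT// powR_inv1 ?(ltW t00)//.
  by rewrite mulrA.
(* At parabolic distances beyond [sqrt (t0 / 2)] the bound [B / t0] at each point already has the
   right size. *)
have [rt|tr] := leP r (t0 / 2); last first.
  apply: (@le_trans _ _ (4 * (scal t0 * rho `^ alpha))).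
    apply: (@le_trans _ _ (B / t0 + B / t0)).
      by apply: (le_trans (ler_normB _ _)); rewrite lerD// dxi_le.
    have := @powR_far t0 r (alpha / 2) t00 _ (ltW tr); rewrite ra => /(_ _) h.
    have {}h : t0 `^ (alpha / 2) <= 2 * rho `^ alpha by apply: h; apply/andP; split; lra.
    apply: (@le_trans _ _ (2 * (B / t0 * t0 `^ (- (alpha / 2))) * (2 * rho `^ alpha))); last first.
      have -> : 4 * (scal t0 * rho `^ alpha) = 2 * scal t0 * (2 * rho `^ alpha) by ring.
      rewrite ler_wpM2r ?mulr_ge0//; lra.
    apply: (@le_trans _ _ (2 * (B / t0 * t0 `^ (- (alpha / 2))) * t0 `^ (alpha / 2))); last first.
      by rewrite ler_wpM2l// !mulr_ge0 ?powR_ge0// invr_ge0 ltW.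
    rewrite powRN -!mulrA mulVf ?mulr1; first by rewrite le_eqVlt; apply/orP; left; apply/eqP; ring.
    by rewrite gt_eqF// powR_gt0.
  rewrite -mulrA ler_wpM2r// /C_space; lra.
have sT : 0 < t0 - r <= T by apply/andP; split; lra.
have qm : q (e *+ m) <= r by exact: q_step.
have qNm : q (- (e *+ m)) <= r.
  rewrite -mulNrn; apply: q_step.
  by case: he => k [->|->]; rewrite ?opprK; [exact: unit_stepN|exact: unit_stepP].
pose v x := D (eps i) (xi j (t0 - r)) x.
have b1 : dexp 1 = alpha / 2 by rewrite /dexp; field.
have hes e' : e' \in [:: eps i] -> unit_step eps e' by rewrite inE => /eqP->; exact: unit_stepP.
have EX x : `|heat (abar t0 x * r) v x - D (eps i) (xi j t0) x| <=
    C_src 1 * (2 / alpha) * (scal t0 * rho `^ alpha).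
  have := @propag_int0 [:: eps i] j t0 r x hes _ r0 rt t0T q_0.
  rewrite /= b1 => /(_ (divr_gt0 a0 _))-/(_ ltac:(by [])).
  rewrite /propag /= addr0 fdiff_heat ra => /le_trans; apply.
  have -> : C_src 1 * (A * B + G) * t0 `^ (- (1 + alpha / 2)) * (rho `^ alpha / (alpha / 2)) =
    C_src 1 * (2 / alpha) * (((A * B + G) * t0 `^ (- (1 + alpha / 2))) * rho `^ alpha).
    by field; rewrite (gt_eqF a0).
  rewrite ler_wpM2l ?mulr_ge0 ?C_src_ge0 ?invr_ge0 ?(ltW a0)// ler_wpM2r//.
  by apply: scal_ge; [exact: size_ge0|exact: size_le].
(* A path of length [rho] along which the third differences are of order [rho^(alpha - 1)]; every
   point of it satisfies [q <= r]. *)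
have E3 : `|heat (abar t0 x0 * r) v y - heat (abar t0 x0 * r) v x0| <= C_third * (scal t0 * rho `^ alpha).
  have -> : C_third * (scal t0 * rho `^ alpha) = m%:R / nu * (C_third * scal t0 * r `^ ((alpha - 1) / 2)).
    have -> : r `^ ((alpha - 1) / 2) = rho `^ (alpha - 1).
      by rewrite /r -[rho ^+ 2]powR_mulrn ?(ltW rho0)// -powRrM; congr (_ `^ _); field.
    by rewrite -/rho -(@mulr_powRB1 _ rho alpha) ?(ltW rho0)//; ring.
  apply: telescope_fdiff => l lm.
  rewrite fdiff_heat.
  have := @third_diff i j t0 r x0 (e *+ l) e he r0 rt t0T.
  rewrite /propag (diffs_rcons nu [:: e]) fdiff_heat /= fdiff_heat; apply.
  apply: (le_trans (q_step _ he)); rewrite /r ler_sqr ?nnegrE ?divr_ge0 ?(ltW nu0)//.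
  by rewrite ler_wpM2r ?invr_ge0 ?(ltW nu0)// ler_nat ltnW.
(* Each point has its own frozen diffusivity. Exchanging them changes the running time by [r] times
   an increment of [abar], that is by a fraction of order [rho^alpha]. *)
have E4 : `|heat (abar t0 y * r) v y - heat (abar t0 x0 * r) v y| <= 16 * n%:R / cm * (scal t0 * rho `^ alpha).
  have /andP[acx _] := abar_bnd x0 t0T'; have /andP[acy _] := abar_bnd y t0T'.
  have vb z : `|v z| <= 2 * B / t0.
    apply: (le_trans (dxi_le _ _ _ sT)).
    have -> : 2 * B / t0 = B / (t0 / 2) by field; rewrite (gt_eqF t00).
    by rewrite ler_wpM2l// lef_pV2 ?posrE; lra.
  have B2 : 0 <= 2 * B / t0 by rewrite divr_ge0 ?mulr_ge0// ltW.
  have := @heat_time_change _ _ _ eps nu p p_ge0 p_sum p_0 p_derive (cm * r) (2 * B / t0) (abar t0 x0 * r) (abar t0 y * r) v y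
     (mulr_gt0 cm0 r0) _ _ B2 vb.
  rewrite !ler_pM2r// => /(_ acx acy)/le_trans; apply.
  (* As [abar_holder] compares distinct times only, the passage from [x0] to [y] goes through time
     [t0 - r], at the same parabolic distance. *)
  have ad : `|abar t0 y - abar t0 x0| <= 4 * A * t0 `^ (- (alpha / 2)) * rho `^ alpha.
    have h1 := @abar_diff t0 r x0 0 r0 rt t0T; rewrite q_0 addr0 ra in h1.
    have h2 := @abar_diff t0 r y (- (e *+ m)) r0 rt t0T qNm; rewrite addrK ra distrC in h2.
    rewrite -[X in `|X|](subrKA (abar (t0 - r) x0)).
    apply: (le_trans (ler_normD _ _)); have := h1 (ltW r0); lra.
  rewrite -mulrBl normrM (ger0_norm (ltW r0)).
  apply: (@le_trans _ _ (2 * n%:R / (cm * r) * (2 * B / t0) * ((4 * A * t0 `^ (- (alpha / 2)) * rho `^ alpha) * r))).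
    rewrite ler_wpM2l//; last by rewrite ler_pM2r.
    by rewrite mulr_ge0// !mulr_ge0// invr_ge0 mulr_ge0 ?(ltW cm0) ?(ltW r0).
  have -> : 2 * n%:R / (cm * r) * (2 * B / t0) * (4 * A * t0 `^ (- (alpha / 2)) * rho `^ alpha * r) =
     16 * n%:R / cm * ((A * (B / t0 * t0 `^ (- (alpha / 2)))) * rho `^ alpha).
    by field; rewrite (gt_eqF cm0) (gt_eqF r0) (gt_eqF t00).
  rewrite ler_wpM2l// ler_wpM2r//.
  apply: (@le_trans _ _ ((A * B) * t0 `^ (- (1 + alpha / 2)))).
    by rewrite opprD powRD ?(gt_eqF t00) ?implybT// powR_inv1 ?(ltW t00)// !mulrA.
  by apply: scal_ge; [rewrite mulr_ge0|rewrite -addrA lerDl addr_ge0].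
have -> : D (eps i) (xi j t0) y - D (eps i) (xi j t0) x0 =
   - (heat (abar t0 y * r) v y - D (eps i) (xi j t0) y) +
   (heat (abar t0 y * r) v y - heat (abar t0 x0 * r) v y) +
   (heat (abar t0 x0 * r) v y - heat (abar t0 x0 * r) v x0) +
   (heat (abar t0 x0 * r) v x0 - D (eps i) (xi j t0) x0) by ring.
have X1 := EX x0; have X2 := EX y; rewrite -normrN in X2.
apply: (le_trans (ler_normD _ _)); apply: (le_trans (lerD (ler_normD _ _) (lexx _))).
apply: (le_trans (lerD (lerD (ler_normD _ _) (lexx _)) (lexx _))).
rewrite -[C_space * _ * _]mulrA /C_space; set Z := scal t0 * _ in X1 X2 E3 E4 sr0 *.
move: X1 X2 E3 E4; set k1 := C_src 1 * _; move: (16 * _ / cm) => k4; lra.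
Qed.


Hypothesis q_rep : forall x, exists2 k : 'I_n -> int, x = \sum_i eps i *~ k i &
  forall i, (`|k i|%N%:R / nu) ^+ 2 <= q x.

Lemma C_space_ge0 : 0 < cp -> 0 <= C_space.
Proof.
move=> cp0; have a0' := a0; have a1' := a1.
have i1 : 0 <= 2 / alpha by rewrite divr_ge0// ltW.
have i2 : 0 <= 2 / (1 - alpha) by rewrite divr_ge0//; lra.
have i3 : 0 <= 8 / cm by rewrite divr_ge0// ltW.
have i4 : 0 <= 16 * n%:R / cm by rewrite divr_ge0// ltW.
have k1 := mulr_ge0 (C_src_ge0 1 cp0) i1; have k2 := mulr_ge0 (C_src_ge0 2 cp0) i2.
rewrite /C_space /C_third; lra.
Qed.

Lemma C_space_scal_ge0 t : 0 < cp -> 0 <= C_space * scal t.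
Proof. by move=> cp0; exact: mulr_ge0 (C_space_ge0 cp0) (scal_ge0 t). Qed.

Lemma nC_space_scal_ge0 t : 0 < cp -> 0 <= n%:R * C_space * scal t.
Proof. by move=> cp0; rewrite -mulrA; exact: mulr_ge0 (ler0n _ _) (C_space_scal_ge0 t cp0). Qed.

Lemma ge_addl2 (x y z : R) : 0 <= y -> 0 <= z -> x <= x + y + z.
Proof. by move=> y0 z0; rewrite -addrA lerDl addr_ge0. Qed.

Lemma ge_addr1 (x y : R) : x + y <= 4 + x + y.
Proof. lra. Qed.

Lemma nC_space_ge0 : 0 < cp -> 0 <= (2 + 2 * n%:R) * (n%:R * C_space).
Proof.
move=> cp0; apply: mulr_ge0; first by rewrite addr_ge0// mulr_ge0.
exact: mulr_ge0 (ler0n _ _) (C_space_ge0 cp0).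
Qed.

Lemma nnC_space_ge0 : 0 < cp -> 0 <= n%:R * (2 + 2 * n%:R) * (n%:R * C_space) * 2.
Proof. by move=> cp0; rewrite mulr_ge0// -mulrA; exact: mulr_ge0 (ler0n _ _) (nC_space_ge0 cp0). Qed.

Lemma dxi_holder_dir i j (t0 : R) x0 l (k : int) : 0 < t0 <= T ->
  `|D (eps i) (xi j t0) (x0 + eps l *~ k) - D (eps i) (xi j t0) x0| <=
  C_space * scal t0 * (`|k|%N%:R / nu) `^ alpha.
Proof.
move=> t0T; have cp0 := cp_gt0 x0 t0T.
case: k => [[|m]|m].
- by rewrite mulr0z addr0 subrr normr0; exact: mulr_ge0 (C_space_scal_ge0 _ cp0) (powR_ge0 _ _).
- by apply: dxi_holder_step => //; exact: unit_stepP.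
- rewrite NegzE mulrNz -mulNrz; apply: dxi_holder_step => //; exact: unit_stepN.
Qed.

(** One axis at a time. The sum over coordinates is the form suited to interpolation, where the
    coordinates are rounded independently; heat averages use the form in [q] below. *)
Lemma dxi_holder_sum i j (t0 : R) x0 (k : 'I_n -> int) : 0 < t0 <= T ->
  `|D (eps i) (xi j t0) (x0 + \sum_l eps l *~ k l) - D (eps i) (xi j t0) x0| <=
  C_space * scal t0 * \sum_l (`|k l|%N%:R / nu) `^ alpha.
Proof.
move=> t0T; elim: (index_enum _) => [|l r IH].
  by rewrite !big_nil addr0 subrr normr0 mulr0.
rewrite !big_cons mulrDr; set s := \sum_(_ <- r) _ in IH *.
have -> : D (eps i) (xi j t0) (x0 + (eps l *~ k l + s)) - D (eps i) (xi j t0) x0 =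
  (D (eps i) (xi j t0) (x0 + s + eps l *~ k l) - D (eps i) (xi j t0) (x0 + s)) +
  (D (eps i) (xi j t0) (x0 + s) - D (eps i) (xi j t0) x0).
  by rewrite subrKA [eps l *~ _ + s]addrC addrA.
by apply: (le_trans (ler_normD _ _)); rewrite lerD// dxi_holder_dir.
Qed.

Lemma dxi_holder_q i j (t0 : R) x0 x : 0 < t0 <= T ->
  `|D (eps i) (xi j t0) (x0 + x) - D (eps i) (xi j t0) x0| <=
  n%:R * C_space * scal t0 * q x `^ (alpha / 2).
Proof.
move=> t0T; have cp0 := cp_gt0 x0 t0T; have [k xk kq] := q_rep x.
rewrite {1}xk.
apply: (le_trans (dxi_holder_sum i j x0 k t0T)).
have -> : n%:R * C_space * scal t0 * q x `^ (alpha / 2) =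
  C_space * scal t0 * (n%:R * q x `^ (alpha / 2)) by ring.
apply: ler_wpM2l; first exact: C_space_scal_ge0.
have -> : n%:R * q x `^ (alpha / 2) = \sum_(l < n) q x `^ (alpha / 2).
  by rewrite sumr_const card_ord mulr_natl.
apply: ler_sum => l _.
have kn : 0 <= (`|k l|%N%:R : R) / nu by rewrite divr_ge0// ltW.
have -> : (`|k l|%N%:R / nu) `^ alpha = ((`|k l|%N%:R / nu) ^+ 2) `^ (alpha / 2).
  by rewrite -powR_mulrn// -powRrM; congr (_ `^ _); field.
by rewrite ge0_ler_powR ?nnegrE ?sqr_ge0 ?divr_ge0 ?(ltW a0).
Qed.

(** * Hoelder continuity in time *)

Lemma dxi_centered i j (t th : R) x0 : 0 < t <= T -> 0 < th ->
  heat th (fun y => (D (eps i) (xi j t) y - D (eps i) (xi j t) x0) ^+ 2) x0 <=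
  (1 + 2 * n%:R) * (n%:R * C_space * scal t * th `^ (alpha / 2)) ^+ 2.
Proof.
move=> tT th0; have cp0 := cp_gt0 x0 tT.
set K := n%:R * C_space * scal t.
have K0 : 0 <= K := nC_space_scal_ge0 t cp0.
(* Linearizing [q^alpha] at [th] reduces the average to the second moment, of order [th]. *)
have h y : (D (eps i) (xi j t) y - D (eps i) (xi j t) x0) ^+ 2 <=
    (K * th `^ (alpha / 2)) ^+ 2 * (1 + th^-1 * q (- x0 + y)).
  have := dxi_holder_q i j x0 (- x0 + y) tT; rewrite addNKr -/K => h; clearbody K.
  rewrite -(real_normK (num_real _)); apply: (@le_trans _ _ ((K * q (- x0 + y) `^ (alpha / 2)) ^+ 2)).
    by rewrite ler_sqr ?nnegrE// mulr_ge0 ?powR_ge0.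
  rewrite !exprMn -[leRHS]mulrA ler_wpM2l ?sqr_ge0// !powR_sqr ?q_ge0 ?(ltW th0)//.
  rewrite [_ / 2 * 2]divfK ?pnatr_eq0// [th^-1 * _]mulrC.
  by apply: powR_le_affine; rewrite ?(ltW a0) ?(ltW a1).
apply: (le_trans (ler_heat p_ge0 _ (ltW th0) h)).
rewrite heatZ heatD heat_cst// heatZ [leRHS]mulrC ler_wpM2l ?sqr_ge0// lerD2l.
rewrite mulrC ler_pdivrMr//.
have := @heat_moment _ _ _ eps nu p p_ge0 p_sum p_0 p_derive (fun y => q (- x0 + y)) (2 * n%:R) th x0 (ltW th0).
rewrite addNr q_0 add0r; apply => y.
by rewrite lap_shift.
Qed.

Definition C_time1 : R :=
  4 + C_src 1 * (2 / alpha) + (2 + 2 * n%:R) * (n%:R * C_space) * (1 + cp).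

Lemma scal_homo (s t : R) : 0 < s -> s <= t -> scal t <= scal s.
Proof.
move=> s0 st; rewrite ler_wpM2l ?addr_ge0 ?mulr_ge0//.
rewrite !powRN lef_pV2 ?posrE ?powR_gt0 ?(lt_le_trans s0)//.
have t0 := lt_le_trans s0 st; have a0' := a0.
by rewrite ge0_ler_powR ?nnegrE ?(ltW s0) ?(ltW t0)//; lra.
Qed.

Lemma powR_cp (r th x : R) : 0 < r -> 0 <= th <= cp * r -> 0 <= x <= 1 -> th `^ x <= (1 + cp) * r `^ x.
Proof.
move=> r0 /andP[th0 thr] x01; have x0 : 0 <= x by case/andP: x01.
have cp0 : 0 <= cp by rewrite -(ler_pM2r r0) mul0r (le_trans th0).
apply: (@le_trans _ _ ((cp * r) `^ x)).
  by rewrite ge0_ler_powR// nnegrE// mulr_ge0// ltW.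
rewrite powRM ?(ltW r0)// ler_wpM2r ?powR_ge0//.
by have := @powR_le_affine _ cp 1 x ltr01 cp0 x01; rewrite powR1 mul1r divr1.
Qed.

(** For [r = t0 - s], Duhamel's formula lands exactly at time [s], on a heat average around [x0]; by
    the spatial bound this average differs from the value at [x0] by order [r^(alpha/2)]. *)
Lemma dxi_holder_time i j (s t0 : R) x0 : 0 < s -> s < t0 -> t0 <= T ->
  `|D (eps i) (xi j t0) x0 - D (eps i) (xi j s) x0| <=
  C_time1 * scal s * (t0 - s) `^ (alpha / 2).
Proof.
move=> s0 st t0T; have a0' := a0; have a1' := a1.
have t00 : 0 < t0 by exact: lt_trans st.
have t0T' : 0 < t0 <= T by rewrite t00.
have sT : 0 < s <= T by rewrite s0 (le_trans (ltW st)).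
have cp0 := cp_gt0 x0 t0T'.
have S0 := scal_ge0 s.
set r := t0 - s; have r0 : 0 < r by rewrite subr_gt0.
have rp := powR_ge0 r (alpha / 2).
have sr0 : 0 <= scal s * r `^ (alpha / 2) := mulr_ge0 S0 rp.
have c1 : 0 <= C_src 1 * (2 / alpha) by rewrite !mulr_ge0 ?C_src_ge0 ?invr_ge0// ltW.
have c2 : 0 <= (2 + 2 * n%:R) * (n%:R * C_space) * (1 + cp).
  by apply: mulr_ge0; [exact: nC_space_ge0|rewrite addr_ge0// ltW].
rewrite -mulrA.
have [rt|tr] := leP r (t0 / 2); last first.
  apply: (@le_trans _ _ (4 * (scal s * r `^ (alpha / 2)))); last first.
    by rewrite ler_wpM2r//; exact: ge_addl2 c1 c2.
  apply: (@le_trans _ _ (2 * (B / s))).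
    apply: (le_trans (ler_normB _ _)).
    have h1 := dxi_le i j x0 t0T'; have h2 := dxi_le i j x0 sT.
    have h3 : B / t0 <= B / s by rewrite ler_wpM2l// lef_pV2 ?posrE// ltW.
    lra.
  have h : s `^ (alpha / 2) <= 2 * r `^ (alpha / 2).
    apply: (@le_trans _ _ (t0 `^ (alpha / 2))).
      by rewrite ge0_ler_powR ?nnegrE ?(ltW s0) ?(ltW t00) ?(ltW st)//; lra.
    by apply: powR_far => //; [apply/andP; split; lra|exact: ltW].
  have -> : B / s = B * s `^ (- (1 + alpha / 2)) * s `^ (alpha / 2).
    rewrite -mulrA -powRD; last by rewrite (gt_eqF s0) implybT.
    have -> : - (1 + alpha / 2) + alpha / 2 = -1 by field.
    by rewrite powR_inv1 // ltW.
  have -> : 4 * (scal s * r `^ (alpha / 2)) = 2 * (scal s * (2 * r `^ (alpha / 2))) by ring.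
  rewrite ler_wpM2l// ler_pM ?mulr_ge0 ?powR_ge0//.
  by apply: scal_ge => //; rewrite -addrA addrCA lerDl size_ge0.
have b1 : dexp 1 = alpha / 2 by rewrite /dexp; field.
have hes e' : e' \in [:: eps i] -> unit_step eps e' by rewrite inE => /eqP->; exact: unit_stepP.
have tr : t0 - r = s by rewrite /r subKr.
pose v x := D (eps i) (xi j s) x.
have E1 : `|heat (abar t0 x0 * r) v x0 - D (eps i) (xi j t0) x0| <=
    C_src 1 * (2 / alpha) * (scal s * r `^ (alpha / 2)).
  have := @propag_int0 [:: eps i] j t0 r x0 hes _ r0 rt t0T q_0.
  rewrite /= b1 => /(_ (divr_gt0 a0 _))-/(_ ltac:(by [])).
  rewrite /propag /= addr0 fdiff_heat tr => /le_trans; apply.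
  have -> : C_src 1 * (A * B + G) * t0 `^ (- (1 + alpha / 2)) * (r `^ (alpha / 2) / (alpha / 2)) =
    C_src 1 * (2 / alpha) * (((A * B + G) * t0 `^ (- (1 + alpha / 2))) * r `^ (alpha / 2)).
    by field; rewrite (gt_eqF a0).
  rewrite ler_wpM2l// ler_wpM2r//.
  apply: (le_trans _ (scal_homo s0 (ltW st))).
  by apply: scal_ge; [exact: size_ge0|exact: size_le].
have E2 : `|heat (abar t0 x0 * r) v x0 - v x0| <=
   (2 + 2 * n%:R) * (n%:R * C_space) * (1 + cp) * (scal s * r `^ (alpha / 2)).
  have ha := abar_gt0 x0 t0T'; have /andP[_ acp] := abar_bnd x0 t0T'.
  set th := abar t0 x0 * r; have th0 : 0 < th by rewrite mulr_gt0.
  have -> : heat th v x0 - v x0 = heat th (fun y => v y - v x0) x0.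
    by rewrite heatB heat_cst.
  have thp : th `^ (alpha / 2) <= (1 + cp) * r `^ (alpha / 2).
    by apply: powR_cp; rewrite // ?(ltW th0) ?ler_pM2r//; apply/andP; split; lra.
  apply: (@le_trans _ _ ((1 + (1 + 2 * n%:R)) * (n%:R * C_space * scal s * th `^ (alpha / 2)))).
    apply: ler_norm_sqrM; first by rewrite addr_ge0 ?mulr_ge0.
      exact: mulr_ge0 (nC_space_scal_ge0 s cp0) (powR_ge0 _ _).
    by apply: (le_trans (heat_sqr p_ge0 p_sum _ _ (ltW th0))); exact: dxi_centered.
  have -> : (2 + 2 * n%:R) * (n%:R * C_space) * (1 + cp) * (scal s * r `^ (alpha / 2)) =
    (1 + (1 + 2 * n%:R)) * (n%:R * C_space * scal s * ((1 + cp) * r `^ (alpha / 2))) by ring.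
  by rewrite ler_wpM2l ?addr_ge0 ?mulr_ge0// ler_wpM2l// nC_space_scal_ge0.
have -> : D (eps i) (xi j t0) x0 - D (eps i) (xi j s) x0 =
   - (heat (abar t0 x0 * r) v x0 - D (eps i) (xi j t0) x0) + (heat (abar t0 x0 * r) v x0 - v x0).
  by rewrite /v; ring.
apply: (le_trans (ler_normD _ _)); rewrite normrN.
apply: (le_trans (lerD E1 E2)); rewrite -mulrDl ler_wpM2r// /C_time1.
exact: ge_addr1.
Qed.

Definition C_time0 : R :=
  4 + C_src 0 * 2 + n%:R * (2 + 2 * n%:R) * (n%:R * C_space) * 2 * (1 + cp).

Lemma xi_le j (t : R) x : 0 < t <= T -> `|xi j t x| <= M * t `^ (- 2^-1).
Proof.
move=> tT; have t0 : 0 < t by case/andP: tT.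
apply: ler_norm_sqr; first by rewrite mulr_ge0 ?powR_ge0.
apply: (le_trans (xi_bnd _ _ tT)).
by rewrite exprMn powR_sqr ?(ltW t0)// mulNr mulVf ?pnatr_eq0// powR_inv1// ltW.
Qed.

(** The derivative in [th] consists of second differences of the smoothed [xi]. The inner difference
    may be centered at its value at [x0], a constant killed by the outer one; this gains
    [r^(alpha/2)] over the gradient cost [r^(-1/2)]. *)
Lemma heat_xi_time j (s th : R) x0 : 0 < s <= T -> 0 < th ->
  `|heat th (xi j s) x0 - xi j s x0| <=
  n%:R * (2 + 2 * n%:R) * (n%:R * C_space) * 2 * scal s * th `^ ((1 + alpha) / 2).
Proof.
move=> sT th0; have a0' := a0; have a1' := a1.
have cp0 := cp_gt0 x0 sT; have S0 := scal_ge0 s.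
have K0 : 0 <= n%:R * (2 + 2 * n%:R) * (n%:R * C_space) * scal s.
  by apply: mulr_ge0 S0; rewrite -[X in 0 <= X]mulrA mulr_ge0// nC_space_ge0.
have b0 : 0 < (1 + alpha) / 2 by lra.
have -> : xi j s x0 = heat 0 (xi j s) x0 by rewrite heat0.
apply: (@le_trans _ _ (n%:R * (2 + 2 * n%:R) * (n%:R * C_space) * scal s *
    (th `^ ((1 + alpha) / 2) / ((1 + alpha) / 2)))); last first.
  have -> : n%:R * (2 + 2 * n%:R) * (n%:R * C_space) * 2 * scal s * th `^ ((1 + alpha) / 2) =
    n%:R * (2 + 2 * n%:R) * (n%:R * C_space) * scal s * (th `^ ((1 + alpha) / 2) * 2) by ring.
  rewrite ler_wpM2l// ler_wpM2l ?powR_ge0// -[leRHS]invrK lef_pV2 ?posrE ?invr_gt0//; lra.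
apply: (powR_MVT0 (F := fun th => heat th (xi j s) x0) (dF := fun th => heat th (lap eps nu (xi j s)) x0)) => //.
- apply: cvg_at_right_filter; apply: differentiable_continuous; apply/derivable1_diffP.
  exact: (@ex_derive _ _ _ _ _ _ _ (is_derive_heat_time p_sum p_derive (xi j s) 0 x0)).
- by move=> r _; exact: is_derive_heat_time.
move=> r /andP[r0 _]; rewrite -lap_heat lapE normrN.
apply: (le_trans (ler_norm_sum _ _ _)).
have -> : n%:R * (2 + 2 * n%:R) * (n%:R * C_space) * scal s * r `^ ((1 + alpha) / 2 - 1) =
  \sum_(l < n) ((1 + (1 + 2 * n%:R)) * (n%:R * C_space * scal s * r `^ ((1 + alpha) / 2 - 1))).
  by rewrite sumr_const card_ord -[RHS]mulr_natl; ring.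
apply: ler_sum => l _; apply: ler_norm_sqrM; first by rewrite addr_ge0 ?mulr_ge0.
  exact: mulr_ge0 (nC_space_scal_ge0 s cp0) (powR_ge0 _ _).
have -> : D (- eps l) (D (eps l) (heat r (xi j s))) x0 =
    D (- eps l) (heat r (fun y => D (eps l) (xi j s) y - D (eps l) (xi j s) x0)) x0.
  rewrite [D (eps l) (heat _ _)]fdiff_heat !fdiff_heat; congr (heat _ _ _); apply/funext => y.
  by rewrite /fdiff; ring.
apply: (le_trans (heat_gradient p_ge0 p_sum p_0 p_derive _ _ r0 (unit_stepN eps l))).
have h := @dxi_centered l j s r x0 sT r0.
apply: (@le_trans _ _ (r^-1 * ((1 + 2 * n%:R) * (n%:R * C_space * scal s * r `^ (alpha / 2)) ^+ 2))).
  by rewrite ler_wpM2l// invr_ge0 ltW.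
rewrite le_eqVlt; apply/orP; left; apply/eqP.
have -> : (1 + alpha) / 2 - 1 = alpha / 2 + - 2^-1 by field.
rewrite powRD ?(gt_eqF r0) ?implybT// !exprMn.
have -> : (r `^ (- 2^-1)) ^+ 2 = r^-1.
  by rewrite powR_sqr ?(ltW r0)// mulNr mulVf ?pnatr_eq0// powR_inv1// ltW.
by ring.
Qed.

(** Same scheme with no difference applied. [M] enters through time gaps beyond [t0 / 2], where the
    size of [xi] itself is used. *)
Lemma xi_holder_time j (s t0 : R) x0 : 0 < s -> s < t0 -> t0 <= T ->
  `|xi j t0 x0 - xi j s x0| <=
  C_time0 * (scal s + M * s `^ (- (1 + alpha / 2))) * (t0 - s) `^ ((1 + alpha) / 2).
Proof.
move=> s0 st t0T; have a0' := a0; have a1' := a1.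
have t00 : 0 < t0 by exact: lt_trans st.
have t0T' : 0 < t0 <= T by rewrite t00.
have sT : 0 < s <= T by rewrite s0 (le_trans (ltW st)).
have cp0 := cp_gt0 x0 t0T'.
have S0 := scal_ge0 s.
have M1 : 0 <= M * s `^ (- (1 + alpha / 2)) by rewrite mulr_ge0 ?powR_ge0.
set r := t0 - s; have r0 : 0 < r by rewrite subr_gt0.
have rp := powR_ge0 r ((1 + alpha) / 2).
have c1 : 0 <= C_src 0 * 2 by rewrite !mulr_ge0 ?C_src_ge0.
have c2 : 0 <= n%:R * (2 + 2 * n%:R) * (n%:R * C_space) * 2 * (1 + cp).
  apply: mulr_ge0; last by rewrite addr_ge0// ltW.
  exact: nnC_space_ge0.
have [rt|tr] := leP r (t0 / 2); last first.
  apply: (@le_trans _ _ (4 * (M * s `^ (- (1 + alpha / 2))) * r `^ ((1 + alpha) / 2))); last first.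
    rewrite ler_wpM2r// ler_pM//; last by rewrite lerDr.
    exact: ge_addl2 c1 c2.
  apply: (@le_trans _ _ (2 * (M * s `^ (- 2^-1)))).
    apply: (le_trans (ler_normB _ _)).
    have h1 := xi_le j x0 t0T'; have h2 := xi_le j x0 sT.
    have h3 : M * t0 `^ (- 2^-1) <= M * s `^ (- 2^-1).
      rewrite ler_wpM2l// !powRN lef_pV2 ?posrE ?powR_gt0//.
      by rewrite ge0_ler_powR ?nnegrE ?(ltW s0) ?(ltW t00) ?(ltW st)// invr_ge0.
    lra.
  have h : s `^ ((1 + alpha) / 2) <= 2 * r `^ ((1 + alpha) / 2).
    apply: (@le_trans _ _ (t0 `^ ((1 + alpha) / 2))).
      by rewrite ge0_ler_powR ?nnegrE ?(ltW s0) ?(ltW t00) ?(ltW st)//; lra.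
    by apply: powR_far => //; [apply/andP; split; lra|exact: ltW].
  have -> : s `^ (- 2^-1) = s `^ (- (1 + alpha / 2)) * s `^ ((1 + alpha) / 2).
    rewrite -powRD; last by rewrite (gt_eqF s0) implybT.
    by congr (_ `^ _); field.
  have -> : 4 * (M * s `^ (- (1 + alpha / 2))) * r `^ ((1 + alpha) / 2) =
     2 * (M * (s `^ (- (1 + alpha / 2)) * (2 * r `^ ((1 + alpha) / 2)))) by ring.
  by rewrite ler_wpM2l// ler_wpM2l// ler_wpM2l ?powR_ge0.
have b1 : dexp 0 = (1 + alpha) / 2 by rewrite /dexp; field.
have tr : t0 - r = s by rewrite /r subKr.
have E1 : `|heat (abar t0 x0 * r) (xi j s) x0 - xi j t0 x0| <=
    C_src 0 * 2 * (scal s * r `^ ((1 + alpha) / 2)).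
  have := @propag_int0 [::] j t0 r x0 _ _ r0 rt t0T q_0.
  rewrite /= b1 => /(_ ltac:(by []) ltac:(lra)).
  rewrite /propag /= addr0 tr => /le_trans; apply.
  have -> : C_src 0 * (A * B + G) * t0 `^ (- (1 + alpha / 2)) * (r `^ ((1 + alpha) / 2) / ((1 + alpha) / 2)) =
    C_src 0 * (2 / (1 + alpha)) * (((A * B + G) * t0 `^ (- (1 + alpha / 2))) * r `^ ((1 + alpha) / 2)).
    by field; rewrite gt_eqF//; lra.
  apply: ler_pM.
  - rewrite !mulr_ge0 ?C_src_ge0 ?invr_ge0//; lra.
  - by rewrite !mulr_ge0 ?size_ge0 ?powR_ge0.
  - rewrite ler_wpM2l ?C_src_ge0// ler_pdivrMr//; lra.
  - rewrite ler_wpM2r//.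
    apply: (le_trans _ (scal_homo s0 (ltW st))).
    by apply: scal_ge; [exact: size_ge0|exact: size_le].
have E2 : `|heat (abar t0 x0 * r) (xi j s) x0 - xi j s x0| <=
   n%:R * (2 + 2 * n%:R) * (n%:R * C_space) * 2 * (1 + cp) * (scal s * r `^ ((1 + alpha) / 2)).
  have ha := abar_gt0 x0 t0T'; have /andP[_ acp] := abar_bnd x0 t0T'.
  set th := abar t0 x0 * r; have th0 : 0 < th by rewrite mulr_gt0.
  have thp : th `^ ((1 + alpha) / 2) <= (1 + cp) * r `^ ((1 + alpha) / 2).
    by apply: powR_cp; rewrite // ?(ltW th0) ?ler_pM2r//; apply/andP; split; lra.
  apply: (le_trans (heat_xi_time j x0 sT th0)).
  have -> : n%:R * (2 + 2 * n%:R) * (n%:R * C_space) * 2 * (1 + cp) * (scal s * r `^ ((1 + alpha) / 2)) =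
    n%:R * (2 + 2 * n%:R) * (n%:R * C_space) * 2 * scal s * ((1 + cp) * r `^ ((1 + alpha) / 2)) by ring.
  rewrite ler_wpM2l//; exact: mulr_ge0 (nnC_space_ge0 cp0) S0.
have -> : xi j t0 x0 - xi j s x0 =
   - (heat (abar t0 x0 * r) (xi j s) x0 - xi j t0 x0) + (heat (abar t0 x0 * r) (xi j s) x0 - xi j s x0).
  by ring.
apply: (le_trans (ler_normD _ _)); rewrite normrN.
apply: (le_trans (lerD E1 E2)); rewrite -mulrDl -[leRHS]mulrA; apply: ler_pM.
- exact: addr_ge0.
- exact: mulr_ge0.
- exact: ge_addr1.
- by rewrite ler_wpM2r// lerDl.
Qed.

End Duhamel.

(** * Absorption *)

Section Absorption.
Context {R : realType} {L : finZmodType} {n : nat}.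
Variables (eps : 'I_n -> L) (nu : R).
Variables (cm cp T alpha : R).
Hypotheses (n0 : (0 < n)%N) (cm0 : 0 < cm) (cp0 : 0 < cp) (T0 : 0 < T) (alpha01 : 0 < alpha < 1).
Variable q : L -> R.
Hypotheses (q_ge0 : forall x, 0 <= q x) (q_lap : forall x, lap eps nu q x <= 2 * n%:R).
Variables (psi abar g : R -> L -> R) (M A G : R).
Local Notation D := (fdiff nu).
Local Notation xi := (xi eps nu psi).

Hypotheses (A0 : 0 <= A) (G0 : 0 <= G) (M0 : 0 <= M).
Hypothesis abar_bnd : forall (t : R) x, 0 < t <= T -> cm <= abar t x <= cp.
Hypothesis xi_derive : forall j (t : R) x, 0 < t < T ->
  is_derive t 1 (fun s => xi j s x) (D (eps j) (fun y => abar t y * lap eps nu (psi t) y + g t y) x).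
Hypothesis xi_cont : forall j (t : R) x, 0 < t <= T -> xi j s x @[s --> t^'-] --> xi j t x.
Hypothesis abar_holder : forall (s t : R) x z, 0 < s -> s < t -> t <= T ->
  (abar s (x + z) - abar t x) ^+ 2 <= A ^+ 2 * s `^ (- alpha) * (Num.max (t - s) (q z)) `^ alpha.
Hypothesis g_bnd : forall j (t : R) x, 0 < t <= T -> D (eps j) (g t) x ^+ 2 <= G ^+ 2 / t.
Hypothesis xi_bnd : forall j (t : R) x, 0 < t <= T -> xi j t x ^+ 2 <= M ^+ 2 / t.
Hypothesis q_0 : q 0 = 0.
Hypothesis nu0 : 0 < nu.

Definition C_absorb : R := C_dxi (n := n) cm cp T alpha.
(** Makes [C_absorb * abs_scale] at most 1/2 for the absorption, and is itself at most 1/2, so that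
    the scale [la] meets [la^2 <= 1/2]. *)
Definition abs_scale : R := (2 * (1 + C_absorb))^-1.
(** Solving [B <= B / 2 + ...] doubles the coefficient of [M / la]; the 1 accounts for [G]. *)
Definition C_grad : R := 1 + 2 * (1 + 2 / cm) * (abs_scale `^ alpha^-1)^-1.
Definition grad_size : R := C_grad * ((A + 1) `^ alpha^-1 * M + (A + 1)^-1 * G).

Let a0 : 0 < alpha. Proof. by case/andP: alpha01. Qed.
Let a1 : alpha < 1. Proof. by case/andP: alpha01. Qed.

Lemma C_dxi_ge0 : 0 <= C_absorb.
Proof. by rewrite /C_absorb /C_dxi mulr_ge0 ?C_src_ge0// divr_ge0// ltW. Qed.

Lemma abs_scale_gt0 : 0 < abs_scale.
Proof. by rewrite invr_gt0 mulr_gt0// ltr_wpDr ?C_dxi_ge0. Qed.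

Lemma abs_scale_le : abs_scale <= 2^-1.
Proof.
have := C_dxi_ge0 => h; rewrite lef_pV2 ?posrE//; last by rewrite mulr_gt0// ltr_wpDr.
by rewrite -[leLHS]mulr1 ler_wpM2l// lerDl.
Qed.

Lemma C_dxi_scale : C_absorb * abs_scale <= 2^-1.
Proof.
have h := C_dxi_ge0; rewrite /abs_scale ler_pdivrMr ?mulr_gt0 ?ltr_wpDr//.
by rewrite mulKf ?pnatr_eq0// lerDr.
Qed.

Lemma C_grad_ge1 : 1 <= C_grad.
Proof.
rewrite /C_grad lerDl !mulr_ge0 ?invr_ge0 ?powR_ge0 ?addr_ge0 ?mulr_ge0 ?invr_ge0//; exact: ltW.
Qed.

Lemma grad_size_ge0 : 0 <= grad_size.
Proof.
apply: mulr_ge0; first exact: le_trans ler01 C_grad_ge1.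
by rewrite addr_ge0// mulr_ge0// ?powR_ge0// invr_ge0 addr_ge0.
Qed.

Let E := [set y | exists i j t x, 0 < t <= T /\ y = t * `|D (eps i) (xi j t) x|].

(** The bound contains [nu], hence degenerates with the mesh; only its finiteness matters. *)
Let hasE : has_sup E.
Proof.
split.
  exists (T * `|D (eps (Ordinal n0)) (xi (Ordinal n0) T) 0|).
  by exists (Ordinal n0), (Ordinal n0), T, 0; split => //; rewrite T0 lexx.
exists (T * (nu * (M * T `^ 2^-1 * T^-1 * 2))) => _ [i [j [t [x [tT ->]]]]].
have t0 : 0 < t by case/andP: tT.
have tleT : t <= T by case/andP: tT.
have h : t * (M * t `^ (- 2^-1)) <= M * T `^ 2^-1.
  rewrite mulrCA ler_wpM2l// -[X in X * _]powRr1 ?(ltW t0)// -powRD; last by rewrite (gt_eqF t0) implybT.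
  have -> : (1 + - 2^-1 : R) = 2^-1 by field.
  by rewrite ge0_ler_powR ?nnegrE ?invr_ge0 ?(ltW t0) ?(ltW T0).
have h1 := xi_le M0 xi_bnd j (x + eps i) tT; have h2 := xi_le M0 xi_bnd j x tT.
have -> : T * (nu * (M * T `^ 2^-1 * T^-1 * 2)) = nu * (2 * (M * T `^ 2^-1)).
  by field; rewrite (gt_eqF T0).
rewrite /fdiff normrM (ger0_norm (ltW nu0)) mulrCA ler_wpM2l ?(ltW nu0)//.
apply: (@le_trans _ _ (t * (2 * (M * t `^ (- 2^-1))))).
  rewrite ler_wpM2l ?(ltW t0)//; apply: (le_trans (ler_normB _ _)); lra.
by rewrite mulrCA ler_wpM2l.
Qed.

(* The bound [B <= B / 2 + ...] obtained from [dxi_step] at the small scale [la]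
   can be absorbed, the best constant [B] being finite for a fixed lattice. *)
Lemma dxi_bnd_grad_size i j (t : R) x : 0 < t <= T ->
  t * `|D (eps i) (xi j t) x| <= grad_size.
Proof.
move=> tT; pose B := sup E.
have hB i' j' (t' : R) x' : 0 < t' <= T -> t' * `|D (eps i') (xi j' t') x'| <= B.
  by move=> h; apply: ub_le_sup; [exact: hasE.2|exists i', j', t', x'].
have B0 : 0 <= B.
  by apply: le_trans (hB i j t x tT); rewrite mulr_ge0//; case/andP: tT => /ltW.
apply: (le_trans (hB i j t x tT)).
have [p [p1 p2 p3 p4]] := heat_kernel_exists eps nu n0.
have A1 : 0 < A + 1 by rewrite ltr_wpDl.
(* With this scale the coefficient of [B] in [dxi_step] is at most [A / (2 (A + 1)) <= 1/2]. *)
pose la := (abs_scale / (A + 1)) `^ alpha^-1.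
have d0 := abs_scale_gt0.
have dA : 0 < abs_scale / (A + 1) by rewrite divr_gt0.
have la0 : 0 < la by rewrite powR_gt0.
have laa : la `^ alpha = abs_scale / (A + 1).
  by rewrite -powRrM mulVf ?gt_eqF// powRr1// ltW.
have dA2 : abs_scale / (A + 1) <= 2^-1.
  rewrite ler_pdivrMr//; apply: (le_trans abs_scale_le).
  by rewrite -[leLHS]mulr1 ler_wpM2l ?invr_ge0// lerDr.
have la2 : la <= 2^-1.
  apply: (le_trans _ dA2); apply: ge1r_powR.
    by rewrite dA/=; apply: (le_trans dA2); lra.
  by rewrite invf_ge1// ltW.
have la2' : la ^+ 2 <= 2^-1.
  apply: (@le_trans _ _ (2^-1 ^+ 2)); last by rewrite expr2; lra.
  by rewrite ler_sqr ?nnegrE ?invr_ge0// ltW.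
have laE : la^-1 = (abs_scale `^ alpha^-1)^-1 * (A + 1) `^ alpha^-1.
  have -> : la = abs_scale `^ alpha^-1 * (A + 1)^-1 `^ alpha^-1.
    by apply: powRM; [exact: ltW|rewrite invr_ge0 ltW].
  rewrite invfM.
  congr (_ * _); rewrite -powRN -[(A + 1)^-1]powR_inv1 ?(ltW A1)// -powRrM.
  by congr (_ `^ _); rewrite mulrNN mul1r.
have hstep : B <= C_absorb * (abs_scale / (A + 1)) * (A * B + G) + (1 + 2 / cm) * (M / la).
  apply: ge_sup => [|_ [i' [j' [t' [x' [tT' ->]]]]]]; first exact: hasE.1.
  have := @dxi_step _ _ _ eps nu p p1 p2 p3 p4 cm cp T alpha cm0 T0 alpha01 q q_ge0 q_lap
     psi abar g M A B G A0 B0 G0 M0 abar_bnd xi_derive xi_cont abar_holder g_bnd xi_bnd hB i' j' t' la x' tT' q_0 la0 la2'.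
  by rewrite laa.
have h1 : C_absorb * (abs_scale / (A + 1)) * (A * B + G) <= 2^-1 * B + 2^-1 * ((A + 1)^-1 * G).
  have -> : C_absorb * (abs_scale / (A + 1)) * (A * B + G) = C_absorb * abs_scale * (A / (A + 1) * B + (A + 1)^-1 * G).
    by field; rewrite (gt_eqF A1).
  rewrite -mulrDr; apply: ler_pM.
  - by rewrite mulr_ge0 ?C_dxi_ge0 ?(ltW d0).
  - by rewrite addr_ge0// mulr_ge0// ?divr_ge0 ?invr_ge0 ?(ltW A1).
  - exact: C_dxi_scale.
  - rewrite lerD2r -[leRHS]mul1r ler_wpM2r// ler_pdivrMr// mul1r lerDl//.
have h2 : (1 + 2 / cm) * (M / la) = 2^-1 * ((C_grad - 1) * ((A + 1) `^ alpha^-1 * M)).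
  by rewrite laE /C_grad; field; rewrite (gt_eqF cm0) gt_eqF// powR_gt0.
have hC := C_grad_ge1.
have g0 : 0 <= (A + 1)^-1 * G by rewrite mulr_ge0// invr_ge0 ltW.
have m0 : 0 <= (A + 1) `^ alpha^-1 * M by rewrite mulr_ge0// powR_ge0.
rewrite /grad_size; move: h1 h2 hstep g0 m0 hC.
move: (_ * (abs_scale / _) * _) ((A + 1)^-1 * G) ((A + 1) `^ _ * M) => u v w h1 -> hs v0 w0 hC.
nra.
Qed.

End Absorption.

(** * The discrete torus *)

Lemma modN_is_zmod_morphism n N : zmod_morphism (modN N : 'rV[int]_n -> lattice n N).
Proof.
suff hD : {morph (modN N : 'rV[int]_n -> lattice n N) : k l / k + l}.
  move=> k l; apply/eqP; rewrite eq_sym subr_eq -hD subrK//.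
move=> k l; apply/rowP => i; rewrite !mxE.
(* For [N = 0] the coordinates live in a one-point type. *)
case: N => [|N]; first by rewrite ord1 [RHS]ord1.
apply: val_inj => /=; rewrite modnDm.
suff : ((`|((k ord0 i + l ord0 i) %% N.+1)%Z|%N %% N.+1)%N)%:Z =
       (((`|(k ord0 i %% N.+1)%Z|%N + `|(l ord0 i %% N.+1)%Z|%N) %% N.+1)%N)%:Z by move=> [].
by rewrite -!modz_nat PoszD !gez0_abs ?modz_ge0// modz_mod modzDm.
Qed.

HB.instance Definition _ n N := GRing.isZmodMorphism.Build _ _
  (modN N : 'rV[int]_n -> lattice n N) (@modN_is_zmod_morphism n N).

Section Lattice.
Context {n N : nat}.
Hypothesis N0 : (0 < N)%N.
Implicit Types (k l : 'rV[int]_n).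
Local Notation modN := (modN N).

Let NS : N.-1.+1 = N. Proof. exact: prednK. Qed.

Lemma modN_lattice (x : lattice n N) : modN (\row_i (x 0 i : nat)%:Z) = x.
Proof.
apply/rowP => i; rewrite !mxE; apply: val_inj => /=.
have := ltn_ord (x 0 i); move: (nat_of_ord (x 0 i)) => a; rewrite NS => aN.
by rewrite modz_nat absz_nat modn_mod modn_small.
Qed.

Lemma modN_eq k l : modN k = modN l -> exists m : 'rV[int]_n, k = l + m *~ N.
Proof.
move=> kl.
have h i : (k ord0 i = l ord0 i %[mod N])%Z.
  have := congr1 val (congr1 (fun x : lattice n N => x 0 i) kl).
  rewrite !mxE /= NS => /(congr1 Posz).
  by rewrite -!modz_nat !gez0_abs ?modz_ge0 ?modz_mod// eqz_nat -lt0n.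
exists (\row_i ((k ord0 i - l ord0 i) %/ N)%Z); apply/rowP => i.
rewrite -scaler_int !mxE /= intz mulrC divzK; first by rewrite addrC subrK.
by rewrite -eqz_mod_dvd; apply/eqP; exact: h.
Qed.

Lemma sum_pos_unit (k : 'I_n -> int) : \sum_i modN (pos_unit i) *~ k i = modN (\row_i k i).
Proof.
have -> : \row_i k i = \sum_i pos_unit i *~ k i :> 'rV[int]_n.
  apply/rowP => j; rewrite mxE summxE (bigD1 j)//= big1 ?addr0.
    by rewrite -scaler_int !mxE !eqxx mulr1 intz.
  by move=> i ij; rewrite -scaler_int !mxE/= eq_sym (negbTE ij) mulr0.
by rewrite raddf_sum; apply: eq_bigr => i _; rewrite raddfMz.
Qed.

(** Integer valued, so that a shortest representative exists by well-ordering. *)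
Definition normsq k : nat := (\sum_i `|k ord0 i| ^ 2)%N.

Lemma min_rep (x : lattice n N) : exists k, modN k = x /\
  forall l, modN l = x -> (normsq k <= normsq l)%N.
Proof.
have ex : exists m, `[< exists k, modN k = x /\ normsq k = m >].
  by exists (normsq (\row_i (x 0 i : nat)%:Z)); apply/asboolP; exists (\row_i (x 0 i : nat)%:Z); rewrite modN_lattice.
case: (ex_minnP ex) => m /asboolP[k [kx <-]] hm.
exists k; split => // l lx; apply: hm; apply/asboolP; by exists l.
Qed.

Definition rep (x : lattice n N) : 'rV[int]_n := sval (cid (min_rep x)).

Lemma repK x : modN (rep x) = x.
Proof. by rewrite /rep; case: cid => k [/=]. Qed.

Lemma rep_min x l : modN l = x -> (normsq (rep x) <= normsq l)%N.
Proof. by rewrite /rep; case: cid => k [/= _]; exact. Qed.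

Context {R : realType}.
Local Notation Nr := (N%:R : R).

Lemma NrP : 0 < Nr. Proof. by rewrite ltr0n. Qed.

Lemma normsqE k : (normsq k)%:R = \sum_i ((k 0 i)%:~R : R) ^+ 2.
Proof.
rewrite natr_sum; apply: eq_bigr => i _.
by rewrite natrX natr_absz intr_norm real_normK ?num_real.
Qed.

(* Squared distance of [x] to [0] on the torus. *)
Definition sqdist (x : lattice n N) : R := (normsq (rep x))%:R / Nr ^+ 2.

Lemma sqdist_ge0 x : 0 <= sqdist x.
Proof. by rewrite divr_ge0// exprn_ge0// ltW// NrP. Qed.

Lemma sqdist_le l : sqdist (modN l) <= (normsq l)%:R / Nr ^+ 2.
Proof. by rewrite ler_wpM2r ?invr_ge0 ?exprn_ge0 ?(ltW NrP)// ler_nat rep_min. Qed.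

Lemma sqdist_0 : sqdist 0 = 0.
Proof.
apply/eqP; rewrite eq_le sqdist_ge0 andbT -(raddf0 (modN : 'rV[int]_n -> lattice n N)).
apply: (le_trans (sqdist_le _)).
by rewrite normsqE big1 ?mul0r// => i _; rewrite mxE expr0n.
Qed.

(* [sqdist] is semiconcave as a minimum of translates of the square norm. *)
Lemma sqdist_lap x : lap (fun i => modN (pos_unit i)) Nr sqdist x <= 2 * n%:R.
Proof.
have -> : 2 * n%:R = \sum_(i < n) (2 : R) by rewrite sumr_const card_ord mulr_natr.
apply: ler_sum => i _; rewrite -ler_pdivlMl ?exprn_gt0 ?NrP//.
pose k := rep x.
have h1 : sqdist (x + modN (pos_unit i)) <= (normsq (k + pos_unit i))%:R / Nr ^+ 2.
  by rewrite -{1}(repK x) -raddfD; exact: sqdist_le.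
have h2 : sqdist (x - modN (pos_unit i)) <= (normsq (k - pos_unit i))%:R / Nr ^+ 2.
  by rewrite -{1}(repK x) -raddfB; exact: sqdist_le.
have E : (normsq (k + pos_unit i))%:R + (normsq (k - pos_unit i))%:R = 2 * (normsq k)%:R + 2 :> R.
  rewrite !normsqE mulr_sumr -big_split/=.
  rewrite (bigD1 i)//= [in RHS](bigD1 i)//= !mxE !eqxx /= rmorphD rmorphB /=.
  rewrite (eq_bigr (fun j => 2 * (k 0 j)%:~R ^+ 2)); first by ring.
  by move=> j ji; rewrite !mxE /= (negbTE ji) mulr0n oppr0 !addr0; ring.
apply: (le_trans (lerB (lerD h1 h2) (lexx _))).
rewrite -mulrDl E /sqdist -/k le_eqVlt; apply/orP; left; apply/eqP; field.
by rewrite gt_eqF// NrP.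
Qed.

Lemma sqdist_step (e : lattice n N) m : unit_step (fun i => modN (pos_unit i)) e ->
  sqdist (e *+ m) <= (m%:R / Nr) ^+ 2.
Proof.
have h i : (normsq (pos_unit i *+ m) = m ^ 2)%N.
  rewrite /normsq (bigD1 i)//= big1 ?addn0 => [|j ji].
    by rewrite mulmxnE mxE !eqxx /= (_ : 1 *+ m = m%:Z)// -natz.
  by rewrite mulmxnE mxE /= (negbTE ji) mul0rn.
have hN i : (normsq (- (pos_unit i *+ m)) = m ^ 2)%N.
  by rewrite -(h i); apply: eq_bigr => j _; rewrite mxE abszN.
rewrite exprMn -natrX exprVn.
case=> i [->|->]; rewrite -?mulNrn -?raddfN -raddfMn; apply: (le_trans (sqdist_le _)).
  by rewrite h.
by rewrite mulNrn hN.
Qed.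

Lemma sqdist_rep x : exists2 k : 'I_n -> int, x = \sum_i modN (pos_unit i) *~ k i &
  forall i, (`|k i|%N%:R / Nr) ^+ 2 <= sqdist x.
Proof.
exists (fun i => rep x 0 i) => [|i].
  rewrite sum_pos_unit -[LHS](repK x); congr (modN _); apply/rowP => i; by rewrite mxE.
rewrite exprMn exprVn ler_wpM2r ?invr_ge0 ?exprn_ge0 ?(ltW NrP)//.
by rewrite -natrX ler_nat /normsq (bigD1 i)//= leq_addr.
Qed.

(** The shortest representative of [z] provides one of the translates over which the infimum is
    taken. *)
Lemma torus_dist_emb (x z : lattice n N) :
  torus_dist (emb (x + z)) (emb x : 'rV[R]_n) <= Num.sqrt (sqdist z).
Proof.
set w : lattice n N := x + z.
have [m hm] : exists m : 'rV[int]_n, rep z + \row_i (x 0 i : nat)%:Z = (\row_i (w 0 i : nat)%:Z) + m *~ N.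
  by apply: modN_eq; rewrite raddfD/= repK !modN_lattice addrC.
clearbody w.
have hi i : rep z 0 i + (nat_of_ord (x 0 i))%:Z = (nat_of_ord (w 0 i))%:Z + N%:Z * m 0 i.
  have := congr1 (fun v : 'rV[int]_n => v 0 i) hm.
  by rewrite -(scaler_int N m) !mxE intz.
have -> : Num.sqrt (sqdist z) = eucl (emb w - emb x + map_mx intr m : 'rV[R]_n).
  rewrite /eucl /sqdist normsqE mulr_suml; congr (Num.sqrt _); apply: eq_bigr => i _.
  have := congr1 (fun a : int => a%:~R : R) (hi i).
  rewrite !mxE !rmorphD rmorphM /= => h.
  have -> : (rep z 0 i)%:~R = (nat_of_ord (w 0 i))%:R + N%:R * (m 0 i)%:~R - (nat_of_ord (x 0 i))%:R :> R.
    by apply/eqP; rewrite eq_sym subr_eq eq_sym; apply/eqP.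
  by field; rewrite gt_eqF// NrP.
apply: ge_inf; last by exists m.
by exists 0 => _ [k _ <-]; exact: sqrtr_ge0.
Qed.

End Lattice.

(** * Interpolation *)

Section Coupling.
Context {R : realType}.

(* Comonotone coupling of two Bernoulli variables of parameters [x] and [y]. *)
Definition cpl (x y : R) (p : bool * bool) : R :=
  let m := Num.min x y in
  match p with
  | (true, true) => m
  | (true, false) => x - m
  | (false, true) => y - m
  | (false, false) => 1 - x - y + m
  end.

Definition bern (x : R) (b : bool) : R := if b then x else 1 - x.

Lemma sum_bool2 (F : bool * bool -> R) :
  \sum_p F p = F (true, true) + F (true, false) + F (false, true) + F (false, false).
Proof.
rewrite (eq_bigr (fun p => F (p.1, p.2))) => [|[]]//.
by rewrite -(pair_bigA _ (fun a b => F (a, b))) big_bool/= !big_bool/= !addrA.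
Qed.

Lemma cpl_ge0 x y p : 0 <= x < 1 -> 0 <= y < 1 -> 0 <= cpl x y p.
Proof.
by move=> /andP[x0 x1] /andP[y0 y1]; case: p => [[] []]; rewrite /cpl; have [] := leP x y; lra.
Qed.

Lemma cpl_marg1 x y b : \sum_(p | p.1 == b) cpl x y p = bern x b.
Proof.
rewrite big_mkcond sum_bool2 /=; case: b => /=; rewrite /bern ?eqxx /=; lra.
Qed.

Lemma cpl_marg2 x y b : \sum_(p | p.2 == b) cpl x y p = bern y b.
Proof.
rewrite big_mkcond sum_bool2 /=; case: b => /=; rewrite /bern ?eqxx /=; lra.
Qed.

Lemma cpl_sum x y : \sum_p cpl x y p = 1.
Proof. rewrite sum_bool2 /=; lra. Qed.

Definition jump (a b : R) (p : bool * bool) : int :=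
  (Num.floor a + (p.1 : nat)%:Z) - (Num.floor b + (p.2 : nat)%:Z).

Definition frac (a : R) : R := a - (Num.floor a)%:~R.

Lemma frac_itv a : 0 <= frac a < 1.
Proof.
have /andP[h1] := floor_itv a; rewrite intrD => h2; rewrite /frac; apply/andP; split; lra.
Qed.

(** Under this coupling the jump never changes sign, so its mean absolute value is the absolute
    value of its mean, which is [a - b]. *)
Lemma cpl_jump a b :
  \sum_p cpl (frac a) (frac b) p * `|jump a b p|%N%:R <= `|a - b|.
Proof.
have ea : a = (Num.floor a)%:~R + frac a by rewrite /frac addrC subrK.
have eb : b = (Num.floor b)%:~R + frac b by rewrite /frac addrC subrK.
have /andP[x0 x1] := frac_itv a; have /andP[y0 y1] := frac_itv b.
rewrite sum_bool2 !natr_absz !intr_norm /jump !intrD ?intrN !intrD /=.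
move: x0 x1 y0 y1 ea eb; move: (frac a) (frac b) => x y x0 x1 y0 y1.
have [E|[H|H]] : Num.floor a = Num.floor b \/ (Num.floor a + 1 <= Num.floor b) \/
    (Num.floor b + 1 <= Num.floor a) by lia.
- rewrite -E; move: (Num.floor a) => k ea eb.
  have -> : k%:~R + 1%:~R - (k%:~R + 1%:~R) = 0 :> R by ring.
  have -> : k%:~R + 1%:~R - (k%:~R + 0%:~R) = 1 :> R by ring.
  have -> : k%:~R + 0%:~R - (k%:~R + 1%:~R) = -1 :> R by ring.
  have -> : k%:~R + 0%:~R - (k%:~R + 0%:~R) = 0 :> R by ring.
  rewrite normrN normr1 normr0 ea eb.
  have -> : k%:~R + x - (k%:~R + y) = x - y by ring.
  by have [xy|xy] := leP x y; [rewrite distrC|]; rewrite ger0_norm; lra.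
- have : (Num.floor a)%:~R + 1 <= (Num.floor b)%:~R :> R.
    by rewrite -[1](mulr1z 1) -intrD ler_int.
  move: (Num.floor a)%:~R (Num.floor b)%:~R => k l kl ea eb.
  rewrite ![`|_|]ler0_norm ?ea ?eb; lra.
- have : (Num.floor b)%:~R + 1 <= (Num.floor a)%:~R :> R.
    by rewrite -[1](mulr1z 1) -intrD ler_int.
  move: (Num.floor a)%:~R (Num.floor b)%:~R => k l kl ea eb.
  rewrite ![`|_|]ger0_norm ?ea ?eb; lra.
Qed.

(** Linearization of the power at [|a - b| / nu]; the 2 is 1 plus the normalized mean jump. For
    [a = b], every jump has size or probability 0. *)
Lemma cpl_jump_powR (a b nu alpha : R) : 0 < nu -> 0 < alpha < 1 ->
  \sum_p cpl (frac a) (frac b) p * (`|jump a b p|%N%:R / nu) `^ alpha <=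
  2 * (`|a - b| / nu) `^ alpha.
Proof.
move=> nu0 /andP[a0 a1].
have c0 p : 0 <= cpl (frac a) (frac b) p by rewrite cpl_ge0 ?frac_itv.
have [E|ab] := eqVneq a b.
  rewrite big1 ?mulr_ge0 ?powR_ge0// => p _.
  have := cpl_jump a b; rewrite {3}E subrr normr0 => h.
  have s0 : \sum_p cpl (frac a) (frac b) p * `|jump a b p|%N%:R = 0.
    by apply/eqP; rewrite eq_le h sumr_ge0// => p' _; rewrite mulr_ge0.
  have /eqP := psumr_eq0P (fun p' _ => mulr_ge0 (c0 p') (ler0n R _)) s0 (i := p) isT.
  rewrite mulf_eq0 => /orP[/eqP->|/eqP->]; first by rewrite mul0r.
  by rewrite mul0r powR0 ?mulr0// gt_eqF.
have d0 : 0 < `|a - b| / nu by rewrite divr_gt0// normr_gt0 subr_eq0.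
set d := `|a - b| / nu in d0 *.
apply: (@le_trans _ _ (\sum_p (d `^ alpha * (cpl (frac a) (frac b) p + cpl (frac a) (frac b) p * `|jump a b p|%N%:R / (nu * d))))).
  apply: ler_sum => p _.
  have := @powR_le_affine R (`|jump a b p|%N%:R / nu) d alpha d0 (divr_ge0 (ler0n _ _) (ltW nu0)).
  rewrite (ltW a0) (ltW a1) => /(_ isT) h.
  apply: (le_trans (ler_wpM2l (c0 p) h)).
  rewrite le_eqVlt; apply/orP; left; apply/eqP; field.
  by rewrite (gt_eqF d0) (gt_eqF nu0).
rewrite -mulr_sumr big_split/= cpl_sum mulrC ler_wpM2r ?powR_ge0// -mulr_suml.
suff : (\sum_p cpl (frac a) (frac b) p * `|jump a b p|%N%:R) / (nu * d) <= 1 by lra.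
have e : nu * d = `|a - b| by rewrite /d mulrC divfK// gt_eqF.
by rewrite e ler_pdivrMr ?mul1r ?cpl_jump// normr_gt0 subr_eq0.
Qed.

End Coupling.

Section ProductCoupling.
Context {R : realType} {n : nat}.

(** Image of a product measure under a coordinatewise map. Used with [fst] and [snd], it writes two
    interpolations as averages over the same coupled roundings. *)
Lemma prod_marg (I J : finType) (K : finType) (c : K -> I -> R) (f : I -> J) (th : K -> J -> R)
  (U : {ffun K -> J} -> R) :
  (forall k j, \sum_(i | f i == j) c k i = th k j) ->
  \sum_(w : {ffun K -> I}) (\prod_k c k (w k)) * U [ffun k => f (w k)] =
  \sum_(v : {ffun K -> J}) (\prod_k th k (v k)) * U v.
Proof.
move=> hth; rewrite (partition_big (fun w : {ffun K -> I} => [ffun k => f (w k)]) xpredT)//=.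
apply: eq_bigr => v _.
rewrite (eq_bigr (fun w : {ffun K -> I} => (\prod_k c k (w k)) * U v)); last by move=> w /eqP->.
rewrite -mulr_suml; congr (_ * _).
under [RHS]eq_bigr do rewrite -hth.
rewrite bigA_distr_big_dep; apply: eq_bigl => w.
apply/eqP/familyP => [<- k|h]; first by rewrite unfold_in/= ffunE eqxx.
by apply/ffunP => k; rewrite ffunE; apply/eqP; have := h k; rewrite unfold_in.
Qed.

Lemma prod_marg1 (I K : finType) (c : K -> I -> R) (l : K) (phi : I -> R) :
  (forall k, \sum_i c k i = 1) ->
  \sum_(w : {ffun K -> I}) (\prod_k c k (w k)) * phi (w l) = \sum_i c l i * phi i.
Proof.
move=> hc; pose c' k i := if k == l then c k i * phi i else c k i.
transitivity (\sum_(w : {ffun K -> I}) \prod_k c' k (w k)).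
  apply: eq_bigr => w _; rewrite (bigD1 l)//= [in RHS](bigD1 l)//= /c' eqxx mulrAC; congr (_ * _).
  by apply: eq_bigr => k /negbTE->.
rewrite -bigA_distr_bigA/= (bigD1 l)//= /c' eqxx [X in _ * X]big1 ?mulr1// => k /negbTE kl.
by rewrite kl hc.
Qed.

End ProductCoupling.

Section Interp.
Context {R : realType} {n N : nat}.
Hypothesis N0 : (0 < N)%N.
Local Notation Nr := (N%:R : R).
Local Notation modN := (modN N).
Implicit Types (u : R -> lattice n N -> R) (z y : 'rV[R]_n).

Definition corner z (v : {ffun 'I_n -> bool}) : lattice n N :=
  modN (\row_i (Num.floor (N%:R * z 0 i) + (v i : nat)%:Z)).

(** [vartheta] is the Bernoulli weight of rounding a coordinate up, so interpolation is the mean of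
    [u] at a random corner. *)
Lemma interpE u t z : interp u t z =
  \sum_(v : {ffun 'I_n -> bool}) (\prod_i bern (frac (Nr * z 0 i)) (v i)) * u t (corner z v).
Proof. by []. Qed.

Lemma prod_bern_ge0 z v : 0 <= \prod_(i < n) bern (frac (Nr * z 0 i)) (v i).
Proof.
apply: prodr_ge0 => i _; have /andP[h1 h2] := frac_itv (Nr * z 0 i).
by rewrite /bern; case: (v i); lra.
Qed.

Lemma sum_prod_bern z : \sum_(v : {ffun 'I_n -> bool}) \prod_(i < n) bern (frac (Nr * z 0 i)) (v i) = 1.
Proof.
rewrite -(bigA_distr_bigA (fun i b => bern (frac (Nr * z 0 i)) b)) big1// => i _.
by rewrite big_bool/= /bern addrC subrK.
Qed.

Lemma interp_bnd u t z (K : R) : (forall x, `|u t x| <= K) -> `|interp u t z| <= K.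
Proof.
move=> uK; rewrite interpE; apply: (le_trans (ler_norm_sum _ _ _)).
have -> : K = \sum_(v : {ffun 'I_n -> bool}) (\prod_(i < n) bern (frac (Nr * z 0 i)) (v i)) * K.
  by rewrite -mulr_suml sum_prod_bern mul1r.
apply: ler_sum => v _.
by rewrite normrM ger0_norm ?prod_bern_ge0// ler_wpM2l ?prod_bern_ge0.
Qed.

(** The function on the right is constant in time, so the time 0 is arbitrary; two different times
    can thus be compared by [interp_bnd]. *)
Lemma interpB u u' t s z : interp u t z - interp u' s z = interp (fun=> fun x => u t x - u' s x) 0 z.
Proof. by rewrite !interpE -sumrB; apply: eq_bigr => v _; rewrite mulrBr. Qed.

Lemma interp_shift u t z (e : 'rV[int]_n) :
  interp u t (z + Nr^-1 *: map_mx intr e) = interp (fun t x => u t (x + modN e)) t z.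
Proof.
have h i : Nr * (z + Nr^-1 *: map_mx intr e) 0 i = Nr * z 0 i + (e 0 i)%:~R.
  by rewrite !mxE mulrDr mulVKf// pnatr_eq0 -lt0n.
have hf i : Num.floor (Nr * z 0 i + (e 0 i)%:~R) = Num.floor (Nr * z 0 i) + e 0 i.
  by rewrite floorDrz ?intr_int// intrKfloor.
rewrite !interpE; apply: eq_bigr => v _; congr (_ * u t _).
  by apply: eq_bigr => i _; rewrite h /frac hf intrD; congr (bern _ _); ring.
rewrite /corner -raddfD; congr (modN _); apply/rowP => i.
by rewrite [LHS]mxE h hf !mxE addrAC.
Qed.

Lemma nabla_interp u t z (e : 'rV[int]_n) :
  nabla N e (interp u) (t, z) = interp (fun t => nablaN e (u t)) t z.
Proof.
rewrite /nabla /= interp_shift interpB !interpE mulr_sumr; apply: eq_bigr => v _.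
by rewrite /nablaN mulrCA.
Qed.

Lemma modN_mulz (k : 'rV[int]_n) : modN (k *~ N) = 0.
Proof.
apply/rowP => i; rewrite !mxE; apply: val_inj => /=.
rewrite (_ : (k *~ N) ord0 i = k 0 i * N%:Z) ?modzMl ?mod0n//.
by rewrite -scaler_int mxE intz mulrC.
Qed.

Lemma interp_periodic u t z (k : 'rV[int]_n) : interp u t (z + map_mx intr k) = interp u t z.
Proof.
have -> : map_mx intr k = Nr^-1 *: map_mx intr (k *~ N) :> 'rV[R]_n.
  apply/rowP => i; rewrite -scaler_int !mxE intz intrM mulKf//.
  by rewrite pnatr_eq0 -lt0n.
by rewrite interp_shift modN_mulz; rewrite !interpE; apply: eq_bigr => v _; rewrite addr0.
Qed.

Lemma interp_emb u t (x : lattice n N) : interp u t (emb x) = u t x.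
Proof.
have -> : emb x = 0 + Nr^-1 *: map_mx intr (\row_i (nat_of_ord (x 0 i))%:Z) :> 'rV[R]_n.
  by apply/rowP => i; rewrite !mxE add0r mulrC.
rewrite interp_shift interpE (bigD1 [ffun=> false])//= [X in _ + X]big1 ?addr0.
  rewrite big1 => [|i _]; last by rewrite !mxE mulr0 /frac floor0 subr0 ffunE /bern subr0.
  rewrite mul1r modN_lattice// /corner (_ : \row_i _ = 0) ?raddf0 ?add0r//.
  by apply/rowP => i; rewrite !mxE mulr0 floor0 ffunE.
move=> v hv; have [i vi] : exists i, v i.
  apply/existsP; rewrite -[[exists _, _]]negbK negb_exists; apply: contra hv => /forallP h.
  by apply/eqP/ffunP => i; rewrite ffunE; apply/negbTE.
by rewrite (bigD1 i)//= vi !mxE mulr0 /frac floor0 subr0 /bern !mul0r.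
Qed.

Variable (alpha : R).
Hypothesis alpha01 : 0 < alpha < 1.

Lemma interp_holder_eucl u t (H : R) z y : 0 <= H ->
  (forall x (k : 'rV[int]_n), `|u t (x + modN k) - u t x| <= H * \sum_l (`|k ord0 l|%N%:R / Nr) `^ alpha) ->
  `|interp u t z - interp u t y| <= 2 * n%:R * H * eucl (z - y) `^ alpha.
Proof.
move=> H0 hu; have Np : 0 < Nr by rewrite ltr0n.
have /andP[a0 a1] := alpha01.
pose c (i : 'I_n) := cpl (frac (Nr * z 0 i)) (frac (Nr * y 0 i)).
have c0 i p : 0 <= c i p by rewrite cpl_ge0 ?frac_itv.
rewrite !interpE.
rewrite -(prod_marg (c := c) (f := fst) (fun v => u t (corner z v)) (fun k j => cpl_marg1 _ _ j)).
rewrite -(prod_marg (c := c) (f := snd) (fun v => u t (corner y v)) (fun k j => cpl_marg2 _ _ j)).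
rewrite -sumrB.
pose J (w : {ffun 'I_n -> bool * bool}) l := jump (Nr * z 0 l) (Nr * y 0 l) (w l).
apply: (@le_trans _ _ (\sum_(w : {ffun 'I_n -> bool * bool}) (\prod_k c k (w k)) *
     (H * \sum_l (`|J w l|%N%:R / Nr) `^ alpha))).
  apply: (le_trans (ler_norm_sum _ _ _)); apply: ler_sum => w _.
  have w0 : 0 <= \prod_k c k (w k) by apply: prodr_ge0.
  rewrite -mulrBr normrM ger0_norm// ler_wpM2l//.
  have -> : corner z [ffun k => (w k).1] = corner y [ffun k => (w k).2] + modN (\row_l J w l).
    rewrite /corner -raddfD; congr (modN _); apply/rowP => i.
    by rewrite !mxE !ffunE /J /jump [RHS]addrC subrK.
  apply: (le_trans (hu _ _)); rewrite ler_wpM2l//; apply: ler_sum => l _.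
  by rewrite mxE.
under eq_bigr do rewrite mulrCA mulr_sumr.
rewrite -mulr_sumr exchange_big/=.
have -> : 2 * n%:R * H * eucl (z - y) `^ alpha = H * \sum_(l < n) (2 * eucl (z - y) `^ alpha).
  by rewrite sumr_const card_ord -mulr_natl; ring.
rewrite ler_wpM2l//; apply: ler_sum => l _.
rewrite (prod_marg1 l (fun p => (`|jump (Nr * z ord0 l) (Nr * y ord0 l) p|%N%:R / Nr) `^ alpha)); last first.
  by move=> k; exact: cpl_sum.
apply: (le_trans (cpl_jump_powR _ _ Np alpha01)).
rewrite ler_wpM2l// ge0_ler_powR ?nnegrE ?(ltW a0) ?sqrtr_ge0 ?divr_ge0 ?(ltW Np)//.
rewrite -mulrBr normrM (ger0_norm (ltW Np)) mulrC mulKf ?gt_eqF//.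
rewrite -sqrtr_sqr /eucl ler_sqrt; last by apply: sumr_ge0 => i _; exact: sqr_ge0.
rewrite (bigD1 l)//= !mxE lerDl; apply: sumr_ge0 => i _; exact: sqr_ge0.
Qed.

(** By periodicity the Euclidean bound holds for every translate. Taking the power [1 / alpha] first
    lets the infimum be used without being attained. *)
Lemma interp_holder u t (H : R) z y : 0 <= H ->
  (forall x (k : 'rV[int]_n), `|u t (x + modN k) - u t x| <= H * \sum_l (`|k ord0 l|%N%:R / Nr) `^ alpha) ->
  `|interp u t z - interp u t y| <= 2 * n%:R * H * torus_dist z y `^ alpha.
Proof.
move=> H0 hu; have /andP[a0 a1] := alpha01.
set K := 2 * n%:R * H; set d := `|_|.
have K0 : 0 <= K by rewrite !mulr_ge0.
have h (k : 'rV[int]_n) : d <= K * eucl (z - y + map_mx intr k) `^ alpha.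
  rewrite /d -(interp_periodic u t z k) -[_ - y + _]addrAC.
  exact: interp_holder_eucl.
have td0 : 0 <= torus_dist z y.
  apply: lb_le_inf; first by exists (eucl (z - y + map_mx intr 0)); exists 0.
  by move=> _ [k _ <-]; exact: sqrtr_ge0.
have [K1|K1] := eqVneq K 0.
  by have := h 0; rewrite K1 !mul0r.
have {}K0 : 0 < K by rewrite lt_neqAle eq_sym K1.
rewrite -ler_pdivrMl//.
have d0 : 0 <= K^-1 * d by rewrite mulr_ge0 ?invr_ge0 ?(ltW K0)// normr_ge0.
have -> : K^-1 * d = ((K^-1 * d) `^ alpha^-1) `^ alpha.
  by rewrite -powRrM mulVf ?gt_eqF// powRr1.
rewrite ge0_ler_powR ?nnegrE ?powR_ge0 ?(ltW a0)//.
apply: lb_le_inf; first by exists (eucl (z - y + map_mx intr 0)); exists 0.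
move=> _ [k _ <-].
have e0 := sqrtr_ge0 (\sum_i (z - y + map_mx intr k) 0 i ^+ 2).
have -> : eucl (z - y + map_mx intr k) = (eucl (z - y + map_mx intr k) `^ alpha) `^ alpha^-1.
  by rewrite -powRrM mulfV ?gt_eqF// powRr1.
rewrite ge0_ler_powR ?nnegrE ?powR_ge0 ?invr_ge0 ?(ltW a0)//.
by rewrite ler_pdivrMl.
Qed.

End Interp.

(** * The norms *)

Section TimeDerivative.
Context {R : realType}.
Variables (T : R) (f : R -> R) (t l : R).

Let near_quotient : is_time_deriv T f t l -> forall e, 0 < e ->
  exists2 d, 0 < d & forall s, `|s - t| < d -> s != t -> 0 <= s <= T ->
    `|l - (f s - f t) / (s - t)| < e.
Proof.
move=> /cvgrPdist_lt h e e0; have [d /= d0 hd] := h e e0.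
exists d => // s st sNt sT; apply: (hd s) => //=; first by rewrite distrC.
Qed.

Lemma is_time_deriv_interior : 0 < t < T -> is_time_deriv T f t l -> is_derive t 1 f l.
Proof.
move=> /andP[t0 tT] /near_quotient h.
have cv : h^-1 *: ((f \o shift t) (h *: 1) - f t) @[h --> (0:R)^'] --> l.
  apply/cvgrPdist_lt => e e0; have [d d0 hd] := h e e0.
  exists (Num.min d (Num.min t (T - t))) => /=.
    by rewrite !lt_min d0 t0 subr_gt0.
  move=> k /=; rewrite sub0r normrN !lt_min => /andP[kd /andP[kt kT]] k0.
  have /= := hd (k + t); rewrite addrK => /(_ kd).
  rewrite -subr_eq0 addrK k0 => /(_ isT) hk.
  rewrite /GRing.scale/= mulr1 mulrC; apply: hk.
  by move: kt kT; rewrite !ltr_norml => /andP[k1 k2] /andP[k3 k4]; apply/andP; split; lra.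
by apply: DeriveDef; [exact: cvgP cv|exact: cvg_lim cv].
Qed.

Lemma is_time_deriv_left_cont : 0 < t <= T -> is_time_deriv T f t l -> f s @[s --> t^'-] --> f t.
Proof.
move=> /andP[t0 tT] /near_quotient h.
apply/cvgrPdist_lt => e e0; have [d d0 hd] := h 1 ltr01.
have l1 : 0 < `|l| + 1 by rewrite ltr_wpDl.
exists (Num.min d (Num.min t (e / (`|l| + 1)))) => /=.
  by rewrite !lt_min d0 t0 divr_gt0.
move=> s /=; rewrite !lt_min => /andP[sd /andP[st se]] sltt.
have hs : `|l - (f s - f t) / (s - t)| < 1.
  apply: hd; rewrite 1?distrC ?lt_eqF//.
  by move: st; rewrite ltr_norml => /andP[k1 k2]; apply/andP; split; lra.
have qb : `|(f s - f t) / (s - t)| <= `|l| + 1.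
  rewrite -[X in `|X|](subKr l); apply: (le_trans (ler_normB _ _)).
  by rewrite lerD2l ltW.
rewrite distrC -[f s - f t](divfK (x := s - t)); last by rewrite subr_eq0 lt_eqF.
rewrite normrM; apply: (le_lt_trans (ler_wpM2r (normr_ge0 _) qb)).
by rewrite mulrC -ltr_pdivlMr// distrC.
Qed.

End TimeDerivative.

(** * Passage between pointwise lattice bounds and the norms *)

Section Transfer.
Context {R : realType} {n N : nat}.
Variables (T alpha : R).
Hypotheses (N0 : (0 < N)%N) (n0 : (0 < n)%N) (T0 : 0 < T) (alpha01 : 0 < alpha < 1).
Local Notation Nr := (N%:R : R).

Let a0 : 0 < alpha. Proof. by case/andP: alpha01. Qed.
Let a1 : alpha < 1. Proof. by case/andP: alpha01. Qed.

Lemma sqrt_powR (x a : R) : 0 <= x -> Num.sqrt x `^ a = x `^ (a / 2).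
Proof. by move=> x0; rewrite -powR12_sqrt// -powRrM; congr (_ `^ _); rewrite mulrC. Qed.

Lemma holder_starN_ge0 (abar : R -> lattice n N -> R) Abar :
  (holder_starN T alpha abar <= Abar%:E)%E -> 0 <= Abar.
Proof.
move=> h; pose P := (((0, 0), (T, 0)) : (R * lattice n N) * (R * lattice n N)).
have PA : offdiag (OmegaN T) P.
  split; rewrite /OmegaN/= ?lexx ?(ltW T0)//.
  by move=> [] /eqP; rewrite eq_sym gt_eqF.
have := le_trans (ereal_sup_ubound (ex_intro2 _ _ P PA erefl)) h.
rewrite lee_fin; apply: le_trans.
by rewrite mulr_ge0 ?powR_ge0// divr_ge0 ?powR_ge0.
Qed.

Lemma holder_starN_bnd (abar : R -> lattice n N -> R) Abar (s t : R) x z :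
  (holder_starN T alpha abar <= Abar%:E)%E -> 0 < s -> s < t -> t <= T ->
  (abar s (x + z) - abar t x) ^+ 2 <=
    Abar ^+ 2 * s `^ (- alpha) * (Num.max (t - s) (sqdist N0 z)) `^ alpha.
Proof.
move=> h s0 st tT; have A0 := holder_starN_ge0 h.
pose P := (((s, x + z), (t, x)) : (R * lattice n N) * (R * lattice n N)).
have t0 : 0 < t by exact: lt_trans st.
have PA : offdiag (OmegaN T) P.
  split; rewrite /OmegaN/= ?(ltW s0) ?(ltW t0)//=; first by rewrite (le_trans (ltW st)).
  by move=> [] /eqP; rewrite lt_eqF.
have := le_trans (ereal_sup_ubound (ex_intro2 _ _ P PA erefl)) h.
rewrite lee_fin /P /dmin /dpar /parab_dist /=.
rewrite min_l; last by rewrite ler_wsqrtr// ltW.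
set pd := Num.max _ _; set W := `|_|; set Q := Num.max (t - s) (sqdist N0 z).
have Q0 : 0 <= Q by rewrite le_max subr_ge0 (ltW st).
have pQ : pd <= Num.sqrt Q.
  rewrite /pd ge_max; apply/andP; split.
    by rewrite distrC ger0_norm ?subr_ge0 ?(ltW st)// ler_wsqrtr// le_max lexx.
  by apply: (le_trans (torus_dist_emb _ _ _)); rewrite ler_wsqrtr// le_max lexx orbT.
(* Positivity comes from [s < t] alone, so nothing has to be known about the zeros of
   [torus_dist]. *)
have p0 : 0 < pd by rewrite lt_max sqrtr_gt0 normr_gt0 subr_eq0 lt_eqF.
have sa : 0 < Num.sqrt s `^ alpha by rewrite powR_gt0// sqrtr_gt0.
rewrite mulrA ler_pdivrMr ?powR_gt0// mulrC -ler_pdivlMr// => hW.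
have hW' : W <= Abar * Num.sqrt Q `^ alpha / Num.sqrt s `^ alpha.
  apply: (le_trans hW); rewrite ler_wpM2r ?invr_ge0 ?(ltW sa)// ler_wpM2l//.
  by rewrite ge0_ler_powR ?nnegrE ?(ltW p0) ?(ltW a0) ?sqrtr_ge0.
have -> : Abar ^+ 2 * s `^ (- alpha) * Q `^ alpha = (Abar * Num.sqrt Q `^ alpha / Num.sqrt s `^ alpha) ^+ 2.
  rewrite !exprMn exprVn !powR_sqr ?sqrtr_ge0// !sqrt_powR ?(ltW s0)// powRN.
  by rewrite mulfK ?pnatr_eq0//; ring.
rewrite -(real_normK (num_real _)) ler_sqr ?nnegrE//.
by apply: le_trans hW'; exact: normr_ge0.
Qed.

Lemma grad_sup1N_bnd (g : R -> lattice n N -> R) G i (t : R) x :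
  (grad_sup1N T g <= G%:E)%E -> 0 <= t <= T ->
  Num.sqrt t * `|nablaN (pos_unit i) (g t) x| <= G.
Proof.
move=> h tT; rewrite -lee_fin; apply: le_trans h.
rewrite /grad_sup1N /=.
apply: le_trans (le_bigmax _ _ i); rewrite le_max; apply/orP; left.
by apply: ereal_sup_ubound; exists (t, x).
Qed.

Lemma U2_le (xi : 'I_n -> R -> lattice n N -> R) (B : R) : 0 <= B ->
  (forall i j (t : R) x, 0 < t <= T -> t * `|nablaN (pos_unit i) (xi j t) x| <= B) ->
  (U2 T xi <= B%:E)%E.
Proof.
move=> B0 hB; apply: bigmax_le => [|i _]; first exact: leNye.
apply: bigmax_le => [|j _]; first exact: leNye.
apply: ge_ereal_sup => _ [[t z] [/= /andP[t0 tT] _] <-].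
rewrite lee_fin /dpar/= sqr_sqrtr// nabla_interp//.
move: t0; rewrite le_eqVlt => /orP[/eqP<-|t0]; first by rewrite mul0r.
rewrite mulrC -ler_pdivlMr//; apply: interp_bnd => x.
by rewrite ler_pdivlMr// mulrC; apply: hB; rewrite t0.
Qed.

Definition min_time (t s : R) : R := Num.min t s `^ (- (1 + alpha / 2)).

Lemma min_time_l t s : 0 < t -> 0 < s -> t `^ (- (1 + alpha / 2)) <= min_time t s.
Proof.
move=> t0 s0; have a0' := a0.
rewrite /min_time !powRN lef_pV2 ?posrE ?powR_gt0 ?lt_min ?t0//.
by rewrite ge0_ler_powR ?nnegrE ?le_min ?ge_min ?lexx ?(ltW t0) ?(ltW s0)//; lra.
Qed.

Lemma dmin_powR (S : Type) (P : (R * S) * (R * S)) : 0 < P.1.1 -> 0 < P.2.1 ->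
  dmin P `^ (2 + alpha) * min_time P.1.1 P.2.1 = 1.
Proof.
move=> t0 s0; rewrite /dmin /dpar /min_time.
have -> : Num.min (Num.sqrt P.1.1) (Num.sqrt P.2.1) = Num.sqrt (Num.min P.1.1 P.2.1).
  by have [ts|ts] := leP P.1.1 P.2.1; [rewrite min_l|rewrite min_r]; rewrite ?ler_wsqrtr// ltW.
have m0 : 0 < Num.min P.1.1 P.2.1 by rewrite lt_min t0.
rewrite sqrt_powR ?(ltW m0)// -powRD; last by rewrite (gt_eqF m0) implybT.
have -> : (2 + alpha) / 2 - (1 + alpha / 2) = 0 by field.
by rewrite powRr0.
Qed.

(** At time 0 the weight kills the quotient, whatever the functions do there. *)
Lemma dmin_eq0 (S : Type) (P : (R * S) * (R * S)) :
  0 <= P.1.1 -> 0 <= P.2.1 -> ~~ ((0 < P.1.1) && (0 < P.2.1)) -> dmin P `^ (2 + alpha) = 0.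
Proof.
move=> t0 s0 h.
have -> : dmin P = 0.
  rewrite /dmin /dpar; apply/eqP; rewrite eq_le le_min !sqrtr_ge0/= andbT ge_min.
  by move: h; rewrite negb_and -!leNgt => /orP[]/ler0_sqrtr->; rewrite lexx ?orbT.
by rewrite powR0// gt_eqF//; have := a0; lra.
Qed.

Lemma time_sym (F : R -> R) (K p : R) : 0 < p -> 0 <= K ->
  (forall s t : R, 0 < s -> s < t -> t <= T -> `|F t - F s| <= K * s `^ (- (1 + alpha / 2)) * (t - s) `^ p) ->
  forall s t : R, 0 < s <= T -> 0 < t <= T -> `|F t - F s| <= K * min_time t s * `|t - s| `^ p.
Proof.
move=> b0 K0 h s t /andP[s0 sT] /andP[t0 tT].
have [st|ts|->] := ltgtP s t.
- have -> : `|t - s| = t - s by rewrite ger0_norm// subr_ge0 ltW.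
  apply: (le_trans (h _ _ s0 st tT)).
  by rewrite ler_wpM2r ?powR_ge0// ler_wpM2l// /min_time minC min_time_l.
- have -> : `|t - s| = s - t by rewrite distrC ger0_norm// subr_ge0 ltW.
  rewrite distrC; apply: (le_trans (h _ _ t0 ts sT)).
  by rewrite ler_wpM2r ?powR_ge0// ler_wpM2l// min_time_l.
- by rewrite subrr normr0 !mulr_ge0 ?powR_ge0.
Qed.

Lemma holder1_le (xi : R -> lattice n N -> R) (Hs Ht : R) : 0 <= Hs -> 0 <= Ht ->
  (forall i (t : R) x (k : 'rV[int]_n), 0 < t <= T ->
    `|nablaN (pos_unit i) (xi t) (x + modN N k) - nablaN (pos_unit i) (xi t) x| <=
    Hs * t `^ (- (1 + alpha / 2)) * \sum_l (`|k ord0 l|%N%:R / Nr) `^ alpha) ->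
  (forall i (s t : R) x, 0 < s -> s < t -> t <= T ->
    `|nablaN (pos_unit i) (xi t) x - nablaN (pos_unit i) (xi s) x| <=
    Ht * s `^ (- (1 + alpha / 2)) * (t - s) `^ (alpha / 2)) ->
  (holder1 N T alpha (interp xi) <= (2 * n%:R * Hs + Ht)%:E)%E.
Proof.
move=> Hs0 Ht0 hS hT; have a0' := a0.
apply: ge_ereal_sup => _ [P [[/= /andP[t0 tT] _] [/= /andP[s0 sT] _] _] <-].
rewrite lee_fin; set K := _ + Ht.
have K0 : 0 <= K by rewrite addr_ge0// !mulr_ge0.
have [/andP[t1 s1]|h] := boolP ((0 < P.1.1) && (0 < P.2.1)); last first.
  by rewrite dmin_eq0// mul0r.
have m0 := powR_ge0 (Num.min P.1.1 P.2.1) (- (1 + alpha / 2)).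
have tT' : 0 < P.1.1 <= T by rewrite t1. have sT' : 0 < P.2.1 <= T by rewrite s1.
suff H : nabla_dist N (interp xi) P.1 P.2 <= K * min_time P.1.1 P.2.1 * parab_dist P.1 P.2 `^ alpha.
  set d := dmin P `^ _; set pd := parab_dist P.1 P.2 `^ alpha in H *.
  have d0 : 0 <= d by exact: powR_ge0.
  have : nabla_dist N (interp xi) P.1 P.2 / pd <= K * min_time P.1.1 P.2.1.
    (* If the distance vanishes, the quotient is 0 by the convention on division. *)
    have [->|pd0] := eqVneq pd 0; first by rewrite invr0 mulr0 mulr_ge0.
    by rewrite ler_pdivrMr// lt_neqAle eq_sym pd0 powR_ge0.
  move=> /(ler_wpM2l d0) /le_trans; apply.
  by rewrite mulrCA dmin_powR// mulr1.
apply: bigmax_le => [|i _]; first by rewrite !mulr_ge0 ?powR_ge0.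
rewrite [P.1]surjective_pairing [P.2]surjective_pairing !nabla_interp//=.
move: t0 tT s0 sT t1 s1 m0 tT' sT'; case: P => [[t z] [s y]] /= t0 tT s0 sT t1 s1 m0 tT' sT'.
set v := fun t => nablaN (pos_unit i) (xi t).
have -> : interp v t z - interp v s y = (interp v t z - interp v t y) + (interp v t y - interp v s y).
  by rewrite subrKA.
apply: (le_trans (ler_normD _ _)).
have pdE : 0 <= torus_dist z y.
  apply: lb_le_inf; first by exists (eucl (z - y + map_mx intr 0)); exists 0.
  by move=> _ [k _ <-]; exact: sqrtr_ge0.
have p1 : torus_dist z y `^ alpha <= parab_dist (t, z) (s, y) `^ alpha.
  by rewrite ge0_ler_powR ?nnegrE ?(ltW a0)// /parab_dist/= le_max ?lexx ?orbT// pdE orbT.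
have p2 : `|t - s| `^ (alpha / 2) <= parab_dist (t, z) (s, y) `^ alpha.
  rewrite -sqrt_powR// ge0_ler_powR ?nnegrE ?(ltW a0) ?sqrtr_ge0// /parab_dist/= le_max ?lexx ?sqrtr_ge0//.
have h1 : `|interp v t z - interp v t y| <= 2 * n%:R * Hs * min_time t s * parab_dist (t, z) (s, y) `^ alpha.
  apply: (le_trans (interp_holder N0 alpha01 z y (H := Hs * min_time t s) _ _)).
  - by rewrite mulr_ge0.
  - move=> x k; apply: (le_trans (hS i t x k tT')).
    apply: ler_wpM2r; first by apply: sumr_ge0 => l _; exact: powR_ge0.
    by rewrite ler_wpM2l// min_time_l.
  - by rewrite !mulrA ler_wpM2l// !mulr_ge0.
have h2 : `|interp v t y - interp v s y| <= Ht * min_time t s * parab_dist (t, z) (s, y) `^ alpha.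
  rewrite interpB; apply: interp_bnd => x.
  apply: (@le_trans _ _ (Ht * min_time t s * `|t - s| `^ (alpha / 2))); last first.
    by rewrite ler_wpM2l// mulr_ge0.
  apply: (time_sym (F := fun t => v t x)) => //; first by rewrite divr_gt0.
  by move=> s' t' s'0 s't' t'T; apply: hT.
apply: (le_trans (lerD h1 h2)).
by rewrite -!mulrDl.
Qed.

Lemma time_holder1N_le (F : R -> lattice n N -> R) (K : R) : 0 <= K ->
  (forall (s t : R) x, 0 < s -> s < t -> t <= T ->
    `|F t x - F s x| <= K * s `^ (- (1 + alpha / 2)) * (t - s) `^ ((1 + alpha) / 2)) ->
  (time_holder1N T alpha F <= K%:E)%E.
Proof.
move=> K0 hF; have a0' := a0.
apply: ge_ereal_sup => _ [P [[/= /andP[t0 tT] /andP[s0 sT] PN] /= Pe] <-].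
rewrite lee_fin.
have [/andP[t1 s1]|h] := boolP ((0 < P.1.1) && (0 < P.2.1)); last first.
  by rewrite dmin_eq0// mul0r.
have tT' : 0 < P.1.1 <= T by rewrite t1. have sT' : 0 < P.2.1 <= T by rewrite s1.
set d := dmin P `^ _; have d0 : 0 <= d by exact: powR_ge0.
have m0 := powR_ge0 (Num.min P.1.1 P.2.1) (- (1 + alpha / 2)).
have h : `|F P.1.1 P.1.2 - F P.2.1 P.2.2| / `|P.1.1 - P.2.1| `^ ((1 + alpha) / 2) <= K * min_time P.1.1 P.2.1.
  set pd := _ `^ _; have [->|pd0] := eqVneq pd 0; first by rewrite invr0 mulr0 mulr_ge0.
  rewrite ler_pdivrMr ?lt_neqAle 1?eq_sym ?pd0 ?powR_ge0// -Pe.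
  apply: (time_sym (F := fun t => F t P.1.2)) => //; first by lra.
  by move=> s' t' s'0 s't' t'T; apply: hF.
apply: (le_trans (ler_wpM2l d0 h)).
by rewrite mulrCA dmin_powR// mulr1.
Qed.

Lemma norm1_0_ge (xi : 'I_n -> R -> lattice n N -> R) i (t : R) x : 0 <= t <= T ->
  ((Num.sqrt t * `|xi i t x|)%:E <= norm1_0 T xi)%E.
Proof.
move=> tT; apply: le_trans (le_bigmax _ _ i).
apply: ereal_sup_ubound; exists (t, emb x); last by rewrite /= interp_emb.
split => //= j; rewrite mxE divr_ge0//= ltr_pdivrMr ?ltr0n// mul1r ltr_nat.
exact: leq_trans (ltn_ord (x 0 j)) (eq_leq (prednK N0)).
Qed.

End Transfer.

(** * Collecting the constants *)

Section Constants.
Context {R : realType} {n : nat}.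
Variables (cm cp T alpha : R).
Hypotheses (cm0 : 0 < cm) (cp0 : 0 < cp) (T0 : 0 < T) (alpha01 : 0 < alpha < 1).

Lemma C_time1_ge0 : 0 <= C_time1 (n := n) cm cp T alpha.
Proof.
have /andP[a0 _] := alpha01.
have c1 : 0 <= C_src (n := n) cm cp T 1 * (2 / alpha).
  by rewrite !mulr_ge0 ?C_src_ge0 ?invr_ge0// ltW.
rewrite /C_time1; apply: addr_ge0; first exact: addr_ge0.
by apply: mulr_ge0; [exact: nC_space_ge0|rewrite addr_ge0// ltW].
Qed.

Lemma C_time0_ge0 : 0 <= C_time0 (n := n) cm cp T alpha.
Proof.
rewrite /C_time0; apply: addr_ge0.
  by rewrite addr_ge0// mulr_ge0 ?C_src_ge0.
by apply: mulr_ge0; [exact: nnC_space_ge0|rewrite addr_ge0// ltW].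
Qed.

Definition C_holder : R :=
  2 * n%:R * C_space (n := n) cm cp T alpha + C_time1 (n := n) cm cp T alpha.

Lemma C_holder_ge0 : 0 <= C_holder.
Proof.
rewrite /C_holder addr_ge0 ?C_time1_ge0//.
by apply: mulr_ge0; [rewrite mulr_ge0|exact: C_space_ge0].
Qed.

(** The second differences and the two Hoelder parts are each measured by at most [C_grad + 1] times
    the final right-hand side; the last term serves the extra [M] in the time seminorm. *)
Definition C_schauder : R :=
  (C_grad (n := n) cm cp T alpha + 1) * (1 + C_holder + C_time0 (n := n) cm cp T alpha)
  + C_time0 (n := n) cm cp T alpha.

Lemma C_schauder_ge : C_grad (n := n) cm cp T alpha <= C_schauder.
Proof.
have := C_time0_ge0; have := C_holder_ge0; have := @C_grad_ge1 _ n _ cp T alpha cm0.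
rewrite /C_schauder; move: (C_grad _ _ _ _) C_holder (C_time0 _ _ _ _) => x y z; nra.
Qed.

(** Since [S1 = (A + 1) B + G], the factor [A + 1] raises the exponent [1 / alpha] of [B] to
    [1 + 1 / alpha] and cancels the [(A + 1)^-1] in front of [G]. *)
Lemma size_sum_le (A M G B S1 : R) : 0 <= A -> 0 <= M -> 0 <= G ->
  B = grad_size (n := n) cm cp T alpha M A G -> S1 = A * B + B + G ->
  B + C_holder * S1 + C_time0 (n := n) cm cp T alpha * (S1 + M) <=
  C_schauder * ((A + 1) `^ (1 + alpha^-1) * M + G).
Proof.
move=> A0 M0 G0 BE S1E.
have /andP[a0 _] := alpha01.
have B0 : 0 <= B by rewrite BE grad_size_ge0.
have S10 : 0 <= S1 by rewrite S1E; exact: addr_ge0 (addr_ge0 (mulr_ge0 A0 B0) B0) G0.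
have A1 : 0 < A + 1 by rewrite ltr_wpDl.
set Z := (A + 1) `^ (1 + alpha^-1) * M + G; set Cg := C_grad (n := n) cm cp T alpha.
have Cg1 : 1 <= Cg := C_grad_ge1 cp T alpha cm0.
have pE : (A + 1) `^ (1 + alpha^-1) = (A + 1) * (A + 1) `^ alpha^-1.
  by rewrite powRD ?(gt_eqF A1) ?implybT// powRr1// ltW.
have SZ : S1 <= (Cg + 1) * Z.
  have -> : S1 = Cg * Z + G.
    by rewrite S1E BE /Z /grad_size -/Cg pE; field; rewrite (gt_eqF A1).
  rewrite [leRHS]mulrDl [1 * Z]mul1r lerD2l /Z lerDr; exact: mulr_ge0 (powR_ge0 _ _) M0.
have MZ : M <= Z.
  have : 1 <= (A + 1) `^ (1 + alpha^-1).
    have h : (A + 1) `^ 0 <= (A + 1) `^ (1 + alpha^-1).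
      by apply: ler_powR; rewrite ?lerDr// addr_ge0// invr_ge0 ltW.
    by rewrite powRr0 in h.
  move=> h; rewrite /Z; apply: (@le_trans _ _ ((A + 1) `^ (1 + alpha^-1) * M)).
    by rewrite -[leLHS]mul1r ler_wpM2r.
  by rewrite lerDl.
have BS : B <= S1 by rewrite S1E addrAC lerDr addr_ge0 ?(mulr_ge0 A0 B0).
have := C_holder_ge0.
have := C_time0_ge0.
rewrite /C_schauder -/Cg.
move: SZ MZ BS Cg1 S10 M0; move: Z Cg C_holder (C_time0 _ _ _ _) => z c h t.
move=> sz mz bs c1 s0 m0 t0 h0.
have e1 : h * S1 <= h * ((c + 1) * z) by rewrite ler_wpM2l.
have e2 : t * S1 <= t * ((c + 1) * z) by rewrite ler_wpM2l.
have e3 : t * M <= t * z by rewrite ler_wpM2l.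
have -> : ((c + 1) * (1 + h + t) + t) * z = (c + 1) * z + h * ((c + 1) * z) + t * ((c + 1) * z) + t * z by ring.
rewrite mulrDr; lra.
Qed.

End Constants.

(** * The estimates on the discrete torus *)

Section LatticeEstimate.
Context {R : realType} {n N : nat}.
Variables (cm cp T alpha : R).
Hypotheses (N0 : (0 < N)%N) (n0 : (0 < n)%N) (cm0 : 0 < cm) (cp0 : 0 < cp) (T0 : 0 < T)
  (alpha01 : 0 < alpha < 1).
Variables (psi abar g : R -> lattice n N -> R) (A M G : R).
Hypothesis sol : solves_system T abar g (grad_family psi).
Hypothesis abar_bnd : forall (t : R) x, 0 <= t <= T -> cm <= abar t x <= cp.
Hypothesis abar_holder : (holder_starN T alpha abar <= A%:E)%E.
Hypothesis g_bnd : (grad_sup1N T g <= G%:E)%E.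
Hypothesis xi_bnd : forall i (t : R) x, 0 <= t <= T -> Num.sqrt t * `|grad_family psi i t x| <= M.
Local Notation eps := (fun i : 'I_n => modN N (pos_unit i)).
Local Notation Nr := (N%:R : R).

Let a0 : 0 < alpha. Proof. by case/andP: alpha01. Qed.
Let A0 : 0 <= A. Proof. exact: holder_starN_ge0 abar_holder. Qed.
Let TT : 0 <= T <= T. Proof. by rewrite lexx ltW. Qed.

Let G0 : 0 <= G.
Proof.
apply: le_trans (grad_sup1N_bnd (Ordinal n0) 0 g_bnd TT).
by rewrite mulr_ge0 ?sqrtr_ge0.
Qed.

Let M0 : 0 <= M.
Proof.
apply: le_trans (xi_bnd (Ordinal n0) 0 TT).
by rewrite mulr_ge0 ?sqrtr_ge0.
Qed.

(** The adjoint differences of the gradient of [psi] add up to [- lap psi], and this sign cancels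
    the one in the system. *)
Let sol' j (t : R) x : 0 < t <= T -> is_time_deriv T (fun s => xi eps Nr psi j s x) t
  (fdiff Nr (eps j) (fun y => abar t y * lap eps Nr (psi t) y + g t y) x).
Proof.
move=> tT; have := @sol j t x tT; congr (is_time_deriv T _ t _).
have E y : \sum_(k < n) nablaN_adj (pos_unit k) (grad_family psi k t) y = - lap eps Nr (psi t) y.
  rewrite lapE opprK; apply: eq_bigr => k _.
  by rewrite /nablaN_adj /nablaN /fdiff raddfN.
rewrite /nablaN /fdiff !E; ring.
Qed.

Let abar_bnd' (t : R) x : 0 < t <= T -> cm <= abar t x <= cp.
Proof. by move=> /andP[t0 tT]; apply: abar_bnd; rewrite ltW. Qed.

Let xi_derive j (t : R) x : 0 < t < T -> is_derive t 1 (fun s => xi eps Nr psi j s x)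
  (fdiff Nr (eps j) (fun y => abar t y * lap eps Nr (psi t) y + g t y) x).
Proof.
move=> /andP[t0 tT]; apply: (is_time_deriv_interior (T := T)); first by rewrite t0.
by apply: sol'; rewrite t0 ltW.
Qed.

Let xi_cont j (t : R) x : 0 < t <= T -> xi eps Nr psi j s x @[s --> t^'-] --> xi eps Nr psi j t x.
Proof. by move=> tT; exact: (@is_time_deriv_left_cont R T (fun s => xi eps Nr psi j s x) t _ tT (@sol' j t x tT)). Qed.

Let sqrt_bnd (t y K : R) : 0 < t -> Num.sqrt t * `|y| <= K -> y ^+ 2 <= K ^+ 2 / t.
Proof.
move=> t0 h; rewrite ler_pdivlMr// -(real_normK (num_real y)).
have -> : `|y| ^+ 2 * t = (Num.sqrt t * `|y|) ^+ 2.
  by rewrite exprMn sqr_sqrtr ?(ltW t0)// mulrC.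
by rewrite ler_sqr ?nnegrE ?mulr_ge0 ?sqrtr_ge0// (le_trans _ h)// mulr_ge0 ?sqrtr_ge0.
Qed.

Let g_bnd' j (t : R) x : 0 < t <= T -> fdiff Nr (eps j) (g t) x ^+ 2 <= G ^+ 2 / t.
Proof.
move=> /andP[t0 tT]; apply: sqrt_bnd => //.
by apply: (grad_sup1N_bnd j x g_bnd); rewrite ltW.
Qed.

Let xi_bnd' j (t : R) x : 0 < t <= T -> xi eps Nr psi j t x ^+ 2 <= M ^+ 2 / t.
Proof. by move=> /andP[t0 tT]; apply: sqrt_bnd => //; apply: xi_bnd; rewrite ltW. Qed.

Local Notation B := (grad_size (n := n) cm cp T alpha M A G).
Local Notation q := (sqdist N0 (R := R)).

Let Np : 0 < Nr. Proof. by rewrite ltr0n. Qed.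

Let abar_holder' := fun s t x z => @holder_starN_bnd R n N T alpha N0 T0 alpha01 abar A s t x z abar_holder.

Lemma dxi_grad_size i j (t : R) x : 0 < t <= T ->
  t * `|nablaN (pos_unit i) (grad_family psi j t) x| <= B.
Proof.
exact: (@dxi_bnd_grad_size R _ n eps Nr cm cp T alpha n0 cm0 cp0 T0 alpha01 q
  (sqdist_ge0 N0) (sqdist_lap N0) psi abar g M A G A0 G0 M0 abar_bnd' xi_derive xi_cont
  abar_holder' g_bnd' xi_bnd' (sqdist_0 N0) Np i j t x).
Qed.

Let B0 : 0 <= B := grad_size_ge0 cp T alpha cm0 A0 G0 M0.

Local Notation S1 := (A * B + B + G).

Let S10 : 0 <= S1. Proof. exact: addr_ge0 (addr_ge0 (mulr_ge0 A0 B0) B0) G0. Qed.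

Lemma U2_grad_size : (U2 T (grad_family psi) <= B%:E)%E.
Proof. by apply: U2_le => // i j t x; exact: dxi_grad_size. Qed.

Lemma holder1_size j : (holder1 N T alpha (interp (grad_family psi j)) <=
   (C_holder (n := n) cm cp T alpha * S1)%:E)%E.
Proof.
have [p [p1 p2 p3 p4]] := heat_kernel_exists eps Nr n0.
have -> : C_holder (n := n) cm cp T alpha * S1 =
   2 * n%:R * (C_space (n := n) cm cp T alpha * S1) + C_time1 (n := n) cm cp T alpha * S1.
  by rewrite /C_holder; ring.
apply: holder1_le => //.
- by rewrite mulr_ge0 ?C_space_ge0.
- by rewrite mulr_ge0 ?C_time1_ge0.
- move=> i t x k tT.
  have := @dxi_holder_sum R _ n eps Nr p p1 p2 p3 p4 cm cp T alpha cm0 T0 alpha01 q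
    (sqdist_ge0 N0) (sqdist_lap N0) psi abar g A B G A0 B0 G0 abar_bnd' xi_derive xi_cont
    abar_holder' g_bnd' dxi_grad_size (sqdist_0 N0) (sqdist_step N0) Np i j t x (fun l => k ord0 l) tT.
  rewrite sum_pos_unit (_ : \row_i k ord0 i = k) ?mulrA//.
  by apply/rowP => l; rewrite mxE.
- move=> i s t x s0 st tT.
  have := @dxi_holder_time R _ n eps Nr p p1 p2 p3 p4 cm cp T alpha cm0 T0 alpha01 q
    (sqdist_ge0 N0) (sqdist_lap N0) psi abar g A B G A0 B0 G0 abar_bnd' xi_derive xi_cont
    abar_holder' g_bnd' dxi_grad_size (sqdist_0 N0) (sqdist_step N0) Np (sqdist_rep N0) i j s t x s0 st tT.
  by rewrite /scal !mulrA.
Qed.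

Lemma time_holder_size j : (time_holder1N T alpha (grad_family psi j) <=
   (C_time0 (n := n) cm cp T alpha * (S1 + M))%:E)%E.
Proof.
have [p [p1 p2 p3 p4]] := heat_kernel_exists eps Nr n0.
apply: (time_holder1N_le alpha01 (mulr_ge0 (C_time0_ge0 cm0 cp0 T0 alpha01) (addr_ge0 S10 M0))).
move=> s t x s0 st tT.
have := @xi_holder_time R _ n eps Nr p p1 p2 p3 p4 cm cp T alpha cm0 T0 alpha01 q
    (sqdist_ge0 N0) (sqdist_lap N0) psi abar g M A B G A0 B0 G0 M0 abar_bnd' xi_derive xi_cont
    abar_holder' g_bnd' xi_bnd' dxi_grad_size (sqdist_0 N0) (sqdist_step N0) Np (sqdist_rep N0) j s t x s0 st tT.
by rewrite /scal -mulrDl !mulrA.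
Qed.

End LatticeEstimate.

Theorem theorem5p5 (R : realType) (n : nat) (cm cp T alpha : R)
    (hn : (0 < n)%N) (hcm : 0 < cm) (hcmp : cm < cp) (hT : 0 < T)
    (halpha : 0 < alpha < 1) :
  exists C : R, 0 < C /\
  forall (N : nat) (psi abar g : R -> lattice n N -> R) (Abar G : R),
    (0 < N)%N ->
    solves_system T abar g (grad_family psi) ->
    (forall x : lattice n N, {within `[0, T], continuous (fun t => g t x)}) ->
    (forall t x, 0 <= t <= T -> cm <= abar t x <= cp) ->
    (holder_starN T alpha abar <= Abar%:E)%E ->
    (grad_sup1N T g <= G%:E)%E ->
    (norm1_1alpha T alpha (grad_family psi)
       <= C%:E * (((Abar + 1) `^ (1 + alpha^-1))%:E
                    * norm1_0 T (grad_family psi) + G%:E))%E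
    /\
    (U2 T (grad_family psi)
       <= C%:E * (((Abar + 1) `^ alpha^-1)%:E
                    * norm1_0 T (grad_family psi) + ((Abar + 1)^-1 * G)%:E))%E.
Proof.
have cp0 : 0 < cp by exact: lt_trans hcmp.
have Cg1 := @C_grad_ge1 R n cm cp T alpha hcm.
have Cge := @C_schauder_ge R n cm cp T alpha hcm cp0 hT halpha.
have C0 : 0 < C_schauder (n := n) cm cp T alpha.
  by apply: lt_le_trans Cge; apply: lt_le_trans Cg1.
exists (C_schauder (n := n) cm cp T alpha); split => //.
move=> N psi abar g A G N0 sol _ abnd ahol gbnd.
have A0 := holder_starN_ge0 hT ahol.
have A1 : 0 < A + 1 by rewrite ltr_wpDl.
have TT : 0 <= T <= T by rewrite lexx ltW.
have G0 : 0 <= G.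
  apply: le_trans (grad_sup1N_bnd (Ordinal hn) 0 gbnd TT).
  by rewrite mulr_ge0 ?sqrtr_ge0.
have nge := norm1_0_ge (T := T) N0 (grad_family psi).
(* An infinite norm makes both right-hand sides infinite, as the powers of [A + 1] are positive; the
   value [-oo] is excluded because [0 < n]. *)
case E : (norm1_0 T (grad_family psi)) nge => [M||] nge.
- have xb i t x : 0 <= t <= T -> Num.sqrt t * `|grad_family psi i t x| <= M.
    by move=> tT; rewrite -lee_fin; exact: nge.
  have M0 : 0 <= M.
    by apply: le_trans (xb (Ordinal hn) T 0 TT); rewrite mulr_ge0 ?sqrtr_ge0.
  have u2 := U2_grad_size N0 hn hcm cp0 hT halpha sol abnd ahol gbnd xb.
  have fold (c a b : R) : (c%:E * (a%:E * M%:E + b%:E))%E = (c * (a * M + b))%:E by [].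
  rewrite !fold; split; last first.
    apply: (le_trans u2); rewrite lee_fin /grad_size ler_wpM2r//.
    by rewrite addr_ge0// mulr_ge0 ?powR_ge0 ?invr_ge0// ltW.
  have := @size_sum_le R n cm cp T alpha hcm cp0 hT halpha A M G _ _ A0 M0 G0 erefl erefl.
  rewrite -lee_fin; apply: le_trans.
  rewrite /norm1_1alpha !EFinD; apply: leeD; first apply: leeD => //.
    apply: bigmax_le => [|j _]; first exact: leNye.
    exact (holder1_size N0 hn hcm cp0 hT halpha sol abnd ahol gbnd xb j).
  apply: bigmax_le => [|j _]; first exact: leNye.
  exact (time_holder_size N0 hn hcm cp0 hT halpha sol abnd ahol gbnd xb j).
- have top (c a b : R) : 0 < c -> 0 < a -> (c%:E * (a%:E * +oo + b%:E))%E = +oo%E.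
    move=> c0 a0; have -> : (a%:E * +oo)%E = +oo%E by apply: gt0_muley; rewrite lte_fin.
    by rewrite addye// gt0_muley// lte_fin.
  by rewrite !top ?powR_gt0// !leey.
- by have := nge (Ordinal hn) T 0 TT; rewrite leeNy_eq.
Qed.
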